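(* The absolute-invariant ring $\mathcal{A}_D=(\mathcal{R}[D^{-1}])_0$ is generated as a $k$-algebra by the fourteen functions $$U_1,\ U_2,\ 3U_3,\ U_4,\ U_5,\ U_6,\qquad \frac{Q_g}{D^{m_g}}\quad(g=e_2,p_{02},p_{12},p_{03},w_2,w_{21},w_{12},w_{03})$$ defined in the context. After restriction to the normalized slice $\{(F,G_0):F\in V_5\}$ with $G_0=xy(x-y)$, this is a minimal homogeneous generating set of $k[V_5]^\Gamma$, with degree pattern: one generator of degree $1$ ($U_1$), four of degree $2$ ($U_2$, $U_4$, $Q_{e_2}/D^{m_{e_2}}$, $Q_{p_{02}}/D^{m_{p_{02}}}$), five of degree $3$ ($3U_3$, $U_5$ and $Q_g/D^{m_g}$ for $g=p_{12},p_{03},w_2$), and four of degree $4$ ($U_6$ and $Q_g/D^{m_g}$ for $g=w_{21},w_{12},w_{03}$).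
   Context: $k$ is an algebraically closed field of characteristic zero, $V_n$ is the space of binary forms of order (degree) $n$ in $x,y$ over $k$, and $\mathrm{SL}_2(k)$ acts on pairs $(F,G)\in V_5\oplus V_3$ by simultaneous linear substitution of variables. $\mathcal{R}=k[V_5\oplus V_3]^{\mathrm{SL}_2}$, graded by total degree; $(\mathcal{R}[D^{-1}])_0$ is the degree-zero part of the localization. $\Gamma\simeq S_3$ is the group of elements of $\mathrm{PGL}_2(k)$ preserving $\{0,1,\infty\}$, generated by $r(z)=1/(1-z)$ and $s(z)=1-z$, acting linearly on $V_5$ by $r:F\mapsto-F(x-y,x)$, $s:F\mapsto-F(-x+y,y)$; degrees on the slice are degrees in the coefficients of $F$. Transvectants: for binary forms $A,B$ of orders $m,n$, $$(A,B)_r=\frac{(m-r)!(n-r)!}{m!\,n!}\sum_{j=0}^r(-1)^j\binom rj\frac{\partial^rA}{\partial x^{r-j}\partial y^j}\frac{\partial^rB}{\partial x^j\partial y^{r-j}}.$$ Covariants: $H=(F,F)_2$, $i=(F,F)_4$, $t=(F,H)_1$, $c_{3,5}=(i,F)_1$, $c_{3,3}=(i,F)_2$; $h=(G,G)_2$, $q=(G,h)_1$, $D=(h,h)_2$. Joint invariants: $A=(F,Gh)_5$, $L=(F,hq)_5$, $B_1=(i,h)_2$, $B_2=(H,G^2)_6$, $M=(H,Gq)_6$, $N=(H,q^2)_6$, $R=(c_{3,3},G)_3$, $S_1=(c_{3,3},q)_3$, $S_2=(c_{3,5},Gh)_5$, $S_3=(t,G^3)_9$, $T_1=(c_{3,5},hq)_5$,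 $T_2=(t,G^2q)_9$, $T_3=(F^3,G^5)_{15}$, $W=(F^3,G^4q)_{15}$. $U_i=P_i/(c_iD^{m_i})$ with $(c_1,\dots,c_6)=(3,54,20432412,18,2270268,27027)$, $(m_1,\dots,m_6)=(1,3,4,3,4,6)$ and $P_1=700A$; $P_2=5^3\bigl(98010L^2+190080DN+47045DA^2+97000D^2B_2-19224D^2B_1\bigr)$; $P_3=5^5\bigl(63868314510AL^2+49446437040DLM+148589040600DAN+31976059115DA^3+560560D^2T_3-164989440D^2T_2-45305310960D^2T_1+98893534740D^2AB_2-39968032104D^2AB_1+7720750752D^3R\bigr)$; $P_4=-5\bigl(632610L^2+803520DN+165385DA^2+552680D^2B_2-98424D^2B_1\bigr)$; $P_5=-5^3\bigl(216453026790AL^2+514942187760DLM+493336803960DAN+112492234855DA^3+83523440D^2T_3-16672803840D^2T_2-290479054320D^2T_1+491566054980D^2AB_2-218716874376D^2AB_1-12670582496D^3R\bigr)$; $P_6=-5^6\bigl(67988850930L^4+197785748160DL^2N+33952803885DA^2L^2-560560D^2LW+79622318160D^2L^2B_2-39182280984D^2L^2B_1+19394519760D^2ALM-82457760D^3LS_3+21320456220D^3LS_2+9857393568D^3LS_1\bigr)$. The $Q_g$ (subscripts $g$ are labels), with exponents $m_g=3,3,4,4,4,6,6,6$ for $g=e_2,p_{02},p_{12},p_{03},w_2,w_{21},w_{12},w_{03}$: $Q_{e_2}=264600L^2$; $Q_{p_{02}}=\frac1{30}\bigl(4083210L^2+D(2453760N+581405A^2+D(2687080B_2-835416B_1))\bigr)$;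 $Q_{p_{12}}=\frac{5}{756756}\bigl(133383920670AL^2+D(4587439736880LM+1869573265560AN+407613761555A^3+D(12444992560T_3-1305564986880T_2-1725889117680T_1+2239075899060AB_2-1153318029864AB_1-289845437024DR))\bigr)$; $Q_{p_{03}}=\frac1{252252}\bigl(1459163675970AL^2-D(7553317852080LM+2899790613720AN+648701088035A^3+D(370860778288T_3-3781089607680T_2-1987532754480T_1+2085082539540AB_2-1274048816040AB_1-459131079264DR))\bigr)$; $Q_{w_2}=49392000L(DM-AL)$; $Q_{w_{21}}=\frac{625}{9009}L\bigl(438837128730L^3+982935233280DLN+215194604625DA^2L-83523440D^2W+526319806320D^2LB_2-178109310456D^2LB_1-22314544560D^2AM-8330894880D^3S_3+75289456620D^3S_2+99761875488D^3S_1\bigr)$; $Q_{w_{12}}=\frac{25}{3003}L\bigl(-2832494194530L^3-4448817172800DLN-1081547792325DA^2L+12444992560D^2W-3200034111120D^2LB_2+914989205592D^2LB_1-8471509200D^2AM+651961944480D^3S_3-291086990460D^3S_2-664047594144D^3S_1\bigr)$; $Q_{w_{03}}=\frac1{1001}L\bigl(18282462528330L^3+16479966222720DLN+3176968579785DA^2L-1854303891440D^2W+18276219284400D^2LB_2-5198207741496D^2LB_1+4876420626000D^2AM-9330462224160D^3S_3+1385837078220D^3S_2+3660996971808D^3S_1\bigr)$. *)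

(* Defs.v *)
From HB Require Import structures.
From mathcomp Require Import all_boot all_order all_algebra.
From mathcomp Require Import mpoly.

Set Implicit Arguments.
Unset Strict Implicit.
Unset Printing Implicit Defensive.
Set Warnings "-abstract-large-number".

Import GRing.Theory.
Local Open Scope ring_scope.

(* The large integer constants below are stored as decimal literals under     *)
(* [Nat.of_num_uint]; reducing that to a unary [nat] would exhaust memory.    *)
#[global] Arguments Nat.of_num_uint : simpl never.

(** * Binary forms *)

(* A binary form of order n over R is an n.-homog element of {mpoly R[2]},    *)
(* with x = 'X_ord0 and y = 'X_ord_max.                                       *)

Section Forms.
Variable R : comUnitRingType.
Implicit Types (F A B : {mpoly R[2]}).

Definition xvar : {mpoly R[2]} := 'X_ord0.
Definition yvar : {mpoly R[2]} := 'X_ord_max.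

(* Coordinates on forms of order n: the coefficient of x^(n-i) y^i, without   *)
(* binomial factors.                                                          *)
Definition form_coord n F : 'I_n.+1 -> R :=
  fun i => F@_[multinom [tuple (n - i)%N; nat_of_ord i]].

Definition form_of_coord n (a : 'I_n.+1 -> R) : {mpoly R[2]} :=
  \sum_(i < n.+1) a i *: (xvar ^+ (n - i) * yvar ^+ i).

(* F (p, q) *)
Definition form_subst F (p q : {mpoly R[2]}) : {mpoly R[2]} :=
  F \mPo [tuple p; q].

(* [transvectant m n r A B] is (A,B)_r for A of order m and B of order n.     *)
Definition transvectant (m n r : nat) A B : {mpoly R[2]} :=
  (((m - r)`! * (n - r)`!)%N%:R / (m`! * n`!)%N%:R : R) *:
  \sum_(j < r.+1)
    (-1) ^+ j * 'C(r, j)%:R *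
    (A^`M(ord0, r - j)^`M(ord_max, j) * B^`M(ord0, j)^`M(ord_max, r - j)).

End Forms.

Arguments xvar {R}.
Arguments yvar {R}.

(** * Generated subalgebras *)

(* The subalgebra generated by X of a k-algebra S with structure map iota.    *)
Inductive subalg (k S : comNzRingType) (iota : k -> S) (X : S -> Prop) :
    S -> Prop :=
| subalg_const c : subalg iota X (iota c)
| subalg_gen f : X f -> subalg iota X f
| subalg_add f g : subalg iota X f -> subalg iota X g -> subalg iota X (f + g)
| subalg_mul f g : subalg iota X f -> subalg iota X g -> subalg iota X (f * g).

Definition generates (k S : comNzRingType) (iota : k -> S)
    (X B : S -> Prop) : Prop :=
  forall f, B f <-> subalg iota X f.

(* No proper subfamily of u generates B; in particular the u i are distinct.  *)
Definition minimal_homogeneous_generators (k : comNzRingType) (n N : nat)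
    (B : {mpoly k[n]} -> Prop) (u : 'I_N -> {mpoly k[n]}) (d : 'I_N -> nat) :
    Prop :=
  [/\ generates (@mpolyC n k) (fun f => exists i, f = u i) B,
      forall i, u i != 0 /\ u i \is (d i).-homog
    & forall J : {set 'I_N},
        generates (@mpolyC n k) (fun f => exists2 i, i \in J & f = u i) B ->
        J = [set: 'I_N]].

Section Invariants.
Variable k : fieldType.

(** * Invariants of pairs (F, G) *)

(* k[V_5 + V_3]: the first six variables are the coordinates of F, the last   *)
(* four those of G.                                                           *)
Notation coordring := {mpoly k[6 + 4]}.

Definition pair_coord (F G : {mpoly k[2]}) : 'I_(6 + 4) -> k :=
  fun i => match split i with
           | inl a => @form_coord k 5 F a
           | inr b => @form_coord k 3 G b
           end.

Definition mx_subst (g : 'M[k]_2) (F : {mpoly k[2]}) : {mpoly k[2]} :=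
  form_subst F (g ord0 ord0 *: xvar + g ord0 ord_max *: yvar)
               (g ord_max ord0 *: xvar + g ord_max ord_max *: yvar).

Definition SL2_invariant (P : coordring) : Prop :=
  forall g : 'M[k]_2, \det g = 1 ->
  forall F G : {mpoly k[2]}, F \is 5.-homog -> G \is 3.-homog ->
    P.@[pair_coord (mx_subst g F) (mx_subst g G)] = P.@[pair_coord F G].

(** * Covariants and joint invariants of the generic pair *)

Definition genF : {mpoly coordring[2]} :=
  @form_of_coord coordring 5 (fun a => 'X_(lshift 4 a)).
Definition genG : {mpoly coordring[2]} :=
  @form_of_coord coordring 3 (fun b => 'X_(rshift 6 b)).

Definition cov_H := transvectant 5 5 2 genF genF.        (* order 6 *)
Definition cov_i := transvectant 5 5 4 genF genF.        (* order 2 *)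
Definition cov_t := transvectant 5 6 1 genF cov_H.       (* order 9 *)
Definition cov_c35 := transvectant 2 5 1 cov_i genF.     (* order 5 *)
Definition cov_c33 := transvectant 2 5 2 cov_i genF.     (* order 3 *)
Definition cov_h := transvectant 3 3 2 genG genG.        (* order 2 *)
Definition cov_q := transvectant 3 2 1 genG cov_h.       (* order 3 *)

(* The value of a form of order 0. *)
Definition const_form (A : {mpoly coordring[2]}) : coordring := A@_0%MM.

Definition inv_D := const_form (transvectant 2 2 2 cov_h cov_h).
Definition inv_A := const_form (transvectant 5 5 5 genF (genG * cov_h)).
Definition inv_L := const_form (transvectant 5 5 5 genF (cov_h * cov_q)).
Definition inv_B1 := const_form (transvectant 2 2 2 cov_i cov_h).
Definition inv_B2 := const_form (transvectant 6 6 6 cov_H (genG ^+ 2)).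
Definition inv_M := const_form (transvectant 6 6 6 cov_H (genG * cov_q)).
Definition inv_N := const_form (transvectant 6 6 6 cov_H (cov_q ^+ 2)).
Definition inv_R := const_form (transvectant 3 3 3 cov_c33 genG).
Definition inv_S1 := const_form (transvectant 3 3 3 cov_c33 cov_q).
Definition inv_S2 := const_form (transvectant 5 5 5 cov_c35 (genG * cov_h)).
Definition inv_S3 := const_form (transvectant 9 9 9 cov_t (genG ^+ 3)).
Definition inv_T1 := const_form (transvectant 5 5 5 cov_c35 (cov_h * cov_q)).
Definition inv_T2 := const_form (transvectant 9 9 9 cov_t (genG ^+ 2 * cov_q)).
Definition inv_T3 :=
  const_form (transvectant 15 15 15 (genF ^+ 3) (genG ^+ 5)).
Definition inv_W :=
  const_form (transvectant 15 15 15 (genF ^+ 3) (genG ^+ 4 * cov_q)).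

Notation D := inv_D.   Notation A := inv_A.   Notation L := inv_L.
Notation B1 := inv_B1. Notation B2 := inv_B2. Notation M := inv_M.
Notation N := inv_N.   Notation R := inv_R.   Notation S1 := inv_S1.
Notation S2 := inv_S2. Notation S3 := inv_S3. Notation T1 := inv_T1.
Notation T2 := inv_T2. Notation T3 := inv_T3. Notation W := inv_W.

(** * Absolute invariants *)

(* The degree-zero part of the localization of the invariant ring at D,       *)
(* inside the field of fractions of k[V_5 + V_3].                             *)
Definition absolute_invariant (f : {fraction coordring}) : Prop :=
  exists P (m d : nat),
    [/\ SL2_invariant P, P \is d.-homog, D ^+ m \is d.-homog
      & f = tofrac P / tofrac (D ^+ m)].

Definition frac_const (c : k) : {fraction coordring} := tofrac c%:MP.

(** * The fourteen generators *)

Definition P1 : coordring := 700%:R * A.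

Definition P2 : coordring :=
  5%:R ^+ 3 * (98010%:R * L ^+ 2 + 190080%:R * D * N + 47045%:R * D * A ^+ 2
    + 97000%:R * D ^+ 2 * B2 - 19224%:R * D ^+ 2 * B1).

Definition P3 : coordring :=
  5%:R ^+ 5 * (63868314510%:R * A * L ^+ 2 + 49446437040%:R * D * L * M
    + 148589040600%:R * D * A * N + 31976059115%:R * D * A ^+ 3
    + 560560%:R * D ^+ 2 * T3 - 164989440%:R * D ^+ 2 * T2
    - 45305310960%:R * D ^+ 2 * T1 + 98893534740%:R * D ^+ 2 * A * B2
    - 39968032104%:R * D ^+ 2 * A * B1 + 7720750752%:R * D ^+ 3 * R).

Definition P4 : coordring :=
  - 5%:R * (632610%:R * L ^+ 2 + 803520%:R * D * N + 165385%:R * D * A ^+ 2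
    + 552680%:R * D ^+ 2 * B2 - 98424%:R * D ^+ 2 * B1).

Definition P5 : coordring :=
  - 5%:R ^+ 3 * (216453026790%:R * A * L ^+ 2 + 514942187760%:R * D * L * M
    + 493336803960%:R * D * A * N + 112492234855%:R * D * A ^+ 3
    + 83523440%:R * D ^+ 2 * T3 - 16672803840%:R * D ^+ 2 * T2
    - 290479054320%:R * D ^+ 2 * T1 + 491566054980%:R * D ^+ 2 * A * B2
    - 218716874376%:R * D ^+ 2 * A * B1 - 12670582496%:R * D ^+ 3 * R).

Definition P6 : coordring :=
  - 5%:R ^+ 6 * (67988850930%:R * L ^+ 4 + 197785748160%:R * D * L ^+ 2 * N
    + 33952803885%:R * D * A ^+ 2 * L ^+ 2 - 560560%:R * D ^+ 2 * L * W
    + 79622318160%:R * D ^+ 2 * L ^+ 2 * B2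
    - 39182280984%:R * D ^+ 2 * L ^+ 2 * B1
    + 19394519760%:R * D ^+ 2 * A * L * M - 82457760%:R * D ^+ 3 * L * S3
    + 21320456220%:R * D ^+ 3 * L * S2 + 9857393568%:R * D ^+ 3 * L * S1).

Definition Q_e2 : coordring := 264600%:R * L ^+ 2.

Definition Q_p02 : coordring :=
  1 / 30%:R * (4083210%:R * L ^+ 2
    + D * (2453760%:R * N + 581405%:R * A ^+ 2
      + D * (2687080%:R * B2 - 835416%:R * B1))).

Definition Q_p12 : coordring :=
  5%:R / 756756%:R * (133383920670%:R * A * L ^+ 2
    + D * (4587439736880%:R * L * M + 1869573265560%:R * A * N
      + 407613761555%:R * A ^+ 3
      + D * (12444992560%:R * T3 - 1305564986880%:R * T2
        - 1725889117680%:R * T1 + 2239075899060%:R * A * B2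
        - 1153318029864%:R * A * B1 - 289845437024%:R * D * R))).

Definition Q_p03 : coordring :=
  1 / 252252%:R * (1459163675970%:R * A * L ^+ 2
    - D * (7553317852080%:R * L * M + 2899790613720%:R * A * N
      + 648701088035%:R * A ^+ 3
      + D * (370860778288%:R * T3 - 3781089607680%:R * T2
        - 1987532754480%:R * T1 + 2085082539540%:R * A * B2
        - 1274048816040%:R * A * B1 - 459131079264%:R * D * R))).

Definition Q_w2 : coordring := 49392000%:R * L * (D * M - A * L).

Definition Q_w21 : coordring :=
  625%:R / 9009%:R * L * (438837128730%:R * L ^+ 3
    + 982935233280%:R * D * L * N + 215194604625%:R * D * A ^+ 2 * L
    - 83523440%:R * D ^+ 2 * W + 526319806320%:R * D ^+ 2 * L * B2
    - 178109310456%:R * D ^+ 2 * L * B1 - 22314544560%:R * D ^+ 2 * A * M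
    - 8330894880%:R * D ^+ 3 * S3 + 75289456620%:R * D ^+ 3 * S2
    + 99761875488%:R * D ^+ 3 * S1).

Definition Q_w12 : coordring :=
  25%:R / 3003%:R * L * (- 2832494194530%:R * L ^+ 3
    - 4448817172800%:R * D * L * N - 1081547792325%:R * D * A ^+ 2 * L
    + 12444992560%:R * D ^+ 2 * W - 3200034111120%:R * D ^+ 2 * L * B2
    + 914989205592%:R * D ^+ 2 * L * B1 - 8471509200%:R * D ^+ 2 * A * M
    + 651961944480%:R * D ^+ 3 * S3 - 291086990460%:R * D ^+ 3 * S2
    - 664047594144%:R * D ^+ 3 * S1).

Definition Q_w03 : coordring :=
  1 / 1001%:R * L * (18282462528330%:R * L ^+ 3
    + 16479966222720%:R * D * L * N + 3176968579785%:R * D * A ^+ 2 * L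
    - 1854303891440%:R * D ^+ 2 * W + 18276219284400%:R * D ^+ 2 * L * B2
    - 5198207741496%:R * D ^+ 2 * L * B1 + 4876420626000%:R * D ^+ 2 * A * M
    - 9330462224160%:R * D ^+ 3 * S3 + 1385837078220%:R * D ^+ 3 * S2
    + 3660996971808%:R * D ^+ 3 * S1).

(* (numerator, denominator) of U_1, U_2, 3 U_3, U_4, U_5, U_6, followed by    *)
(* Q_g / D^(m_g) for g = e2, p02, p12, p03, w2, w21, w12, w03.                *)
Definition generators : 14.-tuple (coordring * coordring) :=
  [tuple (P1, 3%:R * D ^+ 1);
         (P2, 54%:R * D ^+ 3);
         (3%:R * P3, 20432412%:R * D ^+ 4);
         (P4, 18%:R * D ^+ 3);
         (P5, 2270268%:R * D ^+ 4);
         (P6, 27027%:R * D ^+ 6);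
         (Q_e2, D ^+ 3);
         (Q_p02, D ^+ 3);
         (Q_p12, D ^+ 4);
         (Q_p03, D ^+ 4);
         (Q_w2, D ^+ 4);
         (Q_w21, D ^+ 6);
         (Q_w12, D ^+ 6);
         (Q_w03, D ^+ 6)].

Definition generator_degrees : 14.-tuple nat :=
  [tuple 1; 2; 3; 2; 3; 4; 2; 2; 3; 3; 3; 4; 4; 4].

Definition generator (i : 'I_14) : {fraction coordring} :=
  tofrac (tnth generators i).1 / tofrac (tnth generators i).2.

(** * The normalized slice *)

Definition G0 : {mpoly k[2]} := xvar * yvar * (xvar - yvar).

(* Restriction of polynomial functions to {(F, G0)}. *)
Definition restrict (P : coordring) : {mpoly k[6]} :=
  P \mPo [tuple match split i with
                | inl a => 'X_a
                | inr b => (@form_coord k 3 G0 b)%:MP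
                end | i < 6 + 4].

(* D (G0) = 2/27, so the denominators restrict to nonzero constants, which    *)
(* are units of {mpoly k[6]}.                                                 *)
Definition slice_generator (i : 'I_14) : {mpoly k[6]} :=
  restrict (tnth generators i).1 / restrict (tnth generators i).2.

Definition Gamma_r (F : {mpoly k[2]}) : {mpoly k[2]} :=
  - form_subst F (xvar - yvar) xvar.
Definition Gamma_s (F : {mpoly k[2]}) : {mpoly k[2]} :=
  - form_subst F (- xvar + yvar) yvar.

(* The transformations of V_5 given by the elements of Gamma, the group        *)
(* generated by r and s.  As r^3 = s^2 = 1 on V_5, no closure under inverses  *)
(* is needed.                                                                 *)
Inductive Gamma : ({mpoly k[2]} -> {mpoly k[2]}) -> Prop :=
| Gamma_id : Gamma id
| Gamma_mul_r a : Gamma a -> Gamma (Gamma_r \o a)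
| Gamma_mul_s a : Gamma a -> Gamma (Gamma_s \o a).

Definition Gamma_invariant (p : {mpoly k[6]}) : Prop :=
  forall a, Gamma a -> forall F : {mpoly k[2]}, F \is 5.-homog ->
    p.@[@form_coord k 5 (a F)] = p.@[@form_coord k 5 F].

End Invariants.

(* Main.v *)
(** Transvectants are equivariant under GL_2 up to a power of the determinant, and a
    cubic with D <> 0 is a multiple of a linear transform of G0 = xy(x-y); so an
    absolute invariant is determined by its restriction to the slice, where it is
    invariant under the stabiliser Gamma of the line through G0.

    Let om be a primitive cube root of unity. Eigenvectors of the rotation r turn G0 into
    a multiple of x^3 + y^3, and in the coordinates
      al = f4 - f1, w = f1 + f4, x1 = 25 f0 + 245 f3, x2 = 149 f0 + 49 f3,
      y1 = - (25 f5 + 245 f2), y2 = - (149 f5 + 49 f2)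
    of the quintic sum_i f_i x^(5-i) y^i the group acts by r : x_i -> om x_i, y_i -> om^2 y_i
    and s : w -> - w, x_i <-> y_i. Evaluating the transvectants shows that the fourteen
    generators become nonzero multiples of al, w^2, the polarisations x_i y_j + x_j y_i of
    x1 y1, those of x1^3 + y1^3, and the products by w of the antisymmetric
    counterparts of the latter two families. Every r-invariant polynomial is the sum of an
    element of the algebra E they generate and of an E-combination of w and of the
    antisymmetric forms, because products of two s-odd forms lie in E; the first summand is
    the s-invariant part. The generating set is minimal because each generator
    contains a monomial that occurs in no other one and that is not a product of two
    nonconstant monomials of elements of E. *)

Require Import Defs.
From mathcomp Require Import all_boot all_order all_algebra.
From mathcomp Require Import mpoly.
From mathcomp Require Import fraction.
From mathcomp Require Import ring zify.

Set Implicit Arguments. Unset Strict Implicit. Unset Printing Implicit Defensive.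
Import GRing.Theory.
Local Open Scope ring_scope.

(** * Polynomials and their values *)

(** Over a field of characteristic zero a polynomial is determined by its values, and invariance,
    degree and restriction are handled here as statements about values. The generic covariants are
    therefore never expanded: they are specialised, and the specialisations are computed on
    coefficient lists with symbolic entries. The cubic G0 is an inconvenient place for this. At x^3
    + y^3 the covariants h, q and the invariant D are 2xy, x^3 - y^3 and -2, so that all their
    products are sparse. The price is a matrix of determinant theta, a square root of -3, and a
    scalar c relating the two cubics. This scalar acts on every joint invariant through its degree
    alone, hence it cancels in quotients of degree zero. The eigenvectors x_i, y_i are not
    arbitrary: x1 and y1 are the linear factors of the numerator of U_2 at x^3 + y^3, and x2 and y2
    are those of Q_p02. In a general eigenbasis the fourteen functions would be combinations of the
    polarisations rather than multiples of single ones. *)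

Section Monomials.
Variables (R : comUnitRingType).

Lemma mono2E a b : xvar ^+ a * yvar ^+ b = 'X_[[multinom [tuple a; b]]] :> {mpoly R[2]}.
Proof.
rewrite mpolyXE_id !big_ord_recl big_ord0 mulr1 !multinomE !(tnth_nth 0%N) /=.
by congr (_ * 'X_[U_(_)] ^+ _); apply: val_inj.
Qed.

Lemma mdeg2 a b : mdeg [multinom [tuple a; b]] = (a + b)%N.
Proof. by rewrite mdegE !big_ord_recl big_ord0 !multinomE !(tnth_nth 0%N) /= addn0. Qed.

Lemma multinom2P (m : 'X_{1..2}) : m = [multinom [tuple m ord0; m ord_max]].
Proof.
apply/mnmP => i; rewrite multinomE (tnth_nth 0%N); case: i => [[|[|i]] Hi] //=.
  by congr (m _); apply: val_inj.
by congr (m _); apply: val_inj.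
Qed.

Lemma multinom2_inj a b c d :
  ([multinom [tuple a; b]] == [multinom [tuple c; d]]) = (a == c) && (b == d).
Proof.
apply/eqP/andP => [/mnmP E|[/eqP-> /eqP->] //].
have:= E ord0; have := E ord_max; rewrite !multinomE !(tnth_nth 0%N) /= => -> ->.
by rewrite !eqxx.
Qed.

Lemma form_of_coord_homog n (a : 'I_n.+1 -> R) : form_of_coord a \is n.-homog.
Proof.
apply: rpred_sum => i _; apply: rpredZ.
by rewrite mono2E dhomogX /= mdeg2 subnK // -ltnS.
Qed.

Lemma form_of_coordK n (a : 'I_n.+1 -> R) : form_coord (form_of_coord a) =1 a.
Proof.
move=> i; rewrite /form_coord /form_of_coord raddf_sum (bigD1 i) //=.
rewrite big1 => [|j ji]; rewrite mcoeffZ mono2E mcoeffX multinom2_inj.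
  by rewrite !eqxx mulr1 addr0.
by move: ji; rewrite -val_eqE => /negbTE /= ->; rewrite andbF mulr0.
Qed.

Lemma form_coordK n (A : {mpoly R[2]}) : A \is n.-homog ->
  form_of_coord (fun i : 'I_n.+1 => form_coord A i) = A.
Proof.
move=> homA; apply/mpolyP => m; rewrite [m]multinom2P.
set a := m ord0; set b := m ord_max.
have [eqn|neq] := eqVneq (a + b)%N n; last first.
  have homB := form_of_coord_homog (fun i : 'I_n.+1 => form_coord A i).
  have deg : mdeg [multinom [tuple a; b]] != n by rewrite mdeg2.
  by rewrite (dhomog_nemf_coeff homA deg) (dhomog_nemf_coeff homB deg).
have bn : (b < n.+1)%N by rewrite -eqn ltnS leq_addl.
have -> : a = (n - b)%N by rewrite /= -eqn addnK.
exact: (form_of_coordK _ (Ordinal bn)).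
Qed.

Lemma eq_form_of_coord n (a b : 'I_n.+1 -> R) : a =1 b -> form_of_coord a = form_of_coord b.
Proof. by move=> ab; apply: eq_bigr => i _; rewrite ab. Qed.

Lemma form_of_coordZ n c (a : 'I_n.+1 -> R) :
  form_of_coord (fun i => c * a i) = c *: form_of_coord a.
Proof. by rewrite scaler_sumr; apply: eq_bigr => i _; rewrite scalerA. Qed.

End Monomials.

Section Scaling.
Variables (k : fieldType) (n : nat).
Implicit Types (p : {mpoly k[n]}) (c v : 'I_n -> k).

(** A diagonal substitution has the monomials as eigenvectors, which turns statements about values
    into statements about exponents. *)
Definition scale_vars c p : {mpoly k[n]} := p \mPo [tuple c i *: 'X_i | i < n].

Lemma mcoeff_scale_vars c p m : (scale_vars c p)@_m = p@_m * \prod_i c i ^+ m i.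
Proof.
rewrite /scale_vars comp_mpolyEX raddf_sum /=.
under eq_bigr => m' _.
  rewrite mcoeffZ comp_mpolyX.
  under eq_bigr do rewrite tnth_mktuple exprZn.
  rewrite scaler_prod -mpolyXE_id mcoeffZ mcoeffX; over.
rewrite /= [in RHS](mpolyE p) raddf_sum mulr_suml; apply: eq_bigr => m' _ /=.
rewrite mcoeffZ mcoeffX; case: eqP => [->|_]; first by rewrite !mulr1.
by rewrite !mulr0 mul0r.
Qed.

Lemma meval_scale_vars c p v : (scale_vars c p).@[v] = p.@[fun i => c i * v i].
Proof.
rewrite comp_mpoly_meval; apply: meval_eq => i.
by rewrite tnth_mktuple mevalZ mevalXU.
Qed.

Hypothesis char0 : [pchar k] =i pred0.

Lemma natr_inj : injective (fun m : nat => m%:R : k).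
Proof.
have /pcharf0P natr0 := char0 => a b /=; wlog ab : a b / (a <= b)%N.
  by move=> W; case: (leqP a b) => [/W//|/ltnW /W E /esym/E].
move=> /eqP; rewrite eq_sym -subr_eq0 -natrB // natr0 subn_eq0 => ba.
by apply/eqP; rewrite eqn_leq ab.
Qed.

Lemma expr2n_inj : injective (fun m : nat => 2%:R ^+ m : k).
Proof. by move=> a b /=; rewrite -!natrX => /natr_inj/eqP; rewrite eqn_exp2l // => /eqP. Qed.

(* Comparing p (.., 2 x_i, ..) with 2^(m i) p lowers the number of monomials. *)
Lemma mpoly_vanish p : (forall v, p.@[v] = 0) -> p = 0.
Proof.
have [s] := ubnP (size (msupp p)); elim: s p => // s IH p /ltnSE le_s p0.
apply/eqP/negPn/negP => nz_p.
have mp : mlead p \in msupp p by exact: mlead_supp.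
set m := mlead p in mp.
have [/allP single|/allPn[m' m'p nemm']] := boolP (all (pred1 m) (msupp p)).
  (* With a single monomial left, the value at (1, .., 1) is its coefficient. *)
  have:= p0 (fun=> 1); rewrite mevalE (eq_big_seq (fun m' => p@_m')); last first.
    by move=> m' _; rewrite big1 ?mulr1 // => i _; rewrite expr1n.
  rewrite (bigD1_seq m) ?msupp_uniq //= big1_seq => [|m' /andP[ne /single /eqP E]].
    by rewrite addr0; move/eqP; rewrite -[_ == 0]negbK -mcoeff_msupp mp.
  by rewrite E eqxx in ne.
have [i nei] : {i | m' i != m i}.
  apply/sigW/existsP; apply: contraR nemm'; rewrite negb_exists => /forallP eqi.
  by apply/eqP/mnmP => i; apply/eqP; rewrite -[_ == _]negbK.
pose c := fun j : 'I_n => if j == i then 2%:R else 1 : k.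
have prodc (l : 'X_{1..n}) : \prod_j c j ^+ l j = 2%:R ^+ l i.
  rewrite (bigD1 i) //= /c eqxx big1 ?mulr1 // => j /negbTE ->.
  by rewrite expr1n.
pose q := scale_vars c p - 2%:R ^+ m i *: p.
have qE l : q@_l = p@_l * (2%:R ^+ l i - 2%:R ^+ m i).
  by rewrite mcoeffB mcoeff_scale_vars prodc mcoeffZ mulrBr [X in _ - X]mulrC.
have /eqP : q = 0.
  apply: IH => [|v]; last by rewrite mevalB mevalZ meval_scale_vars !p0 mulr0 subr0.
  apply: leq_trans le_s; rewrite (perm_size (perm_to_rem mp)) ltnS.
  apply: uniq_leq_size; first exact: msupp_uniq.
  move=> l; rewrite mem_rem_uniq ?msupp_uniq // !inE !mcoeff_msupp qE.
  rewrite mulf_eq0 negb_or => /andP[-> nz]; rewrite andbT.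
  by apply: contraNneq nz => ->; rewrite subrr.
apply/negP; rewrite -msupp_eq0 -size_eq0 -lt0n -has_predT; apply/hasP; exists m' => //.
rewrite mcoeff_msupp qE mulf_neq0 // -?mcoeff_msupp // subr_eq0.
by apply: contraNneq nei => /expr2n_inj ->.
Qed.

Lemma mpoly_eq_meval p q : (forall v, p.@[v] = q.@[v]) -> p = q.
Proof. by move=> pq; apply/subr0_eq/mpoly_vanish => v; rewrite mevalB pq subrr. Qed.

(** Doubling all coordinates multiplies the coefficient of [m] by [2 ^ mdeg m], and powers of 2 are
    distinct in characteristic zero; so the single scalar 2 detects degrees. *)
Lemma homog_of_meval p d :
  (forall v, p.@[fun i => 2%:R * v i] = 2%:R ^+ d * p.@[v]) -> p \is d.-homog.
Proof.
move=> pd; have E : scale_vars (fun=> 2%:R) p = 2%:R ^+ d *: p.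
  by apply: mpoly_eq_meval => v; rewrite meval_scale_vars mevalZ pd.
apply/dhomogP => m /[!mcoeff_msupp] nz; apply: expr2n_inj; apply: (mulfI nz).
move/(congr1 (mcoeff m)): E; rewrite mcoeff_scale_vars mcoeffZ [in RHS]mulrC => <-.
by rewrite /= mdegE prodrXr.
Qed.

End Scaling.

(** * Binary forms as coefficient lists *)

Section ListForms.
Variable k : comUnitRingType.
Implicit Types (a b : seq k) (A B : {mpoly k[2]}).

(** Coefficients by decreasing powers of x. A list of size n + 1 is a form of order n, zeros
    included, so the size carries the order. Lists make transvectants computable by [cbv] while the
    coefficients stay symbolic. *)
Fixpoint lform (a : seq k) : {mpoly k[2]} :=
  if a is c :: a' then c *: xvar ^+ (size a') + yvar * lform a' else 0.

(** Stops at the shorter list, so it represents a sum only for equal sizes. Hence the padding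
    elsewhere: appended zeros multiply by a power of x, a leading zero multiplies by y. *)
Fixpoint ladd a b : seq k :=
  match a, b with c :: a', d :: b' => c + d :: ladd a' b' | _, _ => [::] end.

Definition lscale (c : k) a := [seq c * x | x <- a].

Fixpoint lmul a b : seq k :=
  match a with
  | [::] => nseq (size b).-1 0
  | [:: c] => lscale c b
  | c :: a' => ladd (lscale c b ++ nseq (size a') 0) (0 :: lmul a' b) end.

Fixpoint ldx a : seq k :=
  match a with
  | [::] => [::]
  | [:: c] => [::]
  | c :: a' => (size a')%:R * c :: ldx a' end.

(** Leibniz rule on [c x^n + y B]: the derivative is [B + y B_y]. *)
Fixpoint ldy a : seq k :=
  match a with
  | [::] => [::]
  | [:: c] => [::]
  | c :: a' => ladd a' (0 :: ldy a') end.

Lemma size_ladd a b : size a = size b -> size (ladd a b) = size b.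
Proof. by elim: a b => [|c a IH] [|d b] //= [/IH ->]. Qed.

Lemma lform_add a b : size a = size b -> lform (ladd a b) = lform a + lform b.
Proof.
elim: a b => [|c a IH] [|d b] //= => [_|[eq_ab]]; first by rewrite addr0.
by rewrite size_ladd // IH // eq_ab scalerDl mulrDr addrACA.
Qed.

Lemma lform_scale c a : lform (lscale c a) = c *: lform a.
Proof.
elim: a => [|d a IH] /=; first by rewrite scaler0.
by rewrite size_map IH scalerDr scalerA -scalerAr.
Qed.

Lemma lform_nseq0 n : lform (nseq n 0) = 0.
Proof. by elim: n => //= n ->; rewrite scale0r mulr0 addr0. Qed.

Lemma lform_cat0 a n : lform (a ++ nseq n 0) = lform a * xvar ^+ n.
Proof.
elim: a => [|c a IH] /=; first by rewrite lform_nseq0 mul0r.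
by rewrite IH size_cat size_nseq exprD mulrDl scalerAl mulrA.
Qed.

Lemma lmul_cons c a b : (0 < size a)%N ->
  lmul (c :: a) b = ladd (lscale c b ++ nseq (size a) 0) (0 :: lmul a b).
Proof. by case: a. Qed.

Lemma size_lmul a b : (0 < size a)%N -> (0 < size b)%N ->
  size (lmul a b) = (size a + size b).-1.
Proof.
move=> + b0; elim: a => // c a IH _; case: (posnP (size a)) => [/size0nil ->|a0].
  by rewrite /= size_map.
have {}IH := IH a0; rewrite lmul_cons // size_ladd /=.
  by rewrite IH; lia.
by rewrite size_cat size_map size_nseq IH prednK ?addn_gt0 ?a0 // addnC.
Qed.

Lemma lform_mul a b : (0 < size a)%N -> (0 < size b)%N ->
  lform (lmul a b) = lform a * lform b.
Proof.
move=> + b0; elim: a => // c a IH _; case: (posnP (size a)) => [/size0nil ->|a0].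
  by rewrite /= lform_scale mulr0 addr0 expr0 -scalerAl mul1r.
rewrite lmul_cons // lform_add /=; last first.
  by rewrite size_lmul // size_cat size_map size_nseq prednK ?addn_gt0 ?a0 // addnC.
rewrite lform_cat0 lform_scale IH // scale0r add0r mulrDl -!scalerAl mulrA.
by congr (_ *: _ + _); rewrite mulrC.
Qed.

Lemma mderiv_exp (p : {mpoly k[2]}) j n :
  (p ^+ n)^`M(j) = n%:R *: (p ^+ n.-1 * p^`M(j)).
Proof.
elim: n => [|[|n] IH]; first by rewrite expr0 -mpolyC1 mderivC scale0r.
  by rewrite expr1 expr0 mul1r scale1r.
rewrite exprS mderivM IH /= -scalerAr mulrA -exprS -[in RHS]natr1 scalerDl scale1r.
by rewrite addrC [_ * p ^+ n.+1]mulrC.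
Qed.

Lemma mderivXU (i j : 'I_2) : ('X_i : {mpoly k[2]})^`M(j) = (i == j)%:R.
Proof.
rewrite mderivX mnm1E; case: eqP => [->|_]; last by rewrite scale0r.
by rewrite -mpolyX0 scale1r; congr ('X_[_]); apply/mnmP => l; rewrite mnmBE mnm0E subnn.
Qed.

Lemma ldx_cons c a : (0 < size a)%N -> ldx (c :: a) = (size a)%:R * c :: ldx a.
Proof. by case: a. Qed.

Lemma size_ldx a : size (ldx a) = (size a).-1.
Proof.
elim: a => // c a IH; case: (posnP (size a)) => [/size0nil -> //|a0].
by rewrite ldx_cons //= IH prednK.
Qed.

Lemma lform_dx a : lform (ldx a) = (lform a)^`M(ord0).
Proof.
elim: a => [|c a IH]; first by rewrite /= mderiv0.
case: (posnP (size a)) => [/size0nil ->|a0].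
  by rewrite /= mulr0 addr0 expr0 mderivZ -mpolyC1 mderivC scaler0.
rewrite ldx_cons //= size_ldx IH mderivD mderivZ mderivM mderiv_exp !mderivXU /=.
by rewrite mul0r add0r mulr1 scalerA mulrC.
Qed.

Lemma ldy_cons c a : (0 < size a)%N -> ldy (c :: a) = ladd a (0 :: ldy a).
Proof. by case: a. Qed.

Lemma size_ldy a : size (ldy a) = (size a).-1.
Proof.
elim: a => // c a IH; case: (posnP (size a)) => [/size0nil -> //|a0].
by rewrite ldy_cons // size_ladd /= IH prednK.
Qed.

Lemma lform_dy a : lform (ldy a) = (lform a)^`M(ord_max).
Proof.
elim: a => [|c a IH]; first by rewrite /= mderiv0.
case: (posnP (size a)) => [/size0nil ->|a0].
  by rewrite /= mulr0 addr0 expr0 mderivZ -mpolyC1 mderivC scaler0.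
rewrite ldy_cons // lform_add /= ?size_ldy ?prednK // IH scale0r add0r.
by rewrite mderivD mderivZ mderivM mderiv_exp !mderivXU /= mulr0 !scaler0 mul1r add0r.
Qed.

Definition lterm r j a b :=
  lscale ((-1) ^+ j * 'C(r, j)%:R)
    (lmul (iter j ldy (iter (r - j) ldx a)) (iter (r - j) ldy (iter j ldx b))).

Fixpoint lsum s : seq k :=
  match s with
  | [::] => [::]
  | [:: a] => a
  | a :: s' => ladd a (lsum s') end.

(** The normalisation (m - r)! / m! is kept as the inverse of a falling factorial, which keeps the
    numerals small. *)
Definition ltrans m n r a b :=
  lscale ((m ^_ r)%:R^-1 * (n ^_ r)%:R^-1) (lsum [seq lterm r j a b | j <- iota 0 r.+1]).

(** The transvectant without its normalisation: Cayley's omega process iterated r times and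
    restricted to the diagonal. *)
Definition omega r A B : {mpoly k[2]} :=
  \sum_(j < r.+1) (-1) ^+ j * 'C(r, j)%:R *
    (A^`M(ord0, r - j)^`M(ord_max, j) * B^`M(ord0, j)^`M(ord_max, r - j)).

Lemma lform_iter_dx j a : lform (iter j ldx a) = (lform a)^`M(ord0, j).
Proof. by elim: j => [|j IH]; rewrite ?mderivn0 //= lform_dx IH -mderivnS. Qed.

Lemma lform_iter_dy j a : lform (iter j ldy a) = (lform a)^`M(ord_max, j).
Proof. by elim: j => [|j IH]; rewrite ?mderivn0 //= lform_dy IH -mderivnS. Qed.

Lemma size_iter_dx j a : size (iter j ldx a) = (size a - j)%N.
Proof. by elim: j => [|j IH]; rewrite ?subn0 //= size_ldx IH subnS. Qed.

Lemma size_iter_dy j a : size (iter j ldy a) = (size a - j)%N.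
Proof. by elim: j => [|j IH]; rewrite ?subn0 //= size_ldy IH subnS. Qed.

Lemma lsum_cons a s : s != [::] -> lsum (a :: s) = ladd a (lsum s).
Proof. by case: s. Qed.

Lemma size_lsum N s : s != [::] -> {in s, forall a, size a = N} -> size (lsum s) = N.
Proof.
elim: s => // a s IH _ sz; case: (eqVneq s [::]) => [->|s0].
  by apply: sz; rewrite mem_head.
have Ss : size (lsum s) = N by apply: IH => // b bs; apply: sz; rewrite inE bs orbT.
by rewrite lsum_cons // size_ladd Ss // sz // inE eqxx.
Qed.

Lemma lform_sum N s : {in s, forall a, size a = N} ->
  lform (lsum s) = \sum_(a <- s) lform a.
Proof.
elim: s => [|a s IH] sz; first by rewrite big_nil.
have szs : {in s, forall b, size b = N} by move=> b bs; apply: sz; rewrite inE bs orbT.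
case: (eqVneq s [::]) => [->|s0]; first by rewrite big_seq1.
rewrite big_cons lsum_cons // lform_add ?IH //.
by rewrite (size_lsum s0 szs) sz // inE eqxx.
Qed.

Lemma lform_omega m n r a b : size a = m.+1 -> size b = n.+1 ->
    (r <= m)%N -> (r <= n)%N ->
  lform (lsum [seq lterm r j a b | j <- iota 0 r.+1]) = omega r (lform a) (lform b).
Proof.
move=> sa sb rm rn.
have szA j : (j <= r)%N ->
    size (iter j ldy (iter (r - j) ldx a)) = (m - r).+1.
  by move=> jr; rewrite size_iter_dy size_iter_dx sa -subnDA subnK // subSn.
have szB j : (j <= r)%N ->
    size (iter (r - j) ldy (iter j ldx b)) = (n - r).+1.
  by move=> jr; rewrite size_iter_dy size_iter_dx sb -subnDA subnKC // subSn.
rewrite (@lform_sum ((m - r).+1 + (n - r))); last first.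
  move=> c /mapP[j]; rewrite mem_iota add0n ltnS => /andP[_ jr] ->.
  by rewrite size_map size_lmul ?szA ?szB // addnS.
rewrite big_map -[iota 0 r.+1]/(index_iota 0 r.+1) big_mkord.
apply: eq_bigr => -[j jr] _; rewrite /lterm lform_scale lform_mul ?szA ?szB //.
rewrite !lform_iter_dy !lform_iter_dx -mul_mpolyC mpolyCM mpolyC_nat.
by rewrite rmorphXn rmorphN1.
Qed.

End ListForms.

(** * Transvectants of coefficient lists *)

Section ListTransvectants.
Variable k : fieldType.
Hypothesis char0 : [pchar k] =i pred0.
Implicit Types (a b : seq k) (A B : {mpoly k[2]}).

Lemma natr_neq0 n : (n != 0)%N -> n%:R != 0 :> k.
Proof. by move/pcharf0P: char0 => ->. Qed.

Lemma lform_trans m n r a b : size a = m.+1 -> size b = n.+1 ->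
    (r <= m)%N -> (r <= n)%N ->
  transvectant m n r (lform a) (lform b) = lform (ltrans m n r a b).
Proof.
move=> sa sb rm rn; rewrite /transvectant /ltrans lform_scale (lform_omega sa sb) //.
have fact0 p : p`!%:R != 0 :> k by rewrite natr_neq0 // -lt0n fact_gt0.
have ffE p : (r <= p)%N -> (p - r)`!%:R / p`!%:R = (p ^_ r)%:R^-1 :> k.
  by move=> rp; rewrite -(ffact_fact rp) natrM invfM mulrC -mulrA mulVf ?mulr1.
by rewrite !natrM invfM mulrACA !ffE.
Qed.

Lemma mcoeff0_mderiv A (i j : nat) :
  (A^`M(ord0, i)^`M(ord_max, j))@_0 =
  (i`! * j`!)%N%:R * A@_[multinom [tuple i; j]].
Proof.
rewrite -mderivmDm mcoeff_mderivm addm0.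
have -> : (U_(ord0) *+ i + U_(ord_max) *+ j)%MM = [multinom [tuple i; j]].
  apply/mnmP => l; rewrite mnmDE !mulmnE !mnm1E multinomE.
  by case: l => [[|[|l]] Hl] //=; rewrite ?mul1n ?mul0n ?addn0.
rewrite !big_ord_recl big_ord0 muln1 !multinomE !(tnth_nth 0%N) /= !ffactnn.
by rewrite mulr_natl.
Qed.

Lemma mcoeff0M A B : (A * B)@_0 = A@_0 * B@_0.
Proof. exact: (rmorphM (mcoeff 0%MM)). Qed.

(* Each derivative of order n is a constant, namely a multiple of one coefficient. *)
Lemma full_transvectant n A B :
  (transvectant n n n A B)@_0 =
  \sum_(j < n.+1) (-1) ^+ j / 'C(n, j)%:R *
    (A@_[multinom [tuple (n - j)%N; nat_of_ord j]] *
     B@_[multinom [tuple nat_of_ord j; (n - j)%N]]).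
Proof.
rewrite /transvectant mcoeffZ subnn fact0 raddf_sum mulr_sumr; apply: eq_bigr => -[j jn] _ /=.
rewrite -mulr_natr -mpolyC_nat -(rmorphN1 (@mpolyC 2 k)) -rmorphXn -rmorphM mul_mpolyC.
rewrite mcoeffZ mcoeff0M !mcoeff0_mderiv.
have fact0 p : p`!%:R != 0 :> k by rewrite natr_neq0 // -lt0n fact_gt0.
have bn0 : 'C(n, j)%:R != 0 :> k by rewrite natr_neq0 // -lt0n bin_gt0.
have e : n`!%:R = 'C(n, j)%:R * (j`!%:R * (n - j)`!%:R) :> k.
  by rewrite -!natrM bin_fact.
rewrite !natrM e; field; rewrite ?fact0 ?bn0 //.
Qed.

End ListTransvectants.

(** Reduces identities between algebra morphisms, and the chain rule for derivations, to constants
    and variables. *)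
Lemma mpoly_alg_ind (R : comNzRingType) n (P : {mpoly R[n]} -> Prop) :
  (forall c, P c%:MP) -> (forall i, P 'X_i) ->
  (forall p q, P p -> P q -> P (p + q)) -> (forall p q, P p -> P q -> P (p * q)) ->
  forall p, P p.
Proof.
move=> PC PX PD PM p; rewrite [p]mpolyE; apply: big_ind => //; first exact: (PC 0).
move=> m _; rewrite -mul_mpolyC mpolyXE_id; apply: (PM) => //.
apply: big_ind => //; first exact: (PC 1).
by move=> i _; elim: (m i) => [|e IH]; [exact: (PC 1)|rewrite exprS; exact: PM].
Qed.

(** * Equivariance of transvectants *)

Section Omega.
Variable k : fieldType.
Implicit Types (A B p q : {mpoly k[2]}) (g : 'M[k]_2).

Lemma transvectantE m n r A B : transvectant m n r A B =
  (((m - r)`! * (n - r)`!)%N%:R / (m`! * n`!)%N%:R : k) *: omega r A B.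
Proof. by []. Qed.

(** One factor A_x B_y - A_y B_x of the omega operator is split off, and the two sums recombine by
    Pascal's rule. This recursion is what makes equivariance provable one factor at a time. *)
Lemma omegaS r A B : omega r.+1 A B =
  omega r A^`M(ord0) B^`M(ord_max) - omega r A^`M(ord_max) B^`M(ord0).
Proof.
pose T j := A^`M(ord0, r.+1 - j)^`M(ord_max, j) * B^`M(ord0, j)^`M(ord_max, r.+1 - j).
have -> : omega r A^`M(ord0) B^`M(ord_max) = \sum_(j < r.+1) (-1) ^+ j * 'C(r, j)%:R * T j.
  apply: eq_bigr => -[j jr] _ /=; rewrite ltnS in jr; rewrite /T subSn //.
  congr (_ * (_ * _)); first by rewrite -mderivSn.
  rewrite -!mderivmU1m -!mderivmDm; congr (_^`M[_]).
  by rewrite mulmS !addmA; congr (_ + _)%MM; rewrite addmC.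
have -> : omega r A^`M(ord_max) B^`M(ord0) = \sum_(j < r.+1) (-1) ^+ j * 'C(r, j)%:R * T j.+1.
  apply: eq_bigr => -[j jr] _ /=; rewrite ltnS in jr; rewrite /T subSS.
  congr (_ * (_ * _)); last by rewrite -mderivSn.
  rewrite -!mderivmU1m -!mderivmDm; congr (_^`M[_]).
  by rewrite mulmS !addmA; congr (_ + _)%MM; rewrite addmC.
have -> : omega r.+1 A B = \sum_(j < r.+2) (-1) ^+ j * 'C(r.+1, j)%:R * T j by [].
rewrite big_ord_recl bin0.
(* The added term has binomial coefficient zero; it aligns the index ranges for Pascal's rule. *)
have -> : \sum_(j < r.+1) (-1) ^+ j * 'C(r, j)%:R * T j =
    \sum_(j < r.+2) (-1) ^+ j * 'C(r, j)%:R * T j :> {mpoly k[2]}.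
  by rewrite [RHS]big_ord_recr /= bin_small // mulr0n mulr0 mul0r addr0.
rewrite [X in _ = X - _]big_ord_recl bin0 -addrA -sumrB; congr (_ + _); apply: eq_bigr => j _.
by rewrite /= binS -[bump 0 j]/(j.+1) natrD exprS; ring.
Qed.

Lemma omegaDl r A A' B : omega r (A + A') B = omega r A B + omega r A' B.
Proof.
by rewrite -big_split; apply: eq_bigr => j _; rewrite !mderivmD mulrDl mulrDr.
Qed.

Lemma omegaDr r A B B' : omega r A (B + B') = omega r A B + omega r A B'.
Proof.
by rewrite -big_split; apply: eq_bigr => j _; rewrite !mderivmD !mulrDr.
Qed.

Lemma omegaZl r c A B : omega r (c *: A) B = c *: omega r A B.
Proof.
by rewrite scaler_sumr; apply: eq_bigr => j _; rewrite !mderivmZ -scalerAl -scalerAr.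
Qed.

Lemma omegaZr r c A B : omega r A (c *: B) = c *: omega r A B.
Proof.
by rewrite scaler_sumr; apply: eq_bigr => j _; rewrite !mderivmZ -!scalerAr.
Qed.

Lemma omega_bilinear r a b c d A A' B B' :
  omega r (a *: A + b *: A') (c *: B + d *: B') =
  (a * c) *: omega r A B + (a * d) *: omega r A B'
  + ((b * c) *: omega r A' B + (b * d) *: omega r A' B').
Proof.
by rewrite omegaDl !omegaZl !omegaDr !omegaZr !scalerDr !scalerA.
Qed.

Lemma form_substM A B p q : form_subst (A * B) p q = form_subst A p q * form_subst B p q.
Proof. exact: rmorphM. Qed.

Lemma form_substD A B p q : form_subst (A + B) p q = form_subst A p q + form_subst B p q.
Proof. exact: raddfD. Qed.

Lemma form_subst_x p q : form_subst xvar p q = p.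
Proof. by rewrite /form_subst comp_mpolyXU. Qed.

Lemma form_subst_y p q : form_subst yvar p q = q.
Proof. by rewrite /form_subst comp_mpolyXU. Qed.

Lemma mderiv_form_subst A p q i :
  (form_subst A p q)^`M(i) = form_subst A^`M(ord0) p q * p^`M(i)
    + form_subst A^`M(ord_max) p q * q^`M(i).
Proof.
elim/mpoly_alg_ind: A => [c|j|A B IHA IHB|A B IHA IHB].
- by rewrite /form_subst comp_mpolyC !mderivC !raddf0 !mul0r addr0.
- rewrite !mderivXU; case: j => [[|[|]] Hj] //.
    have -> : Ordinal Hj = ord0 by exact: val_inj.
    rewrite -[X in (form_subst X _ _)^`M(_)]/xvar form_subst_x eqxx /=.
    by rewrite /form_subst raddf0 rmorph1 mul0r mul1r addr0.
  have -> : Ordinal Hj = ord_max by exact: val_inj.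
  rewrite -[X in (form_subst X _ _)^`M(_)]/yvar form_subst_y eqxx /=.
  by rewrite /form_subst raddf0 rmorph1 mul0r mul1r add0r.
- by rewrite form_substD [LHS]mderivD IHA IHB !mderivD !form_substD !mulrDl addrACA.
rewrite form_substM !mderivM IHA IHB !(form_substD, form_substM).
move: (form_subst A p q) (form_subst B p q) (form_subst A^`M(ord0) p q)
  (form_subst B^`M(ord0) p q) (form_subst A^`M(ord_max) p q) (form_subst B^`M(ord_max) p q)
  p^`M(i) q^`M(i) => *; ring.
Qed.

Lemma mderiv_x_mx_subst g A : (mx_subst g A)^`M(ord0) =
  g ord0 ord0 *: mx_subst g A^`M(ord0) + g ord_max ord0 *: mx_subst g A^`M(ord_max).
Proof.
rewrite /mx_subst mderiv_form_subst !mderivD !mderivZ !mderivXU /=.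
by rewrite !scaler0 !addr0 -!scalerAr !mulr1.
Qed.

Lemma mderiv_y_mx_subst g A : (mx_subst g A)^`M(ord_max) =
  g ord0 ord_max *: mx_subst g A^`M(ord0) + g ord_max ord_max *: mx_subst g A^`M(ord_max).
Proof.
rewrite /mx_subst mderiv_form_subst !mderivD !mderivZ !mderivXU /=.
by rewrite !scaler0 !add0r -!scalerAr !mulr1.
Qed.

Lemma mx_substM g A B : mx_subst g (A * B) = mx_subst g A * mx_subst g B.
Proof. exact: form_substM. Qed.

Lemma mx_substD g A B : mx_subst g (A + B) = mx_subst g A + mx_subst g B.
Proof. exact: form_substD. Qed.

Lemma mx_substB g A B : mx_subst g (A - B) = mx_subst g A - mx_subst g B.
Proof. exact: raddfB. Qed.

Lemma mx_substZ g c A : mx_subst g (c *: A) = c *: mx_subst g A.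
Proof. exact: linearZ. Qed.

Lemma det2 g : \det g = g ord0 ord0 * g ord_max ord_max - g ord0 ord_max * g ord_max ord0.
Proof.
rewrite (expand_det_row _ ord0) !big_ord_recl big_ord0 addr0 /cofactor !det_mx11 !mxE /=.
rewrite expr0 expr1 mul1r mulN1r mulrN.
by congr (_ * g _ _ - g _ _ * g _ _); apply: val_inj.
Qed.

(** Induction on r. By the chain rule and bilinearity one omega factor yields four terms for each of
    its two products; those with equal derivatives on both sides cancel, and the mixed ones combine
    to ad - bc = det g. *)
Lemma omega_subst g r A B :
  omega r (mx_subst g A) (mx_subst g B) = \det g ^+ r *: mx_subst g (omega r A B).
Proof.
elim: r A B => [|r IH] A B.
  by rewrite /omega !big_ord_recl !big_ord0 !addr0 !mderivn0 !mul1r scale1r mx_substM.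
rewrite !omegaS !mderiv_x_mx_subst !mderiv_y_mx_subst.
rewrite [LHS](congr2 (fun x y => x - y) (omega_bilinear _ _ _ _ _ _ _ _ _)
  (omega_bilinear _ _ _ _ _ _ _ _ _)).
rewrite !IH (mx_substB g (omega r A^`M(ord0) B^`M(ord_max))) [\det g ^+ r.+1]exprSr (det2 g).
move: (mx_subst g (omega r A^`M(ord0) B^`M(ord0)))
  (mx_subst g (omega r A^`M(ord0) B^`M(ord_max)))
  (mx_subst g (omega r A^`M(ord_max) B^`M(ord0)))
  (mx_subst g (omega r A^`M(ord_max) B^`M(ord_max))) => U V W Z.
rewrite -!mul_mpolyC !(mpolyCM, mpolyCB).
move: (g ord0 ord0)%:MP (g ord0 ord_max)%:MP (g ord_max ord0)%:MP (g ord_max ord_max)%:MP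
  => a b c d.
move: (_ ^+ r)%:MP => D; ring.
Qed.

Lemma transvectant_subst g m n r A B : \det g = 1 ->
  transvectant m n r (mx_subst g A) (mx_subst g B) = mx_subst g (transvectant m n r A B).
Proof. by move=> dg; rewrite !transvectantE omega_subst dg expr1n scale1r mx_substZ. Qed.

End Omega.

(** The normalising quotient of a transvectant over [coordring] is formed in a polynomial ring; this
    identifies it with a constant of k, so that it commutes with evaluation. *)
Lemma mpolyC_inv (k : fieldType) n (c : k) : (c%:MP_[n])^-1 = (c^-1)%:MP.
Proof.
have [->|nz] := eqVneq c 0; first by rewrite !invr0 mpolyC0.
by rewrite (rmorphV (@mpolyC n k)) ?unitfE.
Qed.

(** * Covariants, joint invariants and their degrees *)

Section Covariants.
Variable k : fieldType.
Notation coordring := {mpoly k[6 + 4]}.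
Implicit Types (v : 'I_(6 + 4) -> k) (A B : {mpoly coordring[2]}) (P Q : coordring).
Implicit Types (F G : {mpoly k[2]}) (g : 'M[k]_2).

Definition spec v A : {mpoly k[2]} := map_mpoly (meval v) A.

Lemma specM v A B : spec v (A * B) = spec v A * spec v B.
Proof. exact: rmorphM. Qed.

Lemma specX v A n : spec v (A ^+ n) = spec v A ^+ n.
Proof. exact: rmorphXn. Qed.

Lemma spec_mderivm v A m : spec v A^`M[m] = (spec v A)^`M[m].
Proof.
by apply/mpolyP => l; rewrite mcoeff_map_mpoly !mcoeff_mderivm mcoeff_map_mpoly raddfMn.
Qed.

Lemma spec_omega v r A B : spec v (omega r A B) = omega r (spec v A) (spec v B).
Proof.
rewrite /spec raddf_sum; apply: eq_bigr => j _ /=.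
rewrite -/(spec v _) !specM !spec_mderivm; congr (_ * _ * _).
  by rewrite -[LHS]/(spec v _) specX /spec rmorphN1.
by rewrite /spec rmorph_nat.
Qed.

Lemma meval_const_frac v (a b : nat) :
  (a%:R / b%:R : coordring).@[v] = a%:R / b%:R.
Proof. by rewrite mevalM rmorph_nat -[b%:R]mpolyC_nat mpolyC_inv mevalC. Qed.

Lemma spec_transvectant v m n r A B :
  spec v (transvectant m n r A B) = transvectant m n r (spec v A) (spec v B).
Proof.
rewrite [in RHS]transvectantE -spec_omega /spec [LHS]map_mpolyZ; congr (_ *: _).
exact: meval_const_frac.
Qed.

Lemma const_form_eval v A : (const_form A).@[v] = (spec v A)@_0.
Proof. by rewrite /const_form mcoeff_map_mpoly. Qed.

Lemma spec_form_of_coord v n (a : 'I_n.+1 -> coordring) :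
  spec v (form_of_coord a) = form_of_coord (fun i => (a i).@[v]).
Proof.
rewrite /spec /form_of_coord raddf_sum; apply: eq_bigr => i _ /=.
by rewrite map_mpolyZ !mono2E map_mpolyX.
Qed.

Lemma spec_genF v : spec v (genF k) = form_of_coord (fun a : 'I_6 => v (lshift 4 a)).
Proof. by rewrite spec_form_of_coord; apply: eq_form_of_coord => i; rewrite mevalXU. Qed.

Lemma spec_genG v : spec v (genG k) = form_of_coord (fun b : 'I_4 => v (rshift 6 b)).
Proof. by rewrite spec_form_of_coord; apply: eq_form_of_coord => i; rewrite mevalXU. Qed.

Lemma spec_pair_genF F G : F \is 5.-homog -> spec (pair_coord F G) (genF k) = F.
Proof.
move=> hF; rewrite spec_genF -[RHS](form_coordK hF); apply: eq_form_of_coord => i.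
by rewrite /pair_coord (unsplitK (inl i)).
Qed.

Lemma spec_pair_genG F G : G \is 3.-homog -> spec (pair_coord F G) (genG k) = G.
Proof.
move=> hG; rewrite spec_genG -[RHS](form_coordK hG); apply: eq_form_of_coord => i.
by rewrite /pair_coord (unsplitK (inr i)).
Qed.

(** The degree d is the total degree in F and G, tested with the scalar 2 only, which is all that
    [homog_of_meval] asks for. Both conditions concern specialisations and are inherited by
    transvectants, because these commute with [spec]. *)
Definition covariant d A := 
  (forall g, \det g = 1 -> forall F G, F \is 5.-homog -> G \is 3.-homog ->
    spec (pair_coord (mx_subst g F) (mx_subst g G)) A
    = mx_subst g (spec (pair_coord F G) A))
  /\ forall v, spec (fun i => 2%:R * v i) A = 2%:R ^+ d *: spec v A.

Definition joint_invariant d P := SL2_invariant P /\ P \is d.-homog.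

Lemma mx_subst_homog g n F : F \is n.-homog -> mx_subst g F \is n.-homog.
Proof.
move=> hF; rewrite -(form_coordK hF) /form_of_coord /mx_subst /form_subst raddf_sum.
apply: rpred_sum => i _ /=; rewrite comp_mpolyZ rmorphM !rmorphXn /=.
apply: rpredZ.
have lin (a b : k) : a *: xvar + b *: yvar \is [in k[2], 1.-homog].
  by rewrite rpredD // rpredZ // dhomogX /= mdeg1.
rewrite -!/(form_subst _ _ _) form_subst_x form_subst_y.
have := dhomogM (dhomogMn (n - i) (lin (g ord0 ord0) (g ord0 ord_max)))
  (dhomogMn i (lin (g ord_max ord0) (g ord_max ord_max))).
by rewrite !mul1n subnK // -ltnS.
Qed.

Lemma covariantM d e A B : covariant d A -> covariant e B -> covariant (d + e) (A * B).
Proof.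
move=> [eqA scA] [eqB scB]; split=> [g dg F G hF hG|v].
  by rewrite !specM eqA // eqB // mx_substM.
by rewrite !specM scA scB -scalerAl -scalerAr scalerA exprD.
Qed.

Lemma covariantX d A n : covariant d A -> covariant (d * n) (A ^+ n).
Proof.
move=> cA; elim: n => [|n IH]; last by rewrite exprS mulnS; exact: covariantM.
rewrite muln0 expr0; split=> [g dg F G hF hG|v]; rewrite /spec !rmorph1 //.
by rewrite /mx_subst /form_subst rmorph1.
by rewrite expr0 scale1r.
Qed.

Lemma covariant_transvectant d e m n r A B : covariant d A -> covariant e B ->
  covariant (d + e) (transvectant m n r A B).
Proof.
move=> [eqA scA] [eqB scB]; split=> [g dg F G hF hG|v].
  by rewrite !spec_transvectant eqA // eqB // transvectant_subst.
rewrite !spec_transvectant scA scB !transvectantE omegaZl omegaZr !scalerA.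
by congr (_ *: _); rewrite exprD; ring.
Qed.

Lemma covariant_genF : covariant 1 (genF k).
Proof.
split=> [g dg F G hF hG|v]; first by rewrite !spec_pair_genF ?mx_subst_homog.
by rewrite !spec_genF expr1 -form_of_coordZ.
Qed.

Lemma covariant_genG : covariant 1 (genG k).
Proof.
split=> [g dg F G hF hG|v]; first by rewrite !spec_pair_genG ?mx_subst_homog.
by rewrite !spec_genG expr1 -form_of_coordZ.
Qed.

Lemma mcoeff0_meval F : F@_0 = F.@[fun=> 0].
Proof.
elim/mpoly_alg_ind: F => [c|i|p q Hp Hq|p q Hp Hq].
- by rewrite mevalC mcoeffC eqxx mulr1.
- by rewrite mevalXU mcoeffX mnm1_eq0.
- by rewrite mcoeffD mevalD Hp Hq.
by rewrite mcoeff0M mevalM Hp Hq.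
Qed.

Lemma mcoeff0_mx_subst g F : (mx_subst g F)@_0 = F@_0.
Proof.
rewrite !mcoeff0_meval comp_mpoly_meval; apply: meval_eq => i.
case: i => [[|[|]] Hi] //; rewrite (tnth_nth 0) /= mevalD !mevalZ !mevalXU; ring.
Qed.

Hypothesis char0 : [pchar k] =i pred0.

(** A linear substitution fixes the origin, hence it preserves the constant coefficient of a
    form. *)
Lemma const_form_invariant d A : covariant d A -> joint_invariant d (const_form A).
Proof.
move=> [eqA scA]; split=> [g dg F G hF hG|].
  by rewrite !const_form_eval eqA // mcoeff0_mx_subst.
by apply: homog_of_meval => // v; rewrite !const_form_eval scA mcoeffZ.
Qed.

Lemma joint_invariantM d e P Q :
  joint_invariant d P -> joint_invariant e Q -> joint_invariant (d + e) (P * Q).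
Proof.
move=> [iP hP] [iQ hQ]; split; last exact: dhomogM.
by move=> g dg F G hF hG; rewrite !mevalM iP // iQ.
Qed.

Lemma joint_invariantX d P n : joint_invariant d P -> joint_invariant (d * n) (P ^+ n).
Proof.
move=> [iP hP]; split; last exact: dhomogMn.
by move=> g dg F G hF hG; rewrite !rmorphXn /= iP.
Qed.

Lemma joint_invariantD d e P Q : joint_invariant d P -> joint_invariant e Q -> d = e ->
  joint_invariant d (P + Q).
Proof.
move=> [iP hP] [iQ hQ] de; split; last by rewrite rpredD // de.
by move=> g dg F G hF hG; rewrite !mevalD iP // iQ.
Qed.

Lemma joint_invariantN d P : joint_invariant d P -> joint_invariant d (- P).
Proof.
move=> [iP hP]; split; last by rewrite rpredN.
by move=> g dg F G hF hG; rewrite !mevalN iP.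
Qed.

Lemma joint_invariantC c : joint_invariant 0 c%:MP.
Proof.
split=> [g dg F G hF hG|]; first by rewrite !mevalC.
by rewrite -[c%:MP]mulr1 mul_mpolyC rpredZ // dhomog1.
Qed.

Lemma joint_invariant_nat n : joint_invariant 0 n%:R.
Proof. by rewrite -mpolyC_nat; exact: joint_invariantC. Qed.

Lemma joint_invariant_frac m n : joint_invariant 0 (m%:R / n%:R).
Proof. by rewrite -!mpolyC_nat mpolyC_inv -mpolyCM; exact: joint_invariantC. Qed.

End Covariants.

(** * The numerators as joint invariants *)

Section Generators.
Variable k : fieldType.
Hypothesis char0 : [pchar k] =i pred0.

Let cF := covariant_genF k.
Let cG := covariant_genG k.
Let cH : covariant 2 (cov_H k) := covariant_transvectant 5 5 2 cF cF.
Let ci : covariant 2 (cov_i k) := covariant_transvectant 5 5 4 cF cF.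
Let ct : covariant 3 (cov_t k) := covariant_transvectant 5 6 1 cF cH.
Let cc35 : covariant 3 (cov_c35 k) := covariant_transvectant 2 5 1 ci cF.
Let cc33 : covariant 3 (cov_c33 k) := covariant_transvectant 2 5 2 ci cF.
Let ch : covariant 2 (cov_h k) := covariant_transvectant 3 3 2 cG cG.
Let cq : covariant 3 (cov_q k) := covariant_transvectant 3 2 1 cG ch.

Let full m n r d e A B (cA : @covariant k d A) (cB : covariant e B) :=
  const_form_invariant char0 (covariant_transvectant m n r cA cB).

Lemma inv_D_joint : joint_invariant 4 (inv_D k).
Proof. exact: (full 2 2 2 ch ch). Qed.
Lemma inv_A_joint : joint_invariant 4 (inv_A k).
Proof. exact: (full 5 5 5 cF (covariantM cG ch)). Qed.
Lemma inv_L_joint : joint_invariant 6 (inv_L k).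
Proof. exact: (full 5 5 5 cF (covariantM ch cq)). Qed.
Lemma inv_B1_joint : joint_invariant 4 (inv_B1 k).
Proof. exact: (full 2 2 2 ci ch). Qed.
Lemma inv_B2_joint : joint_invariant 4 (inv_B2 k).
Proof. exact: (full 6 6 6 cH (covariantX 2 cG)). Qed.
Lemma inv_M_joint : joint_invariant 6 (inv_M k).
Proof. exact: (full 6 6 6 cH (covariantM cG cq)). Qed.
Lemma inv_N_joint : joint_invariant 8 (inv_N k).
Proof. exact: (full 6 6 6 cH (covariantX 2 cq)). Qed.
Lemma inv_R_joint : joint_invariant 4 (inv_R k).
Proof. exact: (full 3 3 3 cc33 cG). Qed.
Lemma inv_S1_joint : joint_invariant 6 (inv_S1 k).
Proof. exact: (full 3 3 3 cc33 cq). Qed.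
Lemma inv_S2_joint : joint_invariant 6 (inv_S2 k).
Proof. exact: (full 5 5 5 cc35 (covariantM cG ch)). Qed.
Lemma inv_S3_joint : joint_invariant 6 (inv_S3 k).
Proof. exact: (full 9 9 9 ct (covariantX 3 cG)). Qed.
Lemma inv_T1_joint : joint_invariant 8 (inv_T1 k).
Proof. exact: (full 5 5 5 cc35 (covariantM ch cq)). Qed.
Lemma inv_T2_joint : joint_invariant 8 (inv_T2 k).
Proof. exact: (full 9 9 9 ct (covariantM (covariantX 2 cG) cq)). Qed.
Lemma inv_T3_joint : joint_invariant 8 (inv_T3 k).
Proof. exact: (full 15 15 15 (covariantX 3 cF) (covariantX 5 cG)). Qed.
Lemma inv_W_joint : joint_invariant 10 (inv_W k).
Proof. exact: (full 15 15 15 (covariantX 3 cF) (covariantM (covariantX 4 cG) cq)). Qed.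

Lemma joint_invariant_eq d e P : @joint_invariant k d P -> d = e -> joint_invariant e P.
Proof. by move=> + <-. Qed.

(** Follows the syntax of a numerator and leaves the degrees as existential variables; [reflexivity]
    in the sum case verifies that the summands have equal degree. Fractions are matched before
    products, since [a / b] is itself a product. *)
Local Ltac joint :=
  lazymatch goal with
  | |- joint_invariant _ (_ + _) => eapply joint_invariantD; [joint | joint | reflexivity]
  | |- joint_invariant _ (- _) => eapply joint_invariantN; joint
  | |- joint_invariant _ (_ ^+ _) => eapply joint_invariantX; joint
  | |- joint_invariant _ (1 / _%:R) => exact (joint_invariant_frac k 1 _)
  | |- joint_invariant _ (_%:R / _%:R) => exact (joint_invariant_frac k _ _)
  | |- joint_invariant _ (_ * _) => eapply joint_invariantM; [joint | joint]
  | |- joint_invariant _ (inv_D _) => exact inv_D_joint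
  | |- joint_invariant _ (inv_A _) => exact inv_A_joint
  | |- joint_invariant _ (inv_L _) => exact inv_L_joint
  | |- joint_invariant _ (inv_B1 _) => exact inv_B1_joint
  | |- joint_invariant _ (inv_B2 _) => exact inv_B2_joint
  | |- joint_invariant _ (inv_M _) => exact inv_M_joint
  | |- joint_invariant _ (inv_N _) => exact inv_N_joint
  | |- joint_invariant _ (inv_R _) => exact inv_R_joint
  | |- joint_invariant _ (inv_S1 _) => exact inv_S1_joint
  | |- joint_invariant _ (inv_S2 _) => exact inv_S2_joint
  | |- joint_invariant _ (inv_S3 _) => exact inv_S3_joint
  | |- joint_invariant _ (inv_T1 _) => exact inv_T1_joint
  | |- joint_invariant _ (inv_T2 _) => exact inv_T2_joint
  | |- joint_invariant _ (inv_T3 _) => exact inv_T3_joint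
  | |- joint_invariant _ (inv_W _) => exact inv_W_joint
  | |- joint_invariant _ _%:R => exact (joint_invariant_nat k _)
  end.
Local Ltac joint_of P := cbv delta [P]; eapply joint_invariant_eq; [joint | reflexivity].

(** The third constant stays 20432412, because the factor 3 of 3 U_3 sits in the numerator. *)
Definition den_const : 14.-tuple nat :=
  [tuple 3; 54; 20432412; 18; 2270268; 27027; 1; 1; 1; 1; 1; 1; 1; 1]%N.
Definition den_exp : 14.-tuple nat :=
  [tuple 1; 3; 4; 3; 4; 6; 3; 3; 4; 4; 4; 6; 6; 6]%N.

(** D has degree 4, so this degree is that of the power of D in the denominator and the generator
    has degree zero. *)
Lemma numerator_joint i :
  joint_invariant (4 * tnth den_exp i) (tnth (generators k) i).1.
Proof.
have P1j : joint_invariant 4 (P1 k) by joint_of P1.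
have P2j : joint_invariant 12 (P2 k) by joint_of P2.
have P3j : joint_invariant 16 (3%:R * P3 k) by joint_of P3.
have P4j : joint_invariant 12 (P4 k) by joint_of P4.
have P5j : joint_invariant 16 (P5 k) by joint_of P5.
have P6j : joint_invariant 24 (P6 k) by joint_of P6.
have Q1j : joint_invariant 12 (Q_e2 k) by joint_of Q_e2.
have Q2j : joint_invariant 12 (Q_p02 k) by joint_of Q_p02.
have Q3j : joint_invariant 16 (Q_p12 k) by joint_of Q_p12.
have Q4j : joint_invariant 16 (Q_p03 k) by joint_of Q_p03.
have Q5j : joint_invariant 16 (Q_w2 k) by joint_of Q_w2.
have Q6j : joint_invariant 24 (Q_w21 k) by joint_of Q_w21.
have Q7j : joint_invariant 24 (Q_w12 k) by joint_of Q_w12.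
have Q8j : joint_invariant 24 (Q_w03 k) by joint_of Q_w03.
case: i => [[|[|[|[|[|[|[|[|[|[|[|[|[|[|i]]]]]]]]]]]]]] Hi]; [..|by []];
  rewrite (tnth_nth 0%N) (tnth_nth (0, 0));
  cbv [generators den_exp tuple tval nth fst snd nat_of_ord];
  [exact P1j | exact P2j | exact P3j | exact P4j | exact P5j | exact P6j | exact Q1j
  |exact Q2j | exact Q3j | exact Q4j | exact Q5j | exact Q6j | exact Q7j | exact Q8j].
Qed.

Lemma denominatorE i : (tnth (generators k) i).2 =
  (tnth den_const i)%:R * inv_D k ^+ tnth den_exp i.
Proof.
case: i => [[|[|[|[|[|[|[|[|[|[|[|[|[|[|i]]]]]]]]]]]]]] Hi]; [..|by []];
  rewrite !(tnth_nth 0%N) (tnth_nth (0, 0));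
  cbv [generators den_const den_exp tuple tval nth fst snd nat_of_ord];
  [reflexivity | reflexivity | reflexivity | reflexivity | reflexivity | reflexivity
  |exact (esym (mul1r _)) ..].
Qed.

Lemma den_const_neq0 i : (tnth den_const i)%:R != 0 :> k.
Proof.
rewrite natr_neq0 //.
by case: i => [[|[|[|[|[|[|[|[|[|[|[|[|[|[|i]]]]]]]]]]]]]] Hi].
Qed.

End Generators.

(** * Symbolic evaluation on coefficient lists *)

Section Coefs.
Variable k : comUnitRingType.

Lemma lform_of_coord n (a : seq k) : size a = n.+1 ->
  lform a = form_of_coord (fun i : 'I_n.+1 => nth 0 a i).
Proof.
rewrite /form_of_coord; elim: n a => [|n IH] [|c a] // [sa].
  by rewrite (size0nil sa) /= mulr0 addr0 big_ord_recl big_ord0 addr0 subn0 mulr1.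
rewrite big_ord_recl /= subn0 mulr1 sa (IH _ sa) mulr_sumr; congr (_ + _).
apply: eq_bigr => i _; rewrite /bump add1n subSS -scalerAr.
by congr (_ *: _); rewrite mulrCA exprS.
Qed.

Lemma mcoeff_lform n (a : seq k) j : size a = n.+1 -> (j <= n)%N ->
  (lform a)@_[multinom [tuple (n - j)%N; j]] = nth 0 a j.
Proof.
move=> sa jn; rewrite (lform_of_coord sa).
exact: (form_of_coordK _ (Ordinal (jn : j < n.+1)%N)).
Qed.

Lemma lform_homog n (a : seq k) : size a = n.+1 -> lform a \is n.-homog.
Proof. by move=> sa; rewrite (lform_of_coord sa); exact: form_of_coord_homog. Qed.

End Coefs.

Section FullList.
Variable k : fieldType.
Hypothesis char0 : [pchar k] =i pred0.

(** A [foldr] instead of a big operator lets [cbv] unfold the sum, for a concrete order, into a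
    field expression. *)
Lemma full_transvectant_lform n (a b : seq k) : size a = n.+1 -> size b = n.+1 ->
  (transvectant n n n (lform a) (lform b))@_0 =
  foldr (fun j s => (-1) ^+ j / 'C(n, j)%:R * (nth 0 a j * nth 0 b (n - j)) + s)
    0 (iota 0 n.+1).
Proof.
move=> sa sb; pose F j := (-1) ^+ j / 'C(n, j)%:R * (nth 0 a j * nth 0 b (n - j)) : k.
transitivity (\sum_(j <- iota 0 n.+1) F j); last by rewrite unlock.
rewrite full_transvectant // -[iota 0 n.+1]/(index_iota 0 n.+1) big_mkord.
apply: eq_bigr => -[j jn] _ /=; rewrite (mcoeff_lform sa) //.
by rewrite -[j in [tuple j; _]](subKn (jn : j <= n)%N) (mcoeff_lform sb) ?leq_subr.
Qed.

End FullList.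

Local Ltac unfold_lists := cbv [ltrans lterm lsum ladd lscale lmul ldx ldy iter
  iota map size cat nseq ncons nth foldr subn Nat.sub falling_factorial ffact_rec
  predn Nat.pred muln Nat.mul addn Nat.add].

(* The list computations unfold the recursion of binomial, which is exponential. *)
Lemma binomial15 : ('C(15, 0) = 1) * ('C(15, 1) = 15) * ('C(15, 2) = 105) *
  ('C(15, 3) = 455) * ('C(15, 4) = 1365) * ('C(15, 5) = 3003) * ('C(15, 6) = 5005) *
  ('C(15, 7) = 6435) * ('C(15, 8) = 6435) * ('C(15, 9) = 5005) * ('C(15, 10) = 3003) *
  ('C(15, 11) = 1365) * ('C(15, 12) = 455) * ('C(15, 13) = 105) * ('C(15, 14) = 15) *
  ('C(15, 15) = 1)%N.
Proof. by vm_compute. Qed.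

Section EvalRules.
Variable k : fieldType.
Variable pt : 'I_(6 + 4) -> k.
Implicit Types P Q : {mpoly k[6 + 4]}.

Lemma eval_add P Q a b : P.@[pt] = a -> Q.@[pt] = b -> (P + Q).@[pt] = a + b.
Proof. by rewrite mevalD => -> ->. Qed.

Lemma eval_opp P a : P.@[pt] = a -> (- P).@[pt] = - a.
Proof. by rewrite mevalN => ->. Qed.

Lemma eval_mul P Q a b : P.@[pt] = a -> Q.@[pt] = b -> (P * Q).@[pt] = a * b.
Proof. by rewrite mevalM => -> ->. Qed.

Lemma eval_exp P a n : P.@[pt] = a -> (P ^+ n).@[pt] = a ^+ n.
Proof. by move=> <-; exact: rmorphXn. Qed.

Lemma eval_nat n : (n%:R : {mpoly k[6 + 4]}).@[pt] = n%:R.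
Proof. exact: rmorph_nat. Qed.

Lemma eval_frac m n : (m%:R / n%:R : {mpoly k[6 + 4]}).@[pt] = m%:R / n%:R.
Proof. exact: meval_const_frac. Qed.

End EvalRules.

(** Exhibiting b as a factor of Y cancels it at once, so that b is in no denominator of the
    identities left to [field]. *)
Lemma frac_mul (k : fieldType) (a b Y Z T : k) :
  b != 0 -> Y = b * Z -> a * Z = T -> a / b * Y = T.
Proof. by move=> b0 -> <-; field. Qed.

(** * The invariants on the slice *)

Section SliceValues.
Variable k : fieldType.
Hypothesis char0 : [pchar k] =i pred0.
Variables f0 f1 f2 f3 f4 f5 : k.

Local Tactic Notation "list_transvectant" constr(m) constr(n) constr(r) constr(a) constr(b) :=
  rewrite (@lform_trans _ char0 m n r a b erefl erefl isT isT);
  apply: (congr1 (@lform _)); unfold_lists.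
Local Tactic Notation "list_full_transvectant" constr(n) constr(a) constr(b) :=
  rewrite (@full_transvectant_lform _ char0 n a b erefl erefl); unfold_lists.

Local Ltac field_tac := field;
  repeat (apply/andP; split);
  lazymatch goal with
  | |- is_true (_%:R != 0) => apply: (natr_neq0 char0); exact isT
  | |- _ => exact: oner_neq0
  end.

(** Coefficients of F, of G = x^3 + y^3, of the covariants of this pair and of their products. The
    lists are claims, verified below coefficient by coefficient. *)
Local Notation lF := ([:: f0; f1; f2; f3; f4; f5] : seq k).
Local Notation lG := ([:: 1; 0; 0; 1] : seq k).
Local Notation lH :=
  ([:: 1 / 5%:R * f0 * f2 - 2%:R / 25%:R * f1 ^+ 2; 3%:R / 5%:R * f0 * f3 -
    3%:R / 25%:R * f1 * f2; 6%:R / 5%:R * f0 * f4 + 3%:R / 25%:R * f1 * f3 -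
    3%:R / 25%:R * f2 ^+ 2; 2%:R * f0 * f5 + 14%:R / 25%:R * f1 * f4 - 4%:R /
    25%:R * f2 * f3; 6%:R / 5%:R * f1 * f5 + 3%:R / 25%:R * f2 * f4 - 3%:R /
    25%:R * f3 ^+ 2; 3%:R / 5%:R * f2 * f5 - 3%:R / 25%:R * f3 * f4; 1 / 5%:R
    * f3 * f5 - 2%:R / 25%:R * f4 ^+ 2] : seq k).
Local Notation li :=
  ([:: 2%:R / 5%:R * f0 * f4 - 4%:R / 25%:R * f1 * f3 + 3%:R / 50%:R * f2 ^+
    2; 2%:R * f0 * f5 - 6%:R / 25%:R * f1 * f4 + 1 / 25%:R * f2 * f3; 2%:R /
    5%:R * f1 * f5 - 4%:R / 25%:R * f2 * f4 + 3%:R / 50%:R * f3 ^+ 2] : seq k).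
Local Notation lt :=
  ([:: 1 / 10%:R * f0 ^+ 2 * f3 - 3%:R / 50%:R * f0 * f1 * f2 + 2%:R / 125%:R
    * f1 ^+ 3; 2%:R / 5%:R * f0 ^+ 2 * f4 + 1 / 50%:R * f0 * f1 * f3 - 3%:R /
    25%:R * f0 * f2 ^+ 2 + 9%:R / 250%:R * f1 ^+ 2 * f2; f0 ^+ 2 * f5 + 11%:R
    / 25%:R * f0 * f1 * f4 - 17%:R / 50%:R * f0 * f2 * f3 + 8%:R / 125%:R * f1
    ^+ 2 * f3 + 3%:R / 250%:R * f1 * f2 ^+ 2; 7%:R / 5%:R * f0 * f1 * f5 -
    17%:R / 50%:R * f0 * f3 ^+ 2 + 29%:R / 125%:R * f1 ^+ 2 * f4 - 1 / 250%:R
    * f1 * f2 * f3 + 1 / 125%:R * f2 ^+ 3 - 4%:R / 25%:R * f0 * f2 * f4; 1 /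
    2%:R * f0 * f2 * f5 - 4%:R / 5%:R * f0 * f3 * f4 + 16%:R / 25%:R * f1 ^+ 2
    * f5 + 47%:R / 250%:R * f1 * f2 * f4 - 11%:R / 125%:R * f1 * f3 ^+ 2 +
    2%:R / 125%:R * f2 ^+ 2 * f3; - 16%:R / 25%:R * f0 * f4 ^+ 2 + 4%:R / 5%:R
    * f1 * f2 * f5 - 47%:R / 250%:R * f1 * f3 * f4 + 11%:R / 125%:R * f2 ^+ 2
    * f4 - 2%:R / 125%:R * f2 * f3 ^+ 2 - 1 / 2%:R * f0 * f3 * f5; 4%:R /
    25%:R * f1 * f3 * f5 - 29%:R / 125%:R * f1 * f4 ^+ 2 + 17%:R / 50%:R * f2
    ^+ 2 * f5 + 1 / 250%:R * f2 * f3 * f4 - 1 / 125%:R * f3 ^+ 3 - 7%:R / 5%:R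
    * f0 * f4 * f5; 17%:R / 50%:R * f2 * f3 * f5 - 8%:R / 125%:R * f2 * f4 ^+
    2 - 3%:R / 250%:R * f3 ^+ 2 * f4 - 11%:R / 25%:R * f1 * f4 * f5 - f0 * f5
    ^+ 2; 3%:R / 25%:R * f3 ^+ 2 * f5 - 9%:R / 250%:R * f3 * f4 ^+ 2 - 1 /
    50%:R * f2 * f4 * f5 - 2%:R / 5%:R * f1 * f5 ^+ 2; 3%:R / 50%:R * f3 * f4
    * f5 - 2%:R / 125%:R * f4 ^+ 3 - 1 / 10%:R * f2 * f5 ^+ 2] : seq k).
Local Notation lc35 :=
  ([:: 1 / 5%:R * f0 * f1 * f4 - 4%:R / 125%:R * f1 ^+ 2 * f3 + 3%:R / 250%:R
    * f1 * f2 ^+ 2 - f0 ^+ 2 * f5 - 1 / 50%:R * f0 * f2 * f3; 8%:R / 25%:R *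
    f0 * f2 * f4 - 19%:R / 250%:R * f1 * f2 * f3 + 3%:R / 125%:R * f2 ^+ 3 -
    f0 * f1 * f5 + 9%:R / 125%:R * f1 ^+ 2 * f4 - 3%:R / 50%:R * f0 * f3 ^+ 2;
    6%:R / 25%:R * f0 * f3 * f4 - 18%:R / 125%:R * f1 * f3 ^+ 2 + 4%:R /
    125%:R * f2 ^+ 2 * f3 - 1 / 5%:R * f0 * f2 * f5 + 19%:R / 125%:R * f1 * f2
    * f4 - 8%:R / 25%:R * f1 ^+ 2 * f5; 8%:R / 25%:R * f0 * f4 ^+ 2 - 19%:R /
    125%:R * f1 * f3 * f4 + 18%:R / 125%:R * f2 ^+ 2 * f4 + 1 / 5%:R * f0 * f3
    * f5 - 4%:R / 125%:R * f2 * f3 ^+ 2 - 6%:R / 25%:R * f1 * f2 * f5; f0 * f4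
    * f5 - 8%:R / 25%:R * f1 * f3 * f5 + 3%:R / 50%:R * f2 ^+ 2 * f5 - 9%:R /
    125%:R * f1 * f4 ^+ 2 + 19%:R / 250%:R * f2 * f3 * f4 - 3%:R / 125%:R * f3
    ^+ 3; f0 * f5 ^+ 2 - 1 / 5%:R * f1 * f4 * f5 + 1 / 50%:R * f2 * f3 * f5 +
    4%:R / 125%:R * f2 * f4 ^+ 2 - 3%:R / 250%:R * f3 ^+ 2 * f4] : seq k).
Local Notation lc33 :=
  ([:: - 3%:R / 25%:R * f0 * f2 * f4 - 3%:R / 125%:R * f1 * f2 * f3 + 3%:R /
    500%:R * f2 ^+ 3 + 6%:R / 125%:R * f1 ^+ 2 * f4 + 3%:R / 50%:R * f0 * f3
    ^+ 2; 3%:R / 25%:R * f0 * f3 * f4 - 3%:R / 250%:R * f1 * f3 ^+ 2 + 3%:R /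
    500%:R * f2 ^+ 2 * f3 - 3%:R / 5%:R * f0 * f2 * f5 - 3%:R / 125%:R * f1 *
    f2 * f4 + 6%:R / 25%:R * f1 ^+ 2 * f5; 6%:R / 25%:R * f0 * f4 ^+ 2 - 3%:R
    / 125%:R * f1 * f3 * f4 - 3%:R / 250%:R * f2 ^+ 2 * f4 - 3%:R / 5%:R * f0
    * f3 * f5 + 3%:R / 500%:R * f2 * f3 ^+ 2 + 3%:R / 25%:R * f1 * f2 * f5; -
    3%:R / 25%:R * f1 * f3 * f5 + 3%:R / 50%:R * f2 ^+ 2 * f5 + 6%:R / 125%:R
    * f1 * f4 ^+ 2 - 3%:R / 125%:R * f2 * f3 * f4 + 3%:R / 500%:R * f3 ^+ 3] : seq k).
Local Notation lh := ([:: 0; 2%:R; 0] : seq k).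
Local Notation lq := ([:: 1; 0; 0; - 1] : seq k).
Local Notation lGh := ([:: 0; 2%:R; 0; 0; 2%:R; 0] : seq k).
Local Notation lhq := ([:: 0; 2%:R; 0; 0; - 2%:R; 0] : seq k).
Local Notation lGG := ([:: 1; 0; 0; 2%:R; 0; 0; 1] : seq k).
Local Notation lGq := ([:: 1; 0; 0; 0; 0; 0; - 1] : seq k).
Local Notation lqq := ([:: 1; 0; 0; - 2%:R; 0; 0; 1] : seq k).
Local Notation lGGG := ([:: 1; 0; 0; 3%:R; 0; 0; 3%:R; 0; 0; 1] : seq k).
Local Notation lGGq := ([:: 1; 0; 0; 1; 0; 0; - 1; 0; 0; - 1] : seq k).
Local Notation lG4 := ([:: 1; 0; 0; 4%:R; 0; 0; 6%:R; 0; 0; 4%:R; 0; 0; 1] : seq k).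
Local Notation lG5 :=
  ([:: 1; 0; 0; 5%:R; 0; 0; 10%:R; 0; 0; 10%:R; 0; 0; 5%:R; 0; 0; 1] : seq k).
Local Notation lG4q :=
  ([:: 1; 0; 0; 3%:R; 0; 0; 2%:R; 0; 0; - 2%:R; 0; 0; - 3%:R; 0; 0; - 1] : seq k).
Local Notation lFF :=
  ([:: f0 ^+ 2; 2%:R * f0 * f1; 2%:R * f0 * f2 + f1 ^+ 2; 2%:R * f0 * f3 +
    2%:R * f1 * f2; 2%:R * f0 * f4 + 2%:R * f1 * f3 + f2 ^+ 2; 2%:R * f0 * f5
    + 2%:R * f1 * f4 + 2%:R * f2 * f3; 2%:R * f1 * f5 + 2%:R * f2 * f4 + f3 ^+
    2; 2%:R * f2 * f5 + 2%:R * f3 * f4; 2%:R * f3 * f5 + f4 ^+ 2; 2%:R * f4 *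
    f5; f5 ^+ 2] : seq k).
Local Notation lF3 :=
  ([:: f0 ^+ 3; 3%:R * f0 ^+ 2 * f1; 3%:R * f0 ^+ 2 * f2 + 3%:R * f0 * f1 ^+
    2; 3%:R * f0 ^+ 2 * f3 + 6%:R * f0 * f1 * f2 + f1 ^+ 3; 3%:R * f0 ^+ 2 *
    f4 + 6%:R * f0 * f1 * f3 + 3%:R * f0 * f2 ^+ 2 + 3%:R * f1 ^+ 2 * f2; 3%:R
    * f0 ^+ 2 * f5 + 6%:R * f0 * f1 * f4 + 6%:R * f0 * f2 * f3 + 3%:R * f1 ^+
    2 * f3 + 3%:R * f1 * f2 ^+ 2; 6%:R * f0 * f1 * f5 + 6%:R * f0 * f2 * f4 +
    3%:R * f0 * f3 ^+ 2 + 3%:R * f1 ^+ 2 * f4 + 6%:R * f1 * f2 * f3 + f2 ^+ 3;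
    6%:R * f0 * f2 * f5 + 6%:R * f0 * f3 * f4 + 3%:R * f1 ^+ 2 * f5 + 6%:R *
    f1 * f2 * f4 + 3%:R * f1 * f3 ^+ 2 + 3%:R * f2 ^+ 2 * f3; 6%:R * f0 * f3 *
    f5 + 3%:R * f0 * f4 ^+ 2 + 6%:R * f1 * f2 * f5 + 6%:R * f1 * f3 * f4 +
    3%:R * f2 ^+ 2 * f4 + 3%:R * f2 * f3 ^+ 2; 6%:R * f0 * f4 * f5 + 6%:R * f1
    * f3 * f5 + 3%:R * f1 * f4 ^+ 2 + 3%:R * f2 ^+ 2 * f5 + 6%:R * f2 * f3 *
    f4 + f3 ^+ 3; 3%:R * f0 * f5 ^+ 2 + 6%:R * f1 * f4 * f5 + 6%:R * f2 * f3 *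
    f5 + 3%:R * f2 * f4 ^+ 2 + 3%:R * f3 ^+ 2 * f4; 3%:R * f1 * f5 ^+ 2 + 6%:R
    * f2 * f4 * f5 + 3%:R * f3 ^+ 2 * f5 + 3%:R * f3 * f4 ^+ 2; 3%:R * f2 * f5
    ^+ 2 + 6%:R * f3 * f4 * f5 + f4 ^+ 3; 3%:R * f3 * f5 ^+ 2 + 3%:R * f4 ^+ 2
    * f5; 3%:R * f4 * f5 ^+ 2; f5 ^+ 3] : seq k).
Local Notation slice_pt := (pair_coord (lform lF) (lform lG)).

Lemma slice_F : spec slice_pt (genF k) = lform lF.
Proof. exact/spec_pair_genF/lform_homog. Qed.

Lemma slice_G : spec slice_pt (genG k) = lform lG.
Proof. exact/spec_pair_genG/lform_homog. Qed.

Lemma slice_h : spec slice_pt (cov_h k) = lform lh.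
Proof.
rewrite [LHS](spec_transvectant _ 3 3 2).
apply: etrans (congr2 (transvectant 3 3 2) slice_G slice_G) _.
by list_transvectant 3%N 3%N 2%N lG lG;
  cbv [binomial]; congr [:: _; _; _]; field_tac.
Qed.

Lemma slice_q : spec slice_pt (cov_q k) = lform lq.
Proof.
rewrite [LHS](spec_transvectant _ 3 2 1).
apply: etrans (congr2 (transvectant 3 2 1) slice_G slice_h) _.
by list_transvectant 3%N 2%N 1%N lG lh;
  cbv [binomial]; congr [:: _; _; _; _]; field_tac.
Qed.

Lemma slice_H : spec slice_pt (cov_H k) = lform lH.
Proof.
rewrite [LHS](spec_transvectant _ 5 5 2).
apply: etrans (congr2 (transvectant 5 5 2) slice_F slice_F) _.
by list_transvectant 5%N 5%N 2%N lF lF;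
  cbv [binomial]; congr [:: _; _; _; _; _; _; _]; field_tac.
Qed.

Lemma slice_i : spec slice_pt (cov_i k) = lform li.
Proof.
rewrite [LHS](spec_transvectant _ 5 5 4).
apply: etrans (congr2 (transvectant 5 5 4) slice_F slice_F) _.
by list_transvectant 5%N 5%N 4%N lF lF;
  cbv [binomial]; congr [:: _; _; _]; field_tac.
Qed.

Lemma slice_t : spec slice_pt (cov_t k) = lform lt.
Proof.
rewrite [LHS](spec_transvectant _ 5 6 1).
apply: etrans (congr2 (transvectant 5 6 1) slice_F slice_H) _.
by list_transvectant 5%N 6%N 1%N lF lH;
  cbv [binomial]; congr [:: _; _; _; _; _; _; _; _; _; _]; field_tac.
Qed.

Lemma slice_c35 : spec slice_pt (cov_c35 k) = lform lc35.
Proof.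
rewrite [LHS](spec_transvectant _ 2 5 1).
apply: etrans (congr2 (transvectant 2 5 1) slice_i slice_F) _.
by list_transvectant 2%N 5%N 1%N li lF;
  cbv [binomial]; congr [:: _; _; _; _; _; _]; field_tac.
Qed.

Lemma slice_c33 : spec slice_pt (cov_c33 k) = lform lc33.
Proof.
rewrite [LHS](spec_transvectant _ 2 5 2).
apply: etrans (congr2 (transvectant 2 5 2) slice_i slice_F) _.
by list_transvectant 2%N 5%N 2%N li lF;
  cbv [binomial]; congr [:: _; _; _; _]; field_tac.
Qed.

Lemma lform_mul_Gh : lform lG * lform lh = lform lGh.
Proof.
by rewrite -(@lform_mul _ lG lh isT isT); apply: (congr1 (@lform _));
  unfold_lists; congr [:: _; _; _; _; _; _]; ring.
Qed.

Lemma lform_mul_hq : lform lh * lform lq = lform lhq.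
Proof.
by rewrite -(@lform_mul _ lh lq isT isT); apply: (congr1 (@lform _));
  unfold_lists; congr [:: _; _; _; _; _; _]; ring.
Qed.

Lemma lform_mul_GG : lform lG * lform lG = lform lGG.
Proof.
by rewrite -(@lform_mul _ lG lG isT isT); apply: (congr1 (@lform _));
  unfold_lists; congr [:: _; _; _; _; _; _; _]; ring.
Qed.

Lemma lform_mul_Gq : lform lG * lform lq = lform lGq.
Proof.
by rewrite -(@lform_mul _ lG lq isT isT); apply: (congr1 (@lform _));
  unfold_lists; congr [:: _; _; _; _; _; _; _]; ring.
Qed.

Lemma lform_mul_qq : lform lq * lform lq = lform lqq.
Proof.
by rewrite -(@lform_mul _ lq lq isT isT); apply: (congr1 (@lform _));
  unfold_lists; congr [:: _; _; _; _; _; _; _]; ring.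
Qed.

Lemma lform_mul_GGG : lform lG * lform lGG = lform lGGG.
Proof.
by rewrite -(@lform_mul _ lG lGG isT isT); apply: (congr1 (@lform _));
  unfold_lists; congr [:: _; _; _; _; _; _; _; _; _; _]; ring.
Qed.

Lemma lform_mul_GGq : lform lGG * lform lq = lform lGGq.
Proof.
by rewrite -(@lform_mul _ lGG lq isT isT); apply: (congr1 (@lform _));
  unfold_lists; congr [:: _; _; _; _; _; _; _; _; _; _]; ring.
Qed.

Lemma lform_mul_G4 : lform lG * lform lGGG = lform lG4.
Proof.
by rewrite -(@lform_mul _ lG lGGG isT isT); apply: (congr1 (@lform _));
  unfold_lists; congr [:: _; _; _; _; _; _; _; _; _; _; _; _; _]; ring.
Qed.

Lemma lform_mul_G5 : lform lG * lform lG4 = lform lG5.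
Proof.
by rewrite -(@lform_mul _ lG lG4 isT isT); apply: (congr1 (@lform _));
  unfold_lists; congr [:: _; _; _; _; _; _; _; _; _; _; _; _; _; _; _; _]; ring.
Qed.

Lemma lform_mul_G4q : lform lG4 * lform lq = lform lG4q.
Proof.
by rewrite -(@lform_mul _ lG4 lq isT isT); apply: (congr1 (@lform _));
  unfold_lists; congr [:: _; _; _; _; _; _; _; _; _; _; _; _; _; _; _; _]; ring.
Qed.

Lemma lform_mul_FF : lform lF * lform lF = lform lFF.
Proof.
by rewrite -(@lform_mul _ lF lF isT isT); apply: (congr1 (@lform _));
  unfold_lists; congr [:: _; _; _; _; _; _; _; _; _; _; _]; ring.
Qed.

Lemma lform_mul_F3 : lform lF * lform lFF = lform lF3.
Proof.
by rewrite -(@lform_mul _ lF lFF isT isT); apply: (congr1 (@lform _));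
  unfold_lists; congr [:: _; _; _; _; _; _; _; _; _; _; _; _; _; _; _; _]; ring.
Qed.

Lemma lform_pow_GG : lform lG ^+ 2 = lform lGG.
Proof. exact: etrans (expr2 _) lform_mul_GG. Qed.

Lemma lform_pow_GGG : lform lG ^+ 3 = lform lGGG.
Proof. exact: etrans (exprS _ 2) (etrans (congr1 ( *%R _) lform_pow_GG) lform_mul_GGG). Qed.

Lemma lform_pow_G4 : lform lG ^+ 4 = lform lG4.
Proof. exact: etrans (exprS _ 3) (etrans (congr1 ( *%R _) lform_pow_GGG) lform_mul_G4). Qed.

Lemma lform_pow_G5 : lform lG ^+ 5 = lform lG5.
Proof. exact: etrans (exprS _ 4) (etrans (congr1 ( *%R _) lform_pow_G4) lform_mul_G5). Qed.

Lemma lform_pow_qq : lform lq ^+ 2 = lform lqq.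
Proof. exact: etrans (expr2 _) lform_mul_qq. Qed.

Lemma lform_pow_FF : lform lF ^+ 2 = lform lFF.
Proof. exact: etrans (expr2 _) lform_mul_FF. Qed.

Lemma lform_pow_F3 : lform lF ^+ 3 = lform lF3.
Proof. exact: etrans (exprS _ 2) (etrans (congr1 ( *%R _) lform_pow_FF) lform_mul_F3). Qed.

Lemma slice_GG : spec slice_pt (genG k ^+ 2) = lform lGG.
Proof.
exact: etrans (specX _ _ 2) (etrans (congr1 (fun x => x ^+ 2) slice_G) lform_pow_GG).
Qed.

Lemma slice_qq : spec slice_pt (cov_q k ^+ 2) = lform lqq.
Proof.
exact: etrans (specX _ _ 2) (etrans (congr1 (fun x => x ^+ 2) slice_q) lform_pow_qq).
Qed.

Lemma slice_GGG : spec slice_pt (genG k ^+ 3) = lform lGGG.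
Proof.
exact: etrans (specX _ _ 3) (etrans (congr1 (fun x => x ^+ 3) slice_G) lform_pow_GGG).
Qed.

Lemma slice_G4 : spec slice_pt (genG k ^+ 4) = lform lG4.
Proof.
exact: etrans (specX _ _ 4) (etrans (congr1 (fun x => x ^+ 4) slice_G) lform_pow_G4).
Qed.

Lemma slice_G5 : spec slice_pt (genG k ^+ 5) = lform lG5.
Proof.
exact: etrans (specX _ _ 5) (etrans (congr1 (fun x => x ^+ 5) slice_G) lform_pow_G5).
Qed.

Lemma slice_F3 : spec slice_pt (genF k ^+ 3) = lform lF3.
Proof.
exact: etrans (specX _ _ 3) (etrans (congr1 (fun x => x ^+ 3) slice_F) lform_pow_F3).
Qed.

Lemma slice_Gh : spec slice_pt (genG k * cov_h k) = lform lGh.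
Proof. exact: etrans (specM _ _ _) (etrans (congr2 *%R slice_G slice_h) lform_mul_Gh). Qed.

Lemma slice_hq : spec slice_pt (cov_h k * cov_q k) = lform lhq.
Proof. exact: etrans (specM _ _ _) (etrans (congr2 *%R slice_h slice_q) lform_mul_hq). Qed.

Lemma slice_Gq : spec slice_pt (genG k * cov_q k) = lform lGq.
Proof. exact: etrans (specM _ _ _) (etrans (congr2 *%R slice_G slice_q) lform_mul_Gq). Qed.

Lemma slice_GGq : spec slice_pt (genG k ^+ 2 * cov_q k) = lform lGGq.
Proof. exact: etrans (specM _ _ _) (etrans (congr2 *%R slice_GG slice_q) lform_mul_GGq). Qed.

Lemma slice_G4q : spec slice_pt (genG k ^+ 4 * cov_q k) = lform lG4q.
Proof. exact: etrans (specM _ _ _) (etrans (congr2 *%R slice_G4 slice_q) lform_mul_G4q). Qed.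

Lemma slice_inv_D : (inv_D k).@[slice_pt] = - 2%:R.
Proof.
rewrite [LHS]const_form_eval (spec_transvectant _ 2 2 2).
apply: etrans (congr1 (mcoeff 0) (congr2 (transvectant 2 2 2) slice_h slice_h)) _.
by list_full_transvectant 2%N lh lh; cbv [binomial]; field_tac.
Qed.

Lemma slice_inv_A : (inv_A k).@[slice_pt] = - 2%:R / 5%:R * f1 + 2%:R / 5%:R * f4.
Proof.
rewrite [LHS]const_form_eval (spec_transvectant _ 5 5 5).
apply: etrans (congr1 (mcoeff 0) (congr2 (transvectant 5 5 5) slice_F slice_Gh)) _.
by list_full_transvectant 5%N lF lGh; cbv [binomial]; field_tac.
Qed.

Lemma slice_inv_L : (inv_L k).@[slice_pt] = 2%:R / 5%:R * f1 + 2%:R / 5%:R * f4.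
Proof.
rewrite [LHS]const_form_eval (spec_transvectant _ 5 5 5).
apply: etrans (congr1 (mcoeff 0) (congr2 (transvectant 5 5 5) slice_F slice_hq)) _.
by list_full_transvectant 5%N lF lhq; cbv [binomial]; field_tac.
Qed.

Lemma slice_inv_B1 : (inv_B1 k).@[slice_pt] =
    - 2%:R * f0 * f5 + 6%:R / 25%:R * f1 * f4 - 1 / 25%:R * f2 * f3.
Proof.
rewrite [LHS]const_form_eval (spec_transvectant _ 2 2 2).
apply: etrans (congr1 (mcoeff 0) (congr2 (transvectant 2 2 2) slice_i slice_h)) _.
by list_full_transvectant 2%N li lh; cbv [binomial]; field_tac.
Qed.

Lemma slice_inv_B2 : (inv_B2 k).@[slice_pt] =
    1 / 5%:R * f0 * f2 - 2%:R / 25%:R * f1 ^+ 2 - 1 / 5%:R * f0 * f5 - 7%:R / 125%:R *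
    f1 * f4 + 2%:R / 125%:R * f2 * f3 + 1 / 5%:R * f3 * f5 - 2%:R / 25%:R * f4 ^+ 2.
Proof.
rewrite [LHS]const_form_eval (spec_transvectant _ 6 6 6).
apply: etrans (congr1 (mcoeff 0) (congr2 (transvectant 6 6 6) slice_H slice_GG)) _.
by list_full_transvectant 6%N lH lGG; cbv [binomial]; field_tac.
Qed.

Lemma slice_inv_M : (inv_M k).@[slice_pt] =
    - 1 / 5%:R * f0 * f2 + 2%:R / 25%:R * f1 ^+ 2 + 1 / 5%:R * f3 * f5 - 2%:R / 25%:R *
    f4 ^+ 2.
Proof.
rewrite [LHS]const_form_eval (spec_transvectant _ 6 6 6).
apply: etrans (congr1 (mcoeff 0) (congr2 (transvectant 6 6 6) slice_H slice_Gq)) _.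
by list_full_transvectant 6%N lH lGq; cbv [binomial]; field_tac.
Qed.

Lemma slice_inv_N : (inv_N k).@[slice_pt] =
    1 / 5%:R * f0 * f2 - 2%:R / 25%:R * f1 ^+ 2 + 1 / 5%:R * f0 * f5 + 7%:R / 125%:R *
    f1 * f4 - 2%:R / 125%:R * f2 * f3 + 1 / 5%:R * f3 * f5 - 2%:R / 25%:R * f4 ^+ 2.
Proof.
rewrite [LHS]const_form_eval (spec_transvectant _ 6 6 6).
apply: etrans (congr1 (mcoeff 0) (congr2 (transvectant 6 6 6) slice_H slice_qq)) _.
by list_full_transvectant 6%N lH lqq; cbv [binomial]; field_tac.
Qed.

Lemma slice_inv_R : (inv_R k).@[slice_pt] =
    - 3%:R / 25%:R * f0 * f2 * f4 - 3%:R / 125%:R * f1 * f2 * f3 + 3%:R / 500%:R * f2 ^+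
    3 + 6%:R / 125%:R * f1 ^+ 2 * f4 + 3%:R / 50%:R * f0 * f3 ^+ 2 + 3%:R / 25%:R * f1 *
    f3 * f5 - 3%:R / 50%:R * f2 ^+ 2 * f5 - 6%:R / 125%:R * f1 * f4 ^+ 2 + 3%:R / 125%:R
    * f2 * f3 * f4 - 3%:R / 500%:R * f3 ^+ 3.
Proof.
rewrite [LHS]const_form_eval (spec_transvectant _ 3 3 3).
apply: etrans (congr1 (mcoeff 0) (congr2 (transvectant 3 3 3) slice_c33 slice_G)) _.
by list_full_transvectant 3%N lc33 lG; cbv [binomial]; field_tac.
Qed.

Lemma slice_inv_S1 : (inv_S1 k).@[slice_pt] =
    3%:R / 25%:R * f0 * f2 * f4 + 3%:R / 125%:R * f1 * f2 * f3 - 3%:R / 500%:R * f2 ^+ 3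
    - 6%:R / 125%:R * f1 ^+ 2 * f4 - 3%:R / 50%:R * f0 * f3 ^+ 2 + 3%:R / 25%:R * f1 *
    f3 * f5 - 3%:R / 50%:R * f2 ^+ 2 * f5 - 6%:R / 125%:R * f1 * f4 ^+ 2 + 3%:R / 125%:R
    * f2 * f3 * f4 - 3%:R / 500%:R * f3 ^+ 3.
Proof.
rewrite [LHS]const_form_eval (spec_transvectant _ 3 3 3).
apply: etrans (congr1 (mcoeff 0) (congr2 (transvectant 3 3 3) slice_c33 slice_q)) _.
by list_full_transvectant 3%N lc33 lq; cbv [binomial]; field_tac.
Qed.

Lemma slice_inv_S2 : (inv_S2 k).@[slice_pt] =
    - 16%:R / 125%:R * f0 * f2 * f4 + 19%:R / 625%:R * f1 * f2 * f3 - 6%:R / 625%:R * f2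
    ^+ 3 + 2%:R / 5%:R * f0 * f1 * f5 - 18%:R / 625%:R * f1 ^+ 2 * f4 + 3%:R / 125%:R *
    f0 * f3 ^+ 2 + 2%:R / 5%:R * f0 * f4 * f5 - 16%:R / 125%:R * f1 * f3 * f5 + 3%:R /
    125%:R * f2 ^+ 2 * f5 - 18%:R / 625%:R * f1 * f4 ^+ 2 + 19%:R / 625%:R * f2 * f3 *
    f4 - 6%:R / 625%:R * f3 ^+ 3.
Proof.
rewrite [LHS]const_form_eval (spec_transvectant _ 5 5 5).
apply: etrans (congr1 (mcoeff 0) (congr2 (transvectant 5 5 5) slice_c35 slice_Gh)) _.
by list_full_transvectant 5%N lc35 lGh; cbv [binomial]; field_tac.
Qed.

Lemma slice_inv_S3 : (inv_S3 k).@[slice_pt] =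
    1 / 10%:R * f0 ^+ 2 * f3 - 3%:R / 50%:R * f0 * f1 * f2 + 2%:R / 125%:R * f1 ^+ 3 - 1
    / 20%:R * f0 * f1 * f5 + 17%:R / 1400%:R * f0 * f3 ^+ 2 - 29%:R / 3500%:R * f1 ^+ 2
    * f4 + 1 / 7000%:R * f1 * f2 * f3 - 1 / 3500%:R * f2 ^+ 3 + 1 / 175%:R * f0 * f2 *
    f4 + 1 / 175%:R * f1 * f3 * f5 - 29%:R / 3500%:R * f1 * f4 ^+ 2 + 17%:R / 1400%:R *
    f2 ^+ 2 * f5 + 1 / 7000%:R * f2 * f3 * f4 - 1 / 3500%:R * f3 ^+ 3 - 1 / 20%:R * f0 *
    f4 * f5 - 3%:R / 50%:R * f3 * f4 * f5 + 2%:R / 125%:R * f4 ^+ 3 + 1 / 10%:R * f2 *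
    f5 ^+ 2.
Proof.
rewrite [LHS]const_form_eval (spec_transvectant _ 9 9 9).
apply: etrans (congr1 (mcoeff 0) (congr2 (transvectant 9 9 9) slice_t slice_GGG)) _.
by list_full_transvectant 9%N lt lGGG; cbv [binomial]; field_tac.
Qed.

Lemma slice_inv_T1 : (inv_T1 k).@[slice_pt] =
    16%:R / 125%:R * f0 * f2 * f4 - 19%:R / 625%:R * f1 * f2 * f3 + 6%:R / 625%:R * f2
    ^+ 3 - 2%:R / 5%:R * f0 * f1 * f5 + 18%:R / 625%:R * f1 ^+ 2 * f4 - 3%:R / 125%:R *
    f0 * f3 ^+ 2 + 2%:R / 5%:R * f0 * f4 * f5 - 16%:R / 125%:R * f1 * f3 * f5 + 3%:R /
    125%:R * f2 ^+ 2 * f5 - 18%:R / 625%:R * f1 * f4 ^+ 2 + 19%:R / 625%:R * f2 * f3 *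
    f4 - 6%:R / 625%:R * f3 ^+ 3.
Proof.
rewrite [LHS]const_form_eval (spec_transvectant _ 5 5 5).
apply: etrans (congr1 (mcoeff 0) (congr2 (transvectant 5 5 5) slice_c35 slice_hq)) _.
by list_full_transvectant 5%N lc35 lhq; cbv [binomial]; field_tac.
Qed.

Lemma slice_inv_T2 : (inv_T2 k).@[slice_pt] =
    - 1 / 10%:R * f0 ^+ 2 * f3 + 3%:R / 50%:R * f0 * f1 * f2 - 2%:R / 125%:R * f1 ^+ 3 +
    1 / 60%:R * f0 * f1 * f5 - 17%:R / 4200%:R * f0 * f3 ^+ 2 + 29%:R / 10500%:R * f1 ^+
    2 * f4 - 1 / 21000%:R * f1 * f2 * f3 + 1 / 10500%:R * f2 ^+ 3 - 1 / 525%:R * f0 * f2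
    * f4 + 1 / 525%:R * f1 * f3 * f5 - 29%:R / 10500%:R * f1 * f4 ^+ 2 + 17%:R / 4200%:R
    * f2 ^+ 2 * f5 + 1 / 21000%:R * f2 * f3 * f4 - 1 / 10500%:R * f3 ^+ 3 - 1 / 60%:R *
    f0 * f4 * f5 - 3%:R / 50%:R * f3 * f4 * f5 + 2%:R / 125%:R * f4 ^+ 3 + 1 / 10%:R *
    f2 * f5 ^+ 2.
Proof.
rewrite [LHS]const_form_eval (spec_transvectant _ 9 9 9).
apply: etrans (congr1 (mcoeff 0) (congr2 (transvectant 9 9 9) slice_t slice_GGq)) _.
by list_full_transvectant 9%N lt lGGq; cbv [binomial]; field_tac.
Qed.

Lemma slice_inv_T3 : (inv_T3 k).@[slice_pt] =
    f0 ^+ 3 - 3%:R / 91%:R * f0 ^+ 2 * f3 - 6%:R / 91%:R * f0 * f1 * f2 - 1 / 91%:R * f1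
    ^+ 3 + 12%:R / 1001%:R * f0 * f1 * f5 + 12%:R / 1001%:R * f0 * f2 * f4 + 6%:R /
    1001%:R * f0 * f3 ^+ 2 + 6%:R / 1001%:R * f1 ^+ 2 * f4 + 12%:R / 1001%:R * f1 * f2 *
    f3 + 2%:R / 1001%:R * f2 ^+ 3 - 12%:R / 1001%:R * f0 * f4 * f5 - 12%:R / 1001%:R *
    f1 * f3 * f5 - 6%:R / 1001%:R * f1 * f4 ^+ 2 - 6%:R / 1001%:R * f2 ^+ 2 * f5 - 12%:R
    / 1001%:R * f2 * f3 * f4 - 2%:R / 1001%:R * f3 ^+ 3 + 3%:R / 91%:R * f2 * f5 ^+ 2 +
    6%:R / 91%:R * f3 * f4 * f5 + 1 / 91%:R * f4 ^+ 3 - f5 ^+ 3.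
Proof.
rewrite [LHS]const_form_eval (spec_transvectant _ 15 15 15).
apply: etrans (congr1 (mcoeff 0) (congr2 (transvectant 15 15 15) slice_F3 slice_G5)) _.
by list_full_transvectant 15%N lF3 lG5; rewrite !binomial15; field_tac.
Qed.

Lemma slice_inv_W : (inv_W k).@[slice_pt] =
    - f0 ^+ 3 + 9%:R / 455%:R * f0 ^+ 2 * f3 + 18%:R / 455%:R * f0 * f1 * f2 + 3%:R /
    455%:R * f1 ^+ 3 - 12%:R / 5005%:R * f0 * f1 * f5 - 12%:R / 5005%:R * f0 * f2 * f4 -
    6%:R / 5005%:R * f0 * f3 ^+ 2 - 6%:R / 5005%:R * f1 ^+ 2 * f4 - 12%:R / 5005%:R * f1
    * f2 * f3 - 2%:R / 5005%:R * f2 ^+ 3 - 12%:R / 5005%:R * f0 * f4 * f5 - 12%:R /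
    5005%:R * f1 * f3 * f5 - 6%:R / 5005%:R * f1 * f4 ^+ 2 - 6%:R / 5005%:R * f2 ^+ 2 *
    f5 - 12%:R / 5005%:R * f2 * f3 * f4 - 2%:R / 5005%:R * f3 ^+ 3 + 9%:R / 455%:R * f2
    * f5 ^+ 2 + 18%:R / 455%:R * f3 * f4 * f5 + 3%:R / 455%:R * f4 ^+ 3 - f5 ^+ 3.
Proof.
rewrite [LHS]const_form_eval (spec_transvectant _ 15 15 15).
apply: etrans (congr1 (mcoeff 0) (congr2 (transvectant 15 15 15) slice_F3 slice_G4q)) _.
by list_full_transvectant 15%N lF3 lG4q; rewrite !binomial15; field_tac.
Qed.

(** Assembles the value of a numerator from those of the joint invariants along its syntax, leaving
    one closed field identity. *)
Local Ltac eval_value :=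
  lazymatch goal with
  | |- meval _ (_ + _) = _ => eapply eval_add; eval_value
  | |- meval _ (- _) = _ => eapply eval_opp; eval_value
  | |- meval _ (_ ^+ _) = _ => eapply eval_exp; eval_value
  | |- meval _ (1 / _%:R) = _ => exact (eval_frac _ 1 _)
  | |- meval _ (_%:R / _%:R) = _ => exact (eval_frac _ _ _)
  | |- meval _ (_ * _) = _ => eapply eval_mul; eval_value
  | |- meval _ (inv_D _) = _ => exact slice_inv_D
  | |- meval _ (inv_A _) = _ => exact slice_inv_A
  | |- meval _ (inv_L _) = _ => exact slice_inv_L
  | |- meval _ (inv_B1 _) = _ => exact slice_inv_B1
  | |- meval _ (inv_B2 _) = _ => exact slice_inv_B2
  | |- meval _ (inv_M _) = _ => exact slice_inv_M
  | |- meval _ (inv_N _) = _ => exact slice_inv_N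
  | |- meval _ (inv_R _) = _ => exact slice_inv_R
  | |- meval _ (inv_S1 _) = _ => exact slice_inv_S1
  | |- meval _ (inv_S2 _) = _ => exact slice_inv_S2
  | |- meval _ (inv_S3 _) = _ => exact slice_inv_S3
  | |- meval _ (inv_T1 _) = _ => exact slice_inv_T1
  | |- meval _ (inv_T2 _) = _ => exact slice_inv_T2
  | |- meval _ (inv_T3 _) = _ => exact slice_inv_T3
  | |- meval _ (inv_W _) = _ => exact slice_inv_W
  | |- meval _ _%:R = _ => exact (eval_nat _ _)
  end.
Local Ltac value_tac P := cbv delta [P]; eapply etrans; [eval_value | field_tac].

(* The denominators 756756 and 252252 are too large for the reduction that the tactic
   field performs on inverses of numerals. *)
Local Tactic Notation "frac_value_tac" reference(P) constr(Z) :=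
  cbv delta [P]; eapply etrans; [eval_value|];
  apply (@frac_mul _ _ _ _ Z);
  [apply: (natr_neq0 char0); exact isT | field_tac | field_tac].

Local Notation al := (f4 - f1).
Local Notation w := (f1 + f4).
Local Notation x1 := (25%:R * f0 + 245%:R * f3).
Local Notation x2 := (149%:R * f0 + 49%:R * f3).
Local Notation y1 := (- (25%:R * f5 + 245%:R * f2)).
Local Notation y2 := (- (149%:R * f5 + 49%:R * f2)).

Lemma value_P1 : (P1 k).@[slice_pt] = 280%:R * al.
Proof. by value_tac P1. Qed.

Lemma value_P2 : (P2 k).@[slice_pt] = - 32%:R * (x1 * y1).
Proof. by value_tac P2. Qed.

Lemma value_P3 : (P3 k).@[slice_pt] = 448448%:R * (x1 ^+ 3 + y1 ^+ 3).
Proof. by value_tac P3. Qed.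

Lemma value_P4 : (P4 k).@[slice_pt] = 16%:R * (x1 * y2 + x2 * y1).
Proof. by value_tac P4. Qed.

Lemma value_P5 : (P5 k).@[slice_pt] = - 448448%:R * (x1 ^+ 2 * x2 + y1 ^+ 2 * y2).
Proof. by value_tac P5. Qed.

Lemma value_P6 : (P6 k).@[slice_pt] = - 896896%:R * (w * (x1 ^+ 3 - y1 ^+ 3)).
Proof. by value_tac P6. Qed.

Lemma value_Q_e2 : (Q_e2 k).@[slice_pt] = 42336%:R * w ^+ 2.
Proof. by value_tac Q_e2. Qed.

Lemma value_Q_p02 : (Q_p02 k).@[slice_pt] = - (16%:R / 3%:R) * (x2 * y2).
Proof. by value_tac Q_p02. Qed.

Lemma value_Q_p12 : (Q_p12 k).@[slice_pt] =
  16%:R / 27%:R * (x1 * x2 ^+ 2 + y1 * y2 ^+ 2).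
Proof. by frac_value_tac Q_p12 ((16%:R / 135%:R) * (x1 * x2 ^+ 2 + y1 * y2 ^+ 2)). Qed.

Lemma value_Q_p03 : (Q_p03 k).@[slice_pt] = - (16%:R / 9%:R) * (x2 ^+ 3 + y2 ^+ 3).
Proof. by frac_value_tac Q_p03 (- (16%:R / 9%:R) * (x2 ^+ 3 + y2 ^+ 3)). Qed.

Lemma value_Q_w2 : (Q_w2 k).@[slice_pt] = 224%:R * (w * (x1 * y2 - x2 * y1)).
Proof. by value_tac Q_w2. Qed.

Lemma value_Q_w21 : (Q_w21 k).@[slice_pt] =
  896%:R / 9%:R * (w * (x1 ^+ 2 * x2 - y1 ^+ 2 * y2)).
Proof. by value_tac Q_w21. Qed.

Lemma value_Q_w12 : (Q_w12 k).@[slice_pt] =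
  - (896%:R / 3%:R) * (w * (x1 * x2 ^+ 2 - y1 * y2 ^+ 2)).
Proof. by value_tac Q_w12. Qed.

Lemma value_Q_w03 : (Q_w03 k).@[slice_pt] = 896%:R * (w * (x2 ^+ 3 - y2 ^+ 3)).
Proof. by value_tac Q_w03. Qed.

End SliceValues.

(** * Invariants of the symmetric group *)

Section S3Invariants.
Variable k : fieldType.
Hypothesis char0 : [pchar k] =i pred0.
Notation ring6 := {mpoly k[6]}.
Implicit Types e f o q : ring6.

Definition tvar n : ring6 := 'X_(inord n).
Local Notation al := (tvar 0).
Local Notation w := (tvar 1).
Local Notation x1 := (tvar 2).
Local Notation x2 := (tvar 3).
Local Notation y1 := (tvar 4).
Local Notation y2 := (tvar 5).

(** In the order of [generators], whose restrictions turn out to be nonzero multiples of these. *)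
Definition s3_generators : 14.-tuple ring6 :=
  [tuple al; x1 * y1; x1 ^+ 3 + y1 ^+ 3; x1 * y2 + x2 * y1;
    x1 ^+ 2 * x2 + y1 ^+ 2 * y2; w * (x1 ^+ 3 - y1 ^+ 3); w ^+ 2; x2 * y2;
    x1 * x2 ^+ 2 + y1 * y2 ^+ 2; x2 ^+ 3 + y2 ^+ 3; w * (x1 * y2 - x2 * y1);
    w * (x1 ^+ 2 * x2 - y1 ^+ 2 * y2); w * (x1 * x2 ^+ 2 - y1 * y2 ^+ 2);
    w * (x2 ^+ 3 - y2 ^+ 3)].

Definition s3_odd_generators : 6.-tuple ring6 :=
  [tuple w; x1 * y2 - x2 * y1; x1 ^+ 3 - y1 ^+ 3; x1 ^+ 2 * x2 - y1 ^+ 2 * y2;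
    x1 * x2 ^+ 2 - y1 * y2 ^+ 2; x2 ^+ 3 - y2 ^+ 3].

Definition s3_even f := subalg (@mpolyC 6 k) (fun g => exists i, g = tnth s3_generators i) f.

(** A module over the algebra of [s3_even], not an algebra: products of two odd elements are
    even. *)
Inductive s3_odd : ring6 -> Prop :=
| odd_gen i : s3_odd (tnth s3_odd_generators i)
| odd_add f g : s3_odd f -> s3_odd g -> s3_odd (f + g)
| odd_mul e f : s3_even e -> s3_odd f -> s3_odd (e * f).

Lemma even_add e f : s3_even e -> s3_even f -> s3_even (e + f).
Proof. exact: subalg_add. Qed.

Lemma even_mul e f : s3_even e -> s3_even f -> s3_even (e * f).
Proof. exact: subalg_mul. Qed.

Lemma even_nat n : s3_even n%:R.
Proof. by rewrite -mpolyC_nat; exact: subalg_const. Qed.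

Lemma even_opp f : s3_even f -> s3_even (- f).
Proof.
move=> ef; rewrite -mulN1r; apply: subalg_mul => //.
by rewrite -(rmorphN1 (@mpolyC 6 k)); exact: subalg_const.
Qed.

Lemma even_exp f n : s3_even f -> s3_even (f ^+ n).
Proof.
move=> ef; elim: n => [|n IH]; first exact: (even_nat 1).
by rewrite exprS; exact: subalg_mul.
Qed.

Lemma even_gen i : s3_even (tnth s3_generators i).
Proof. by apply: subalg_gen; exists i. Qed.

Let gen n (ltn : (n < 14)%N) := even_gen (Ordinal ltn).
Let e_al : s3_even al := @gen 0 isT.
Let e_p20 : s3_even (x1 * y1) := @gen 1 isT.
Let e_c30 : s3_even (x1 ^+ 3 + y1 ^+ 3) := @gen 2 isT.
Let e_p11 : s3_even (x1 * y2 + x2 * y1) := @gen 3 isT.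
Let e_c21 : s3_even (x1 ^+ 2 * x2 + y1 ^+ 2 * y2) := @gen 4 isT.
Let e_w30 : s3_even (w * (x1 ^+ 3 - y1 ^+ 3)) := @gen 5 isT.
Let e_w2 : s3_even (w ^+ 2) := @gen 6 isT.
Let e_p02 : s3_even (x2 * y2) := @gen 7 isT.
Let e_c12 : s3_even (x1 * x2 ^+ 2 + y1 * y2 ^+ 2) := @gen 8 isT.
Let e_c03 : s3_even (x2 ^+ 3 + y2 ^+ 3) := @gen 9 isT.
Let e_w11 : s3_even (w * (x1 * y2 - x2 * y1)) := @gen 10 isT.
Let e_w21 : s3_even (w * (x1 ^+ 2 * x2 - y1 ^+ 2 * y2)) := @gen 11 isT.
Let e_w12 : s3_even (w * (x1 * x2 ^+ 2 - y1 * y2 ^+ 2)) := @gen 12 isT.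
Let e_w03 : s3_even (w * (x2 ^+ 3 - y2 ^+ 3)) := @gen 13 isT.

Local Ltac even := lazymatch goal with
  | |- s3_even (x1 * y1) => exact e_p20
  | |- s3_even (x1 ^+ 3 + y1 ^+ 3) => exact e_c30
  | |- s3_even (x1 * y2 + x2 * y1) => exact e_p11
  | |- s3_even (x1 ^+ 2 * x2 + y1 ^+ 2 * y2) => exact e_c21
  | |- s3_even (x2 * y2) => exact e_p02
  | |- s3_even (x1 * x2 ^+ 2 + y1 * y2 ^+ 2) => exact e_c12
  | |- s3_even (x2 ^+ 3 + y2 ^+ 3) => exact e_c03
  | |- s3_even (_ + _) => apply even_add; even
  | |- s3_even (_ * _) => apply even_mul; even
  | |- s3_even (- _) => apply even_opp; even
  | |- s3_even (_ ^+ _) => apply even_exp; even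
  | |- s3_even _%:R => exact (even_nat _)
  end.
Local Notation p20 := (x1 * y1).
Local Notation p11 := (x1 * y2 + x2 * y1).
Local Notation p02 := (x2 * y2).
Local Notation c30 := (x1 ^+ 3 + y1 ^+ 3).
Local Notation c21 := (x1 ^+ 2 * x2 + y1 ^+ 2 * y2).
Local Notation c12 := (x1 * x2 ^+ 2 + y1 * y2 ^+ 2).
Local Notation c03 := (x2 ^+ 3 + y2 ^+ 3).
Local Tactic Notation "even_as" constr(e) :=
  match goal with |- s3_even ?f => have -> : f = e by ring end; even.

Local Notation a11 := (x1 * y2 - x2 * y1).
Local Notation a30 := (x1 ^+ 3 - y1 ^+ 3).
Local Notation a21 := (x1 ^+ 2 * x2 - y1 ^+ 2 * y2).
Local Notation a12 := (x1 * x2 ^+ 2 - y1 * y2 ^+ 2).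
Local Notation a03 := (x2 ^+ 3 - y2 ^+ 3).

(** Origin of these identities: write f', g' for the images of f, g under the exchange of x_i and
    y_i. Then (f - f')(g - g') equals both (f + f')(g + g') - 2 (f g' + f' g) and 2 (f g + f' g') -
    (f + f')(g + g'). In each case one of the mixed sums is a polynomial in p20, p11, p02 and the
    symmetrised cubics. *)
Let e_11_30 : s3_even (a11 * a30).
Proof. even_as (p11 * c30 - 2%:R * p20 * c21). Qed.
Let e_11_11 : s3_even (a11 * a11).
Proof. even_as (p11 ^+ 2 - 4%:R * p20 * p02). Qed.
Let e_11_21 : s3_even (a11 * a21).
Proof. even_as (p11 * c21 - 2%:R * p20 * c12). Qed.
Let e_11_12 : s3_even (a11 * a12).
Proof. even_as (p11 * c12 - 2%:R * p20 * c03). Qed.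
Let e_11_03 : s3_even (a11 * a03).
Proof. even_as (2%:R * p02 * c12 - p11 * c03). Qed.
Let e_30_30 : s3_even (a30 * a30).
Proof. even_as (c30 ^+ 2 - 4%:R * p20 ^+ 3). Qed.
Let e_30_21 : s3_even (a30 * a21).
Proof. even_as (c30 * c21 - 2%:R * p20 ^+ 2 * p11). Qed.
Let e_30_12 : s3_even (a30 * a12).
Proof. even_as (c30 * c12 - 2%:R * p20 * (p11 ^+ 2 - 2%:R * p20 * p02)). Qed.
Let e_30_03 : s3_even (a30 * a03).
Proof. even_as (c30 * c03 - 2%:R * (p11 ^+ 3 - 3%:R * p20 * p02 * p11)). Qed.
Let e_21_21 : s3_even (a21 * a21).
Proof. even_as (c21 ^+ 2 - 4%:R * p20 ^+ 2 * p02). Qed.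
Let e_21_12 : s3_even (a21 * a12).
Proof. even_as (c21 * c12 - 2%:R * p20 * p02 * p11). Qed.
Let e_21_03 : s3_even (a21 * a03).
Proof. even_as (c21 * c03 - 2%:R * p02 * (p11 ^+ 2 - 2%:R * p20 * p02)). Qed.
Let e_12_12 : s3_even (a12 * a12).
Proof. even_as (c12 ^+ 2 - 4%:R * p20 * p02 ^+ 2). Qed.
Let e_12_03 : s3_even (a12 * a03).
Proof. even_as (c12 * c03 - 2%:R * p02 ^+ 2 * p11). Qed.
Let e_03_03 : s3_even (a03 * a03).
Proof. even_as (c03 ^+ 2 - 4%:R * p02 ^+ 3). Qed.
Let e_w_w : s3_even (w * w).
Proof. rewrite -expr2; exact: e_w2. Qed.

Lemma even_odd_gens i j : s3_even (tnth s3_odd_generators i * tnth s3_odd_generators j).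
Proof.
pose o n := nth 0 s3_odd_generators n.
suff H m n : (m <= n)%N -> (n < 6)%N -> s3_even (o m * o n).
  rewrite !(tnth_nth 0) -/(o i) -/(o j); have [ij|ji] := leqP i j; first by apply: H.
  by rewrite mulrC; apply: H => //; exact: ltnW.
move=> mn n6; case: m mn => [|[|[|[|[|[|m]]]]]] mn; case: n mn n6 => [|[|[|[|[|[|n]]]]]] mn n6;
  try (exfalso; move: mn n6; clear; by []).
- exact: e_w_w.
- exact: e_w11.
- exact: e_w30.
- exact: e_w21.
- exact: e_w12.
- exact: e_w03.
- exact: e_11_11.
- exact: e_11_30.
- exact: e_11_21.
- exact: e_11_12.
- exact: e_11_03.
- exact: e_30_30.
- exact: e_30_21.
- exact: e_30_12.
- exact: e_30_03.
- exact: e_21_21.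
- exact: e_21_12.
- exact: e_21_03.
- exact: e_12_12.
- exact: e_12_03.
- exact: e_03_03.
Qed.

Lemma even_odd_mul f g : s3_odd f -> s3_odd g -> s3_even (f * g).
Proof.
move=> of_ og; elim: of_ => [i|f1 f2 _ H1 _ H2|e f1 He _ H1]; last first.
- by rewrite -mulrA; exact: even_mul.
- by rewrite mulrDl; exact: even_add.
elim: og => [j|g1 g2 _ H1 _ H2|e g1 He _ H1]; first exact: even_odd_gens.
- by rewrite mulrDr; exact: subalg_add.
by rewrite mulrCA; exact: subalg_mul.
Qed.

Lemma odd0 : s3_odd 0.
Proof. by rewrite -(mul0r w); apply: odd_mul; [exact: (even_nat 0)|exact: (odd_gen ord0)]. Qed.

Definition s3_split f := exists e o, [/\ s3_even e, s3_odd o & f = e + o].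

Lemma split_even e : s3_even e -> s3_split e.
Proof. by move=> He; exists e, 0; split; [|exact: odd0|rewrite addr0]. Qed.

Lemma split_odd o : s3_odd o -> s3_split o.
Proof. by move=> Ho; exists 0, o; split; [exact: (even_nat 0)| |rewrite add0r]. Qed.

Lemma split_add f g : s3_split f -> s3_split g -> s3_split (f + g).
Proof.
move=> [e [o [He Ho ->]]] [e' [o' [He' Ho' ->]]]; exists (e + e'), (o + o').
by split; [exact: subalg_add|exact: odd_add|rewrite addrACA].
Qed.

Lemma split_mul f g : s3_split f -> s3_split g -> s3_split (f * g).
Proof.
move=> [e [o [He Ho ->]]] [e' [o' [He' Ho' ->]]]; exists (e * e' + o * o'), (e * o' + e' * o).
split; last by ring.
  by apply: subalg_add; [exact: subalg_mul|exact: even_odd_mul].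
by apply: odd_add; exact: odd_mul.
Qed.

Lemma split_exp f n : s3_split f -> s3_split (f ^+ n).
Proof.
move=> sf; elim: n => [|n IH]; first exact/split_even/(even_nat 1).
by rewrite exprS; exact: split_mul.
Qed.

Lemma split_scale c f : s3_split f -> s3_split (c *: f).
Proof.
by move=> sf; rewrite -mul_mpolyC; apply: split_mul => //; exact/split_even/subalg_const.
Qed.

Lemma split_half f g : s3_even (f + g) -> s3_odd (f - g) -> s3_split f.
Proof.
move=> He Ho; have -> : f = 2%:R^-1 *: (f + g) + 2%:R^-1 *: (f - g).
  rewrite -scalerDr addrACA subrr addr0 -mulr2n -scaler_nat scalerA mulVf ?scale1r //.
  by move/pcharf0P: char0 => ->.
by apply: split_add; apply: split_scale; [exact: split_even|exact: split_odd].
Qed.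

Let og n (ltn : (n < 6)%N) := odd_gen (Ordinal ltn).

Lemma odd_opp o : s3_odd o -> s3_odd (- o).
Proof. by move=> Ho; rewrite -mulN1r; apply: odd_mul => //; exact/even_opp/(even_nat 1). Qed.

Let split_half' f g : s3_even (g + f) -> s3_odd (g - f) -> s3_split f.
Proof.
move=> He Ho; apply: (@split_half f g); first by rewrite addrC.
by rewrite -opprB; exact: odd_opp.
Qed.

Lemma split_xy :
  [/\ s3_split (x1 * y1), s3_split (x1 * y2), s3_split (x2 * y1) & s3_split (x2 * y2)].
Proof.
split; first exact: split_even.
- exact: (split_half e_p11 (@og 1 isT)).
- exact: (split_half' e_p11 (@og 1 isT)).
exact: split_even.
Qed.

Lemma split_xxx :
  [/\ s3_split (x1 ^+ 3), s3_split (x1 ^+ 2 * x2), s3_split (x1 * x2 ^+ 2) & s3_split (x2 ^+ 3)].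
Proof.
by split; [exact: (split_half e_c30 (@og 2 isT))|exact: (split_half e_c21 (@og 3 isT))
  |exact: (split_half e_c12 (@og 4 isT))|exact: (split_half e_c03 (@og 5 isT))].
Qed.

Lemma split_yyy :
  [/\ s3_split (y1 ^+ 3), s3_split (y1 ^+ 2 * y2), s3_split (y1 * y2 ^+ 2) & s3_split (y2 ^+ 3)].
Proof.
by split; [exact: (split_half' e_c30 (@og 2 isT))|exact: (split_half' e_c21 (@og 3 isT))
  |exact: (split_half' e_c12 (@og 4 isT))|exact: (split_half' e_c03 (@og 5 isT))].
Qed.

(** A monomial in two variables of degree divisible by 3 is a product of cubic monomials; the case
    analysis extracts one of them. *)
Lemma split_binary (u v : ring6) a b :
  [/\ s3_split (u ^+ 3), s3_split (u ^+ 2 * v), s3_split (u * v ^+ 2) & s3_split (v ^+ 3)] ->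
  (3 %| a + b)%N -> s3_split (u ^+ a * v ^+ b).
Proof.
move=> [s30 s21 s12 s03]; have [N] := ubnP (a + b)%N; elim: N a b => // N IH a b /ltnSE le_N d3.
case: a le_N d3 => [|[|[|a]]] le_N d3.
- case: b le_N d3 => [|[|[|b]]] le_N d3; [|lia|lia|].
    by rewrite !expr0 mulr1; exact/split_even/(even_nat 1).
  have -> : u ^+ 0 * v ^+ b.+3 = v ^+ 3 * (u ^+ 0 * v ^+ b) by rewrite !exprS; ring.
  by apply: split_mul => //; apply: IH; lia.
- case: b le_N d3 => [|[|b]] le_N d3; [lia|lia|].
  have -> : u ^+ 1 * v ^+ b.+2 = u * v ^+ 2 * (u ^+ 0 * v ^+ b) by rewrite !exprS; ring.
  by apply: split_mul => //; apply: IH; lia.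
- case: b le_N d3 => [|b] le_N d3; first lia.
  have -> : u ^+ 2 * v ^+ b.+1 = u ^+ 2 * v * (u ^+ 0 * v ^+ b) by rewrite !exprS; ring.
  by apply: split_mul => //; apply: IH; lia.
have -> : u ^+ a.+3 * v ^+ b = u ^+ 3 * (u ^+ a * v ^+ b) by rewrite !exprS; ring.
by apply: split_mul => //; apply: IH; lia.
Qed.

(** The congruence says that the rotation fixes the monomial. While both an x and a y occur, a
    factor x_i y_j of weight 3 can be removed; what remains involves the x alone or the y alone and
    has degree divisible by 3. *)
Lemma split_monomial a b c d : (a + b + 2 * (c + d) = 0 %[mod 3])%N ->
  s3_split (x1 ^+ a * x2 ^+ b * (y1 ^+ c * y2 ^+ d)).
Proof.
have [s11 s12 s21 s22] := split_xy.
have [N] := ubnP (a + b)%N; elim: N a b c d => // N IH a b c d /ltnSE le_N d3.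
have step u v f : s3_split (u * v) -> s3_split f -> s3_split (u * v * f) by exact: split_mul.
case: a le_N d3 => [|a] le_N d3.
  case: b le_N d3 => [|b] le_N d3.
    rewrite !expr0 !mul1r; apply: (split_binary split_yyy); lia.
  case: c d3 => [|c] d3; last first.
    have -> : x1 ^+ 0 * x2 ^+ b.+1 * (y1 ^+ c.+1 * y2 ^+ d) =
      x2 * y1 * (x1 ^+ 0 * x2 ^+ b * (y1 ^+ c * y2 ^+ d)) by rewrite !exprS; ring.
    apply: step => //; apply: IH; lia.
  case: d d3 => [|d] d3; last first.
    have -> : x1 ^+ 0 * x2 ^+ b.+1 * (y1 ^+ 0 * y2 ^+ d.+1) =
      x2 * y2 * (x1 ^+ 0 * x2 ^+ b * (y1 ^+ 0 * y2 ^+ d)) by rewrite !exprS; ring.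
    apply: step => //; apply: IH; lia.
  rewrite !expr0 !mulr1; rewrite -(expr0 x1); apply: (split_binary split_xxx); lia.
case: c d3 => [|c] d3; last first.
  have -> : x1 ^+ a.+1 * x2 ^+ b * (y1 ^+ c.+1 * y2 ^+ d) =
    x1 * y1 * (x1 ^+ a * x2 ^+ b * (y1 ^+ c * y2 ^+ d)) by rewrite !exprS; ring.
  apply: step => //; apply: IH; lia.
case: d d3 => [|d] d3; last first.
  have -> : x1 ^+ a.+1 * x2 ^+ b * (y1 ^+ 0 * y2 ^+ d.+1) =
    x1 * y2 * (x1 ^+ a * x2 ^+ b * (y1 ^+ 0 * y2 ^+ d)) by rewrite !exprS; ring.
  apply: step => //; apply: IH; lia.
rewrite !expr0 !mulr1; apply: (split_binary split_xxx); lia.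
Qed.

Definition swap_vars q : ring6 := q \mPo [tuple al; - w; y1; y2; x1; x2].

Lemma swapD p q : swap_vars (p + q) = swap_vars p + swap_vars q.
Proof. exact: raddfD. Qed.
Lemma swapN p : swap_vars (- p) = - swap_vars p.
Proof. exact: raddfN. Qed.
Lemma swapM p q : swap_vars (p * q) = swap_vars p * swap_vars q.
Proof. exact: rmorphM. Qed.
Lemma swapX p n : swap_vars (p ^+ n) = swap_vars p ^+ n.
Proof. exact: rmorphXn. Qed.
Lemma swapC c : swap_vars c%:MP = c%:MP.
Proof. exact: comp_mpolyC. Qed.
Lemma swap_tvar n : (n < 6)%N ->
  swap_vars (tvar n) = nth 0 [:: al; - w; y1; y2; x1; x2] n.
Proof. by move=> n6; rewrite /swap_vars /tvar comp_mpolyXU inordK. Qed.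

Let s_al : swap_vars al = al := @swap_tvar 0 isT.
Let s_w : swap_vars w = - w := @swap_tvar 1 isT.
Let s_x1 : swap_vars x1 = y1 := @swap_tvar 2 isT.
Let s_x2 : swap_vars x2 = y2 := @swap_tvar 3 isT.
Let s_y1 : swap_vars y1 = x1 := @swap_tvar 4 isT.
Let s_y2 : swap_vars y2 = x2 := @swap_tvar 5 isT.
Let swap_rules := (swapD, swapN, swapM, swapX, s_al, s_w, s_x1, s_x2, s_y1, s_y2).

Lemma swap_even e : s3_even e -> swap_vars e = e.
Proof.
elim=> [c|f [i ->]|f g _ Hf _ Hg|f g _ Hf _ Hg].
- exact: swapC.
- rewrite (tnth_nth 0); case: i => [[|[|[|[|[|[|[|[|[|[|[|[|[|[|i]]]]]]]]]]]]]] Hi];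
    [..|by []]; rewrite [nth _ _ _]/= ?swap_rules; ring.
- by rewrite swapD Hf Hg.
by rewrite swapM Hf Hg.
Qed.

Lemma swap_odd o : s3_odd o -> swap_vars o = - o.
Proof.
elim=> [i|f g _ Hf _ Hg|e f He _ Hf].
- rewrite (tnth_nth 0); case: i => [[|[|[|[|[|[|i]]]]]] Hi];
    [..|by []]; rewrite [nth _ _ _]/= ?swap_rules; ring.
- by rewrite swapD Hf Hg opprD.
by rewrite swapM Hf swap_even // mulrN.
Qed.

(** The rotation multiplies x_i by om and y_i by om^2, hence a monomial by om to this power. *)
Definition weight (m : 'X_{1..6}) : nat :=
  m (inord 2) + m (inord 3) + 2 * (m (inord 4) + m (inord 5)).

Lemma mono6E (m : 'X_{1..6}) : 'X_[m] =
  al ^+ m (inord 0) * w ^+ m (inord 1) * (x1 ^+ m (inord 2) * x2 ^+ m (inord 3) *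
   (y1 ^+ m (inord 4) * y2 ^+ m (inord 5))).
Proof.
rewrite mpolyXE_id.
under eq_bigr => i _ do rewrite -[i in 'X_i]inord_val -[i in m i]inord_val -/(tvar i).
rewrite -(big_mkord xpredT (fun i => tvar i ^+ m (inord i))) /index_iota.
by rewrite [iota _ _]/= !big_cons big_nil mulr1 -!mulrA.
Qed.

Lemma s3_even_of_swap q : (forall m, q@_m != 0 -> (3 %| weight m)%N) ->
  swap_vars q = q -> s3_even q.
Proof.
move=> wt_q sq; have [e [o [He Ho qE]]] : s3_split q.
  rewrite [q]mpolyE big_seq; apply: big_ind.
  - exact/split_even/(even_nat 0).
  - by move=> *; exact: split_add.
  move=> m mq; apply: split_scale; rewrite mono6E.
  apply: split_mul; last first.
    by apply: split_monomial; rewrite mod0n; apply/eqP/wt_q; rewrite -mcoeff_msupp.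
  apply: split_mul; apply: split_exp; first exact: split_even.
  exact: (split_odd (@og 0 isT)).
(* Invariance under the swap makes the odd part equal to its opposite, and 2 is nonzero in k. *)
have : o = - o.
  by move: sq; rewrite qE swapD swap_even // swap_odd // => /addrI.
move/eqP; rewrite -subr_eq0 opprK -mulr2n -scaler_nat scaler_eq0 => /orP[|/eqP o0].
  by move/pcharf0P: char0 => ->.
by rewrite qE o0 addr0.
Qed.

(** Signed monomials of the generators: [true] stands for the sign -1, and exponents are in the
    order al, w, x1, x2, y1, y2. Questions about coefficients become computations on this table. The
    head of each entry is the monomial that serves for minimality. *)
Definition s3_monomials : seq (seq (bool * seq nat)) := [::
  [:: (false, [:: 1; 0; 0; 0; 0; 0])];
  [:: (false, [:: 0; 0; 1; 0; 1; 0])];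
  [:: (false, [:: 0; 0; 3; 0; 0; 0]); (false, [:: 0; 0; 0; 0; 3; 0])];
  [:: (false, [:: 0; 0; 1; 0; 0; 1]); (false, [:: 0; 0; 0; 1; 1; 0])];
  [:: (false, [:: 0; 0; 2; 1; 0; 0]); (false, [:: 0; 0; 0; 0; 2; 1])];
  [:: (false, [:: 0; 1; 3; 0; 0; 0]); (true, [:: 0; 1; 0; 0; 3; 0])];
  [:: (false, [:: 0; 2; 0; 0; 0; 0])];
  [:: (false, [:: 0; 0; 0; 1; 0; 1])];
  [:: (false, [:: 0; 0; 1; 2; 0; 0]); (false, [:: 0; 0; 0; 0; 1; 2])];
  [:: (false, [:: 0; 0; 0; 3; 0; 0]); (false, [:: 0; 0; 0; 0; 0; 3])];
  [:: (false, [:: 0; 1; 1; 0; 0; 1]); (true, [:: 0; 1; 0; 1; 1; 0])];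
  [:: (false, [:: 0; 1; 2; 1; 0; 0]); (true, [:: 0; 1; 0; 0; 2; 1])];
  [:: (false, [:: 0; 1; 1; 2; 0; 0]); (true, [:: 0; 1; 0; 0; 1; 2])];
  [:: (false, [:: 0; 1; 0; 3; 0; 0]); (true, [:: 0; 1; 0; 0; 0; 3])]]%N.

Definition mon6 (s : seq nat) : 'X_{1..6} := [multinom nth 0%N s j | j < 6].

Lemma mon6E s n : (n < 6)%N -> mon6 s (inord n) = nth 0%N s n.
Proof. by move=> n6; rewrite mnmE inordK. Qed.

Lemma mono_mon6 s : 'X_[mon6 s] = al ^+ nth 0%N s 0 * w ^+ nth 0%N s 1 *
  (x1 ^+ nth 0%N s 2 * x2 ^+ nth 0%N s 3 * (y1 ^+ nth 0%N s 4 * y2 ^+ nth 0%N s 5)).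
Proof. by rewrite mono6E !mon6E. Qed.

Lemma s3_generatorsE i : tnth s3_generators i =
  \sum_(c <- nth [::] s3_monomials i) (-1) ^+ c.1 *: 'X_[mon6 c.2].
Proof.
rewrite (tnth_nth 0); case: i => [[|[|[|[|[|[|[|[|[|[|[|[|[|[|i]]]]]]]]]]]]]] Hi];
  [..|by []]; cbv [nat_of_ord s3_monomials s3_generators tval tuple nth];
  rewrite !big_cons big_nil ?mono_mon6; cbv [nth fst snd nat_of_bool];
  rewrite ?expr0 ?expr1 ?scale1r ?scaleN1r; ring.
Qed.

Lemma mon6_inj s t : size s = 6 -> size t = 6 -> mon6 s = mon6 t -> s = t.
Proof.
move=> ss st /mnmP E; apply: (@eq_from_nth _ 0%N) => [|j]; first by rewrite ss st.
by rewrite ss => j6; have := E (inord j); rewrite !mon6E.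
Qed.

Lemma s3_monomials_size : all (all (fun c => size c.2 == 6)) s3_monomials.
Proof. by []. Qed.

Lemma size_s3_monomial i c : (c \in nth [::] s3_monomials i) -> size c.2 = 6%N.
Proof.
have [i14|i14] := ltnP i 14; last by rewrite nth_default.
by have /all_nthP-/(_ [::] i i14)/allP H := s3_monomials_size => /H/eqP.
Qed.

Lemma mcoeff_s3_generators (i : 'I_14) s : size s = 6%N ->
  (tnth s3_generators i)@_(mon6 s) =
  \sum_(c <- nth [::] s3_monomials i | c.2 == s) (-1) ^+ c.1.
Proof.
move=> ss; rewrite s3_generatorsE raddf_sum /= [RHS]big_mkcond !big_seq.
apply: eq_bigr => c /size_s3_monomial sc; rewrite mcoeffZ mcoeffX.
case: eqP => [/(mon6_inj sc ss) ->|ne]; first by rewrite eqxx mulr1.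
by case: eqP => [E|]; [case: ne; rewrite E|rewrite mulr0].
Qed.

Definition lead_monomial i : seq nat := (head (false, [::]) (nth [::] s3_monomials i)).2.

Lemma mcoeff_lead (i j : 'I_14) :
  (tnth s3_generators j)@_(mon6 (lead_monomial i)) = (i == j)%:R.
Proof.
(* The whole 14 by 14 table is checked by computation. *)
have H : all (fun a => all (fun b =>
    [seq c.1 | c <- nth [::] s3_monomials b & c.2 == lead_monomial a]
    == (if a == b then [:: false] else [::])) (iota 0 14)) (iota 0 14) by [].
have mem (l : 'I_14) : nat_of_ord l \in iota 0 14 by rewrite mem_iota add0n ltn_ord.
have sl : size (lead_monomial i) = 6%N.
  rewrite /lead_monomial; apply: (@size_s3_monomial i); rewrite -nth0 mem_nth //.
  have S : all (fun l => 0 < size l)%N s3_monomials by [].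
  exact: (all_nthP [::] S).
have /allP/(_ _ (mem j))/eqP E := allP H _ (mem i).
rewrite mcoeff_s3_generators // -big_filter.
have -> : \sum_(c <- [seq c <- nth [::] s3_monomials j | c.2 == lead_monomial i]) (-1) ^+ c.1 =
  \sum_(b <- [seq c.1 | c <- nth [::] s3_monomials j & c.2 == lead_monomial i]) (-1) ^+ b :> k.
  by rewrite big_map.
by rewrite E -val_eqE; case: eqP => _; rewrite ?big_seq1 ?big_nil.
Qed.

(** Only the factorisations of [m] with a trivial factor contribute, so the coefficient of [m]
    behaves as a derivation at the origin: it kills a product as soon as it kills both factors. *)
Lemma mcoeffM_indecomposable f g m : m != 0%MM ->
  (forall a b, m = (a + b)%MM -> a != 0%MM -> b != 0%MM -> f@_a * g@_b = 0) ->
  (f * g)@_m = f@_0 * g@_m + f@_m * g@_0.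
Proof.
move=> nz_m H; pose f' := f - (f@_0)%:MP; pose g' := g - (g@_0)%:MP.
have fE : f = (f@_0)%:MP + f' by rewrite addrC subrK.
have gE : g = (g@_0)%:MP + g' by rewrite addrC subrK.
have f'E a : a != 0%MM -> f'@_a = f@_a.
  by move=> /negbTE a0; rewrite mcoeffB mcoeffC a0 mulr0 subr0.
have g'E a : a != 0%MM -> g'@_a = g@_a.
  by move=> /negbTE a0; rewrite mcoeffB mcoeffC a0 mulr0 subr0.
have f'0 : f'@_0 = 0 by rewrite mcoeffB mcoeffC eqxx mulr1 subrr.
have g'0 : g'@_0 = 0 by rewrite mcoeffB mcoeffC eqxx mulr1 subrr.
have fg'0 : (f' * g')@_m = 0.
  rewrite mcoeffM big1 // => c /eqP mE.
  have [->|a0] := eqVneq (c.1 : 'X_{1..6}) 0%MM; first by rewrite f'0 mul0r.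
  have [->|b0] := eqVneq (c.2 : 'X_{1..6}) 0%MM; first by rewrite g'0 mulr0.
  by rewrite f'E // g'E // H.
clearbody f' g'; rewrite {1}fE {1}gE mulrDl !mulrDr !mcoeffD fg'0 addr0 -rmorphM mcoeffC.
rewrite (negbTE nz_m) mulr0 add0r mul_mpolyC [f' * _]mulrC mul_mpolyC !mcoeffZ.
by rewrite f'E // g'E //; ring.
Qed.

Lemma weightD a b : weight (a + b) = (weight a + weight b)%N.
Proof. by rewrite /weight !mnmDE; lia. Qed.

Lemma s3_even_weight f : s3_even f -> forall m, f@_m != 0 -> (3 %| weight m)%N.
Proof.
elim=> [c|_ [i ->]|g h _ Hg _ Hh|g h _ Hg _ Hh] m.
- have [->|nz] := eqVneq m 0%MM; first by rewrite /weight !mnm0E.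
  by rewrite mcoeffC (negbTE nz) mulr0 eqxx.
- rewrite s3_generatorsE raddf_sum /= => nz.
  have /hasP[c cm /eqP cE] : has (fun c => mon6 c.2 == m) (nth [::] s3_monomials i).
    apply: contra_neqT nz => /hasPn no; rewrite big_seq big1 // => c /no /negbTE ne.
    by rewrite mcoeffZ mcoeffX ne mulr0.
  have W : all (all (fun c =>
    3 %| nth 0 c.2 2 + nth 0 c.2 3 + 2 * (nth 0 c.2 4 + nth 0 c.2 5))%N) s3_monomials by [].
  rewrite -cE /weight !mon6E //.
  by have /all_nthP-/(_ [::] i (ltn_ord i))/allP/(_ c cm) := W.
- rewrite mcoeffD => nz; have [g0|/Hg//] := eqVneq g@_m 0.
  by apply: Hh; apply: contraNneq nz => h0; rewrite g0 h0 addr0.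
apply: contraNT => ndvd; rewrite mcoeffM big1 // => c /eqP mE.
have [->|/Hg da] := eqVneq g@_c.1 0; first by rewrite mul0r.
have [->|/Hh db] := eqVneq h@_c.2 0; first by rewrite mulr0.
by case/negP: ndvd; rewrite mE weightD dvdn_add.
Qed.

(** The variable w is fixed by the rotation but odd under the swap. It needs separate treatment
    because weights alone allow w to be split off from w^2 or from w x1^3. *)
Lemma mcoeff_w_even f : s3_even f -> f@_U_(inord 1) = 0.
Proof.
have U_split (a b : 'X_{1..6}) i : U_(i)%MM = (a + b)%MM -> a != 0%MM -> b != 0%MM -> False.
  move=> /(congr1 mdeg); rewrite mdegD mdeg1 -!mdeg_eq0; lia.
have UE : U_(inord 1)%MM = mon6 [:: 0; 1; 0; 0; 0; 0]%N.
  apply/mnmP => j; rewrite mnm1E mnmE -val_eqE /= inordK //.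
  by case: j => [[|[|[|[|[|[|j]]]]]] Hj].
elim=> [c|_ [i ->]|g h _ Hg _ Hh|g h _ Hg _ Hh].
- by rewrite mcoeffC -mdeg_eq0 mdeg1 mulr0.
- rewrite UE mcoeff_s3_generators // -big_filter.
  have H : all (fun l => [seq c <- l | c.2 == [:: 0; 1; 0; 0; 0; 0]%N] == [::])
    s3_monomials by [].
  have /all_nthP-/(_ [::] i (ltn_ord i))/eqP -> := H.
  by rewrite big_nil.
- by rewrite mcoeffD Hg Hh addr0.
rewrite mcoeffM_indecomposable ?Hg ?Hh ?mulr0 ?mul0r ?addr0 //.
  by rewrite -mdeg_eq0 mdeg1.
by move=> a b /U_split U a0 b0; case: (U a0 b0).
Qed.

Lemma mnm6P (a b : 'X_{1..6}) : (forall n, (n < 6)%N -> a (inord n) = b (inord n)) -> a = b.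
Proof. by move=> E; apply/mnmP => i; rewrite -[i]inord_val; exact: E. Qed.

Lemma mnm6_eq0 (a : 'X_{1..6}) : (a == 0%MM) =
  (a (inord 0) + a (inord 1) + a (inord 2) + a (inord 3) + a (inord 4) + a (inord 5) == 0)%N.
Proof.
apply/eqP/eqP => [->|E]; first by rewrite !mnm0E.
by apply: mnm6P => -[|[|[|[|[|[|n]]]]]] // _; rewrite mnm0E; lia.
Qed.

(** No proper nontrivial part of x1 y1, x1^3 and the like has weight divisible by 3, so w is the
    only factor that can be split off. *)
Lemma lead_monomial_indecomposable (i : 'I_14) (a b : 'X_{1..6}) :
  mon6 (lead_monomial i) = (a + b)%MM -> a != 0%MM -> b != 0%MM ->
  (3 %| weight a)%N -> (3 %| weight b)%N -> a = U_(inord 1)%MM \/ b = U_(inord 1)%MM.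
Proof.
move=> /mnmP E; rewrite !mnm6_eq0 /weight.
pose is_w (c : 'X_{1..6}) := [&& c (inord 0) == 0, c (inord 1) == 1, c (inord 2) == 0,
  c (inord 3) == 0, c (inord 4) == 0 & c (inord 5) == 0]%N.
have U c : is_w c -> c = U_(inord 1)%MM.
  move=> /and5P[/eqP c0 /eqP c1 /eqP c2 /eqP c3 /andP[/eqP c4 /eqP c5]].
  by apply: mnm6P => -[|[|[|[|[|[|n]]]]]] // _; rewrite mnm1E -val_eqE /= !inordK.
move=> a0 b0 wa wb.
suff : is_w a || is_w b by case/orP => /U; [left|right].
have := E (inord 0); have := E (inord 1); have := E (inord 2).
have := E (inord 3); have := E (inord 4); have := E (inord 5).
rewrite /is_w !mnmDE !mon6E //.
move: (a (inord 0)) (a (inord 1)) (a (inord 2)) (a (inord 3)) (a (inord 4)) (a (inord 5))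
  (b (inord 0)) (b (inord 1)) (b (inord 2)) (b (inord 3)) (b (inord 4)) (b (inord 5))
  a0 b0 wa wb.
clear.
case: i => [[|[|[|[|[|[|[|[|[|[|[|[|[|[|i]]]]]]]]]]]]]] Hi]; [..|by []];
  cbv [nat_of_ord lead_monomial s3_monomials head nth fst snd]; clear => *; lia.
Qed.

(** Membership in the algebra is carried along the induction, because the derivation property of the
    coefficient relies on the weights of both factors and on the absence of w in them. *)
Lemma s3_indecomposable (X : ring6 -> Prop) (i : 'I_14) f :
  (forall g, X g -> exists j c, j != i /\ g = c *: tnth s3_generators j) ->
  subalg (@mpolyC 6 k) X f -> s3_even f /\ f@_(mon6 (lead_monomial i)) = 0.
Proof.
have nz : mon6 (lead_monomial i) != 0%MM.
  rewrite mnm6_eq0 !mon6E //.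
  by case: i => [[|[|[|[|[|[|[|[|[|[|[|[|[|[|i]]]]]]]]]]]]]] Hi].
move=> HX; elim=> [c|g /HX[j [c [ji ->]]]|g h _ [Eg Hg] _ [Eh Hh]|g h _ [Eg Hg] _ [Eh Hh]].
- by split; [exact: subalg_const|rewrite mcoeffC (negbTE nz) mulr0].
- split; first by rewrite -mul_mpolyC; apply: even_mul; [exact: subalg_const|exact: even_gen].
  by rewrite mcoeffZ mcoeff_lead eq_sym (negbTE ji) mulr0.
- by split; [exact: even_add|rewrite mcoeffD Hg Hh addr0].
split; first exact: even_mul.
rewrite mcoeffM_indecomposable ?Hg ?Hh ?mulr0 ?mul0r ?addr0 // => a b mE a0 b0.
have [->|ga] := eqVneq g@_a 0; first by rewrite mul0r.
have [->|hb] := eqVneq h@_b 0; first by rewrite mulr0.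
have wa := s3_even_weight Eg ga; have wb := s3_even_weight Eh hb.
have [aE|bE] := lead_monomial_indecomposable mE a0 b0 wa wb.
  by rewrite aE mcoeff_w_even ?mul0r.
by rewrite bE [h@_ _]mcoeff_w_even ?mulr0.
Qed.

Variable om : k.
Hypotheses (om3 : om ^+ 3 = 1) (om1 : om != 1).

Definition rotation : seq k := [:: 1; 1; om; om; om ^+ 2; om ^+ 2].

Lemma rotation_weight q :
  (forall v, q.@[fun i => nth 0 rotation i * v i] = q.@[v]) ->
  forall m, q@_m != 0 -> (3 %| weight m)%N.
Proof.
move=> qr m nz; have E : scale_vars (fun i => nth 0 rotation i) q = q.
  by apply: mpoly_eq_meval => // v; rewrite meval_scale_vars.
have {E} /esym/eqP := congr1 (mcoeff m) E.
rewrite mcoeff_scale_vars -{1}[q@_m]mulr1 (inj_eq (mulfI nz)).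
under eq_bigr => i _ do rewrite -[i in m i]inord_val.
rewrite -(big_mkord xpredT (fun i => nth 0 rotation i ^+ m (inord i))) /index_iota.
rewrite [iota _ _]/= !big_cons big_nil; cbv [rotation nth].
rewrite !expr1n !mul1r mulr1 -!exprM -!exprD -/(weight m).
have -> : (m (inord 2) + (m (inord 3) + (2 * m (inord 4) + 2 * m (inord 5))))%N = weight m.
  by rewrite /weight; lia.
rewrite {1}(divn_eq (weight m) 3) exprD mulnC exprM om3 expr1n mul1r /dvdn.
have := ltn_pmod (weight m) (isT : 0 < 3)%N.
case: (weight m %% 3)%N => [|[|[|r]]] //= _.
  by rewrite expr1 eq_sym (negbTE om1).
by rewrite eq_sym => /eqP om2; move: om1; rewrite -om3 exprS om2 mulr1 eqxx.
Qed.

Lemma swap_vars_of_meval q :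
  (forall v, q.@[fun i => nth 0 [:: v (inord 0); - v (inord 1); v (inord 4); v (inord 5);
     v (inord 2); v (inord 3)] i] = q.@[v]) ->
  swap_vars q = q.
Proof.
move=> qs; apply: mpoly_eq_meval => // v; rewrite -[RHS]qs /swap_vars comp_mpoly_meval.
apply: meval_eq => i; rewrite (tnth_nth 0).
case: i => [[|[|[|[|[|[|i]]]]]] Hi]; [..|by []]; rewrite [nth _ _ _]/= ?mevalN mevalXU //.
Qed.

Lemma s3_evenP q :
  (forall v, q.@[fun i => nth 0 rotation i * v i] = q.@[v]) ->
  (forall v, q.@[fun i => nth 0 [:: v (inord 0); - v (inord 1); v (inord 4); v (inord 5);
     v (inord 2); v (inord 3)] i] = q.@[v]) ->
  s3_even q.
Proof. by move=> /rotation_weight qr /swap_vars_of_meval; exact: s3_even_of_swap. Qed.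

Lemma meval_tvar v n : (tvar n).@[v] = v (inord n).
Proof. exact: mevalXU. Qed.
End S3Invariants.

Lemma ord2P (i : 'I_2) : i = ord0 \/ i = ord_max.
Proof. by case: i => [[|[|]] Hi] //; [left|right]; exact: val_inj. Qed.

(** * The action of GL_2 *)

Section MatrixAction.
Variable k : fieldType.
Implicit Types (F G : {mpoly k[2]}) (g h : 'M[k]_2) (P : {mpoly k[6 + 4]}).

Lemma mx_subst_vars g : mx_subst g xvar = g ord0 ord0 *: xvar + g ord0 ord_max *: yvar
  /\ mx_subst g yvar = g ord_max ord0 *: xvar + g ord_max ord_max *: yvar.
Proof. by rewrite /mx_subst form_subst_x form_subst_y. Qed.

Lemma mx_substC g c : mx_subst g c%:MP = c%:MP.
Proof. exact: comp_mpolyC. Qed.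

Lemma mx_substX g F n : mx_subst g (F ^+ n) = mx_subst g F ^+ n.
Proof. exact: rmorphXn. Qed.

Lemma mulmx2E g h i j : (g *m h) i j = g i ord0 * h ord0 j + g i ord_max * h ord_max j.
Proof.
rewrite mxE !big_ord_recl big_ord0 addr0.
by have -> : lift ord0 ord0 = ord_max :> 'I_2 by exact: val_inj.
Qed.

Lemma mx_subst_comp g h F : mx_subst g (mx_subst h F) = mx_subst (h *m g) F.
Proof.
elim/mpoly_alg_ind: F => [c|i|A B IHA IHB|A B IHA IHB].
- by rewrite !mx_substC.
- have [gx gy] := mx_subst_vars g; have [hx hy] := mx_subst_vars h.
  have [hgx hgy] := mx_subst_vars (h *m g).
  case: (ord2P i) => ->.
  + rewrite -/xvar hx hgx mx_substD !mx_substZ gx gy !mulmx2E !scalerDr !scalerA !scalerDl.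
    by rewrite addrACA.
  + rewrite -/yvar hy hgy mx_substD !mx_substZ gx gy !mulmx2E !scalerDr !scalerA !scalerDl.
    by rewrite addrACA.
- by rewrite !mx_substD IHA IHB.
by rewrite !mx_substM IHA IHB.
Qed.

Lemma mx_subst_form g n (a : 'I_n.+1 -> k) : mx_subst g (form_of_coord a) =
  \sum_(i < n.+1) a i *: (mx_subst g xvar ^+ (n - i) * mx_subst g yvar ^+ i).
Proof.
rewrite /form_of_coord (big_morph _ (mx_substD g) (mx_substC g 0)).
by apply: eq_bigr => i _; rewrite mx_substZ mx_substM !mx_substX.
Qed.

Lemma mx_subst_scalar c n F : F \is n.-homog -> mx_subst c%:M F = c ^+ n *: F.
Proof.
move=> hF; rewrite -(form_coordK hF) mx_subst_form scaler_sumr; apply: eq_bigr => i _.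
have [-> ->] := mx_subst_vars c%:M; rewrite !mxE /= !mulr1n !mulr0n !scale0r addr0 add0r.
have -> : c ^+ n = c ^+ (n - i) * c ^+ i by rewrite -exprD subnK // -ltnS.
by rewrite !exprZn -scalerAl -scalerAr !scalerA; congr (_ *: _); ring.
Qed.

Lemma mx_substZl c g n F : F \is n.-homog -> mx_subst (c *: g) F = c ^+ n *: mx_subst g F.
Proof.
by move=> hF; rewrite -mul_scalar_mx -mx_subst_comp (mx_subst_scalar c hF) mx_substZ.
Qed.

Lemma mx_subst1 n F : F \is n.-homog -> mx_subst 1%:M F = F.
Proof. by move=> hF; rewrite (mx_subst_scalar 1 hF) expr1n scale1r. Qed.

Lemma meval_homog n (p : {mpoly k[n]}) d c v : p \is d.-homog ->
  p.@[fun i => c * v i] = c ^+ d * p.@[v].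
Proof.
move=> hp; rewrite !mevalE mulr_sumr !big_seq; apply: eq_bigr => m mp.
have <- : mdeg m = d by apply: dhomog_mf mp.
under eq_bigr do rewrite exprMn.
by rewrite big_split /= mdegE prodrXr mulrCA.
Qed.

Lemma pair_coordZ c F G : pair_coord (c *: F) (c *: G) =1 (fun i => c * pair_coord F G i).
Proof. by move=> i; rewrite /pair_coord; case: split => j; rewrite /form_coord mcoeffZ. Qed.

Lemma joint_invariantZ d P c F G : joint_invariant d P ->
  P.@[pair_coord (c *: F) (c *: G)] = c ^+ d * P.@[pair_coord F G].
Proof. by move=> [_ hP]; rewrite (meval_eq _ (pair_coordZ c F G)) (meval_homog _ _ hP). Qed.

Lemma inv_D_indep F F' G : F \is 5.-homog -> F' \is 5.-homog -> G \is 3.-homog ->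
  (inv_D k).@[pair_coord F G] = (inv_D k).@[pair_coord F' G].
Proof.
move=> hF hF' hG; rewrite !const_form_eval.
rewrite !(spec_transvectant _ 2 2 2) !(spec_transvectant _ 3 3 2).
by rewrite !spec_pair_genG.
Qed.

Lemma G0_homog : G0 k \is 3.-homog.
Proof.
rewrite /G0 -[3%N]/(1 + 1 + 1)%N; apply: dhomogM; first apply: dhomogM.
- by rewrite dhomogX /= mdeg1.
- by rewrite dhomogX /= mdeg1.
by rewrite rpredB // dhomogX /= mdeg1.
Qed.

Lemma restrict_meval P (a : 'I_6 -> k) :
  (restrict P).@[a] = P.@[pair_coord (form_of_coord a) (G0 k)].
Proof.
rewrite /restrict comp_mpoly_meval; apply: meval_eq => i; rewrite tnth_mktuple /pair_coord.
case: splitP => j _; first by rewrite mevalXU form_of_coordK.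
by rewrite mevalC.
Qed.

Lemma restrict_meval_form P F : F \is 5.-homog ->
  (restrict P).@[@form_coord k 5 F] = P.@[pair_coord F (G0 k)].
Proof. by move=> hF; rewrite restrict_meval form_coordK. Qed.

End MatrixAction.

(** * Joint invariants under GL_2 *)

Section Orbits.
Variable k : fieldType.
Hypothesis closed_k : GRing.closed_field_axiom k.
Implicit Types (F G : {mpoly k[2]}) (g h : 'M[k]_2) (P : {mpoly k[6 + 4]}).

Lemma sqrt_closed (c : k) : exists z, z ^+ 2 = c.
Proof.
(* [closed_k] solves z^n = P 0 + P 1 z + .. + P (n-1) z^(n-1); here the right-hand side is the
   constant c. *)
have [z zE] := @closed_k 2%N (fun i => if i == 0%N then c else 0) isT.
by exists z; rewrite zE !big_ord_recl big_ord0 /= mulr1 mul0r !addr0.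
Qed.

(* With z ^ 2 = det g, the matrix g / z is unimodular and acts on (F, G) as
   (z ^ -5, z ^ -3) times g does; homogeneity absorbs the common factor z ^ 3. *)
Lemma joint_invariant_GL2 g F G : \det g != 0 -> F \is 5.-homog -> G \is 3.-homog ->
  exists2 c, c != 0 & forall d P, joint_invariant d P ->
    P.@[pair_coord (mx_subst g F) (mx_subst g G)]
    = c ^+ d * P.@[pair_coord (\det g *: F) G].
Proof.
move=> dg hF hG; have [z zE] := sqrt_closed (\det g).
have z0 : z != 0 by apply: contraNneq dg => z0; rewrite -zE z0 expr0n.
exists (z ^+ 3); first by rewrite expf_neq0.
move=> d P JP; pose g' := z^-1 *: g.
have dg' : \det g' = 1 by rewrite detZ -zE -exprMn mulVf // expr1n.
have -> : g = z *: g' by rewrite scalerA divff // scale1r.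
rewrite (mx_substZl _ _ hF) (mx_substZl _ _ hG).
have -> : \det (z *: g') = z ^+ 2 by rewrite detZ dg' mulr1.
have -> : z ^+ 5 *: mx_subst g' F = z ^+ 3 *: mx_subst g' (z ^+ 2 *: F).
  by rewrite mx_substZ scalerA -exprD.
rewrite (joint_invariantZ _ _ _ JP); congr (_ * _).
by case: JP => iP _; rewrite iP // rpredZ.
Qed.

(** The scalar c is chosen before [d] and [P]: a numerator and a power of D of the same degree are
    multiplied by the same c^d. *)
Lemma joint_invariant_move g b F G : \det g != 0 -> b != 0 -> F \is 5.-homog -> G \is 3.-homog ->
  exists2 c, c != 0 & forall d P, joint_invariant d P ->
    P.@[pair_coord (b *: mx_subst g F) (b *: mx_subst g G)]
    = c ^+ d * P.@[pair_coord (\det g *: F) G].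
Proof.
move=> dg b0 hF hG; have [c c0 Hc] := joint_invariant_GL2 dg hF hG.
exists (b * c) => [|d P JP]; first by rewrite mulf_neq0.
by rewrite (joint_invariantZ _ _ _ JP) (Hc _ _ JP) mulrA exprMn.
Qed.

End Orbits.

(** * From the cubic x^3 + y^3 to the slice *)

Section SliceAlgebra.
Variable k : fieldType.
Hypothesis char0 : [pchar k] =i pred0.
Implicit Types (F G : {mpoly k[2]}) (g h : 'M[k]_2) (P : {mpoly k[6 + 4]}) (t : 'I_6 -> k).
Variable om : k.
Hypothesis om_root : om ^+ 2 = -1 - om.

(** A square root of -3, which is also the determinant of [slice_mx]. *)
Definition theta : k := 1 + 2%:R * om.

Lemma theta2 : theta ^+ 2 = - 3%:R.
Proof.
have -> : theta ^+ 2 = 4%:R * om ^+ 2 + 4%:R * om + 1 by rewrite /theta; ring.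
by rewrite om_root; ring.
Qed.

Lemma theta_neq0 : theta != 0.
Proof.
apply/eqP => t0; have := natr_neq0 char0 (isT : 3 != 0)%N.
by rewrite -oppr_eq0 -theta2 t0 expr0n eqxx.
Qed.

Lemma om_cube : om ^+ 3 = 1.
Proof. by rewrite exprS om_root mulrBr mulrN1 -expr2 om_root; ring. Qed.

Lemma om_neq1 : om != 1.
Proof.
apply/eqP => o1; have := natr_neq0 char0 (isT : 3 != 0)%N; rewrite -oppr_eq0.
have -> : - 3%:R = -1 - om - om ^+ 2 :> k by rewrite o1; ring.
by rewrite om_root subrr eqxx.
Qed.

Definition mx2 (a b c d : k) : 'M[k]_2 :=
  \matrix_(i, j) if i == ord0 then if j == ord0 then a else b
                 else if j == ord0 then c else d.

Lemma mx2_mul a b c d a' b' c' d' : mx2 a b c d *m mx2 a' b' c' d' =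
  mx2 (a * a' + b * c') (a * b' + b * d') (c * a' + d * c') (c * b' + d * d').
Proof.
apply/matrixP => i j; rewrite mulmx2E !mxE.
by case: (ord2P i) => ->; case: (ord2P j) => ->.
Qed.

Lemma det_mx2 a b c d : \det (mx2 a b c d) = a * d - b * c.
Proof. by rewrite det2 !mxE. Qed.

Lemma mx2_subst a b c d : (mx_subst (mx2 a b c d) xvar = a *: xvar + b *: yvar)
  * (mx_subst (mx2 a b c d) yvar = c *: xvar + d *: yvar).
Proof.
by have [-> ->] := mx_subst_vars (mx2 a b c d); rewrite !mxE.
Qed.

(* X = x + om y and Y = - x + (1 + om) y are eigenvectors of the rotation r and are
   exchanged up to sign by s. *)
Definition slice_mx := mx2 1 om (-1) (1 + om).

Lemma det_slice_mx : \det slice_mx = theta.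
Proof. by rewrite det_mx2 /theta; ring. Qed.

Local Notation G1 := (lform [:: 1; 0; 0; 1 : k]).

Lemma G0_slice : G0 k = (3%:R * theta)^-1 *: mx_subst slice_mx G1.
Proof.
have nz : 3%:R * theta != 0 by rewrite mulf_neq0 ?theta_neq0 // natr_neq0.
apply: (scalerI nz); rewrite scalerA divff // scale1r.
have -> : G1 = xvar ^+ 3 + yvar ^+ 3.
  by rewrite [lform _]/= !scale0r !scale1r; ring.
rewrite mx_substD !mx_substX !mx2_subst -!mul_mpolyC.
set c := om%:MP; set x := xvar; set y := yvar.
have -> : (1 + om)%:MP = 1 + c by rewrite mpolyCD mpolyC1.
have -> : (-1)%:MP = -1 :> {mpoly k[2]} by rewrite mpolyCN mpolyC1.
have -> : (3%:R * theta)%:MP = 3%:R * (1 + 2%:R * c) :> {mpoly k[2]}.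
  by rewrite /theta mpolyCM mpolyC_nat mpolyCD mpolyCM mpolyC_nat mpolyC1.
have c2 : c ^+ 2 = -1 - c by rewrite /c -rmorphXn om_root /= mpolyCB mpolyCN mpolyC1.
(* The second summand vanishes by the equation of om; once it is added, the identity holds for a
   free variable c and is left to [ring]. *)
transitivity (3%:R * (1 + 2%:R * c) * (x * y * (x - y))
  + (1 + 2%:R * c) * (c ^+ 2 - (-1 - c)) * y ^+ 3).
  by rewrite c2 subrr mulr0 mul0r addr0.
by rewrite mpolyC1 /G0; ring.
Qed.

(** Inverse of the change of coordinates from f0, .., f5 to al, w, x1, x2, y1, y2. The blocks for
    (f0, f3) and (f5, f2) have determinant 25 * 49 - 245 * 149 = - 35280, where 35280 = 720 * 49 =
    144 * 245. *)
Definition slice_coef_poly n : {mpoly k[6]} := nth 0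
  [:: (- (720%:R)^-1) *: (tvar k 2 - 5%:R *: tvar k 3);
      2%:R^-1 *: (tvar k 1 - tvar k 0);
      (144%:R^-1 / 245%:R) *: (25%:R *: tvar k 5 - 149%:R *: tvar k 4);
      (- (144%:R^-1 / 245%:R)) *: (25%:R *: tvar k 3 - 149%:R *: tvar k 2);
      2%:R^-1 *: (tvar k 1 + tvar k 0);
      720%:R^-1 *: (tvar k 4 - 5%:R *: tvar k 5)] n.

Definition slice_coef t n : k := (slice_coef_poly n).@[t].

Lemma slice_coefE t :
  [/\ slice_coef t 0 = - (720%:R)^-1 * (t (inord 2) - 5%:R * t (inord 3)),
      slice_coef t 1 = 2%:R^-1 * (t (inord 1) - t (inord 0)),
      slice_coef t 2 = 144%:R^-1 / 245%:R * (25%:R * t (inord 5) - 149%:R * t (inord 4)),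
      slice_coef t 3 = - (144%:R^-1 / 245%:R) * (25%:R * t (inord 3) - 149%:R * t (inord 2)) &
      slice_coef t 4 = 2%:R^-1 * (t (inord 1) + t (inord 0)) /\
      slice_coef t 5 = 720%:R^-1 * (t (inord 4) - 5%:R * t (inord 5))].
Proof.
split; last split; rewrite /slice_coef /slice_coef_poly [nth _ _ _]/=;
  by rewrite !(mevalZ, mevalD, mevalN, meval_tvar).
Qed.

Definition slice_list t := [:: slice_coef t 0; slice_coef t 1; slice_coef t 2;
  slice_coef t 3; slice_coef t 4; slice_coef t 5].

(** The factor -1/9 comes from G0 being (3 theta)^-1 times the transform of x^3 + y^3: moving the
    pair to that cubic multiplies the quintic by 3 theta and by the determinant theta, and 3 theta^2
    = -9. *)
Definition slice_form t := mx_subst slice_mx ((- 9%:R)^-1 *: lform (slice_list t)).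

Lemma lform5_homog t : lform (slice_list t) \is 5.-homog.
Proof. exact: lform_homog. Qed.

Lemma lform3_homog : G1 \is 3.-homog.
Proof. exact: lform_homog. Qed.

Lemma slice_form_homog t : slice_form t \is 5.-homog.
Proof. by apply/mx_subst_homog/rpredZ/lform5_homog. Qed.

Lemma nine_neq0 : - 9%:R != 0 :> k.
Proof. by rewrite oppr_eq0 natr_neq0. Qed.

Lemma theta_scale : theta * (3%:R * theta * (- 9%:R)^-1) = 1.
Proof.
have -> : theta * (3%:R * theta * (- 9%:R)^-1) = 3%:R * theta ^+ 2 / - 9%:R by ring.
by rewrite theta2 (_ : 3%:R * - 3%:R = - 9%:R :> k) ?divff ?nine_neq0 //; ring.
Qed.

(** For a denominator c D^m, the constant in the value of the numerator divided by c (-2)^m, since D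
    = -2 at x^3 + y^3. The first entry is 280 / -6 = -140 / 3. *)
Definition gamma : 14.-tuple k :=
  [tuple - (140%:R / 3%:R); 2%:R / 27%:R; 243%:R^-1; - 9%:R^-1; - 81%:R^-1;
    - (14%:R / 27%:R); - 5292%:R; 2%:R / 3%:R; 27%:R^-1; - 9%:R^-1; 14%:R;
    14%:R / 9%:R; - (14%:R / 3%:R); 14%:R].

Lemma gamma_neq0 i : tnth gamma i != 0.
Proof.
rewrite (tnth_nth 0); case: i => [[|[|[|[|[|[|[|[|[|[|[|[|[|[|i]]]]]]]]]]]]]] Hi];
  [..|by []]; rewrite [nth _ _ _]/= ?oppr_eq0 ?mulf_neq0 ?invr_eq0 ?natr_neq0 //.
Qed.

Lemma slice_lin t : let f := slice_coef t in
  [/\ f 4%N - f 1%N = t (inord 0), f 1%N + f 4%N = t (inord 1),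
      25%:R * f 0%N + 245%:R * f 3%N = t (inord 2),
      149%:R * f 0%N + 49%:R * f 3%N = t (inord 3) &
      - (25%:R * f 5%N + 245%:R * f 2%N) = t (inord 4)
      /\ - (149%:R * f 5%N + 49%:R * f 2%N) = t (inord 5)].
Proof.
have [e0 e1 e2 e3 [e4 e5]] := slice_coefE t.
have n2 : 2%:R != 0 :> k by rewrite natr_neq0.
have n720 : 720%:R != 0 :> k by rewrite natr_neq0.
have n144 : 144%:R != 0 :> k by rewrite natr_neq0.
have n245 : 245%:R != 0 :> k by rewrite natr_neq0.
split; last split; rewrite ?e0 ?e1 ?e2 ?e3 ?e4 ?e5; field; rewrite ?n2 ?n720 ?n144 ?n245 //.
Qed.

Lemma meval_s3_generator i t : (tnth (s3_generators k) i).@[t] =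
  let w := t (inord 1) in let x1 := t (inord 2) in let x2 := t (inord 3) in
  let y1 := t (inord 4) in let y2 := t (inord 5) in
  nth 0 [:: t (inord 0); x1 * y1; x1 ^+ 3 + y1 ^+ 3; x1 * y2 + x2 * y1;
    x1 ^+ 2 * x2 + y1 ^+ 2 * y2; w * (x1 ^+ 3 - y1 ^+ 3); w ^+ 2; x2 * y2;
    x1 * x2 ^+ 2 + y1 * y2 ^+ 2; x2 ^+ 3 + y2 ^+ 3; w * (x1 * y2 - x2 * y1);
    w * (x1 ^+ 2 * x2 - y1 ^+ 2 * y2); w * (x1 * x2 ^+ 2 - y1 * y2 ^+ 2);
    w * (x2 ^+ 3 - y2 ^+ 3)] i.
Proof.
rewrite (tnth_nth 0); case: i => [[|[|[|[|[|[|[|[|[|[|[|[|[|[|i]]]]]]]]]]]]]] Hi];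
  [..|by []]; cbv [s3_generators tval tuple nth nat_of_ord];
  by rewrite ?(mevalD, mevalN, mevalM, rmorphXn) /= ?meval_tvar.
Qed.

Local Ltac apply_value value :=
  match goal with t : 'I_6 -> _ |- _ =>
    let V := fresh in
    have V := value _ char0 (slice_coef t 0) (slice_coef t 1) (slice_coef t 2)
      (slice_coef t 3) (slice_coef t 4) (slice_coef t 5);
    rewrite [meval _ _]V; clear V
  end.

Lemma numerator_value i t :
  (tnth (generators k) i).1.@[pair_coord (lform (slice_list t)) G1] =
  (tnth den_const i)%:R * (- 2%:R) ^+ tnth den_exp i *
  (tnth gamma i * (tnth (s3_generators k) i).@[t]).
Proof.
have [l0 l1 l2 l3 [l4 l5]] := slice_lin t.
rewrite meval_s3_generator.
have n3 : 3%:R != 0 :> k by rewrite natr_neq0.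
have n9 : 9%:R != 0 :> k by rewrite natr_neq0.
have n27 : 27%:R != 0 :> k by rewrite natr_neq0.
have n81 : 81%:R != 0 :> k by rewrite natr_neq0.
have n243 : 243%:R != 0 :> k by rewrite natr_neq0.
case: i => [[|[|[|[|[|[|[|[|[|[|[|[|[|[|i]]]]]]]]]]]]]] Hi]; [..|by []];
  rewrite !(tnth_nth 0%N) (tnth_nth (0, 0)) (tnth_nth 0);
  cbv [generators gamma den_const den_exp tuple tval nth fst snd nat_of_ord];
  [apply_value @value_P1
  |apply_value @value_P2
  |rewrite mevalM (rmorph_nat (meval _) 3); apply_value @value_P3
  |apply_value @value_P4
  |apply_value @value_P5
  |apply_value @value_P6
  |apply_value @value_Q_e2
  |apply_value @value_Q_p02
  |apply_value @value_Q_p12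
  |apply_value @value_Q_p03
  |apply_value @value_Q_w2
  |apply_value @value_Q_w21
  |apply_value @value_Q_w12
  |apply_value @value_Q_w03];
  rewrite ?l0 ?l1 ?l2 ?l3 ?l4 ?l5; field; by rewrite ?n3 ?n9 ?n27 ?n81 ?n243 ?oner_neq0.
Qed.

End SliceAlgebra.

Section SliceReduction.
Variable k : fieldType.
Hypothesis closed_k : GRing.closed_field_axiom k.
Hypothesis char0 : [pchar k] =i pred0.
Implicit Types (F G : {mpoly k[2]}) (g h : 'M[k]_2) (P : {mpoly k[6 + 4]}) (t : 'I_6 -> k).
Variable om : k.
Hypothesis om_root : om ^+ 2 = -1 - om.
Local Notation theta := (theta om).
Local Notation slice_mx := (slice_mx om).
Local Notation slice_form := (slice_form om).
Local Notation G1 := (lform [:: 1; 0; 0; 1 : k]).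

(** Transports every evaluation over G0 to the sparse cubic: [slice_form] is scaled so that exactly
    [lform (slice_list t)] remains next to x^3 + y^3. *)
Lemma slice_pair t : exists2 c, c != 0 & forall d P, joint_invariant d P ->
  P.@[pair_coord (slice_form t) (G0 k)] = c ^+ d * P.@[pair_coord (lform (slice_list t)) G1].
Proof.
have nz3 : 3%:R * theta != 0 by rewrite mulf_neq0 ?theta_neq0 // natr_neq0.
have nz : (3%:R * theta)^-1 != 0 by rewrite invr_eq0.
have dg : \det slice_mx != 0 by rewrite det_slice_mx theta_neq0.
pose E := ((3%:R * theta) * (- 9%:R)^-1) *: lform (slice_list t).
have hE : E \is 5.-homog by apply/rpredZ/lform5_homog.
have [c c0 Hc] := joint_invariant_move closed_k dg nz hE (lform3_homog k).
exists c => // d P JP; rewrite (G0_slice char0 om_root).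
have -> : slice_form t = (3%:R * theta)^-1 *: mx_subst slice_mx E.
  by rewrite /slice_form /E !mx_substZ !scalerA mulKf.
rewrite (Hc d P JP) det_slice_mx /E scalerA.
by rewrite (theta_scale char0 om_root) scale1r.
Qed.

Lemma inv_D_slice : (inv_D k).@[pair_coord 0 (G0 k)] != 0.
Proof.
have [c c0 Hc] := slice_pair (fun=> 0).
rewrite (inv_D_indep (dhomog0 _ _ _) (slice_form_homog om (fun=> 0)) (G0_homog k)).
rewrite (Hc _ _ (inv_D_joint char0)) mulf_neq0 ?expf_neq0 //.
by rewrite slice_inv_D // oppr_eq0 natr_neq0.
Qed.

End SliceReduction.

(** * The group Gamma in the slice coordinates *)

Section SliceSymmetry.
Variable k : fieldType.
Hypothesis char0 : [pchar k] =i pred0.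
Implicit Types (F G : {mpoly k[2]}) (t : 'I_6 -> k).
Variable om : k.
Hypothesis om_root : om ^+ 2 = -1 - om.

Lemma lform_ext n (a b : seq k) : size a = n.+1 -> size b = n.+1 ->
  (forall i, (i < n.+1)%N -> nth 0 a i = nth 0 b i) -> lform a = lform b.
Proof.
by move=> sa sb E; congr lform; apply: (@eq_from_nth _ 0) => [|i]; rewrite sa ?sb //; exact: E.
Qed.

Lemma lform_form n (F : {mpoly k[2]}) : F \is n.-homog ->
  exists2 a : seq k, size a = n.+1 & F = lform a.
Proof.
move=> hF; exists (mkseq (fun i => form_coord F (inord i : 'I_n.+1)) n.+1).
  by rewrite size_mkseq.
rewrite -{1}(form_coordK hF) (@lform_of_coord _ n) ?size_mkseq //.
by apply: eq_form_of_coord => i; rewrite nth_mkseq // inord_val.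
Qed.

Lemma slice_form_surj F : F \is 5.-homog -> exists t, F = slice_form om t.
Proof.
move=> hF; have th := theta_neq0 char0 om_root.
have gu : slice_mx om \in unitmx by rewrite unitmxE det_slice_mx unitfE.
have hF' : mx_subst (invmx (slice_mx om)) F \is 5.-homog by exact: mx_subst_homog.
have [a sa aE] := lform_form hF'.
(* The factor -9 undoes the scalar in [slice_form]; the witness lists the coordinates al, w, x1, x2,
   y1, y2 of the resulting quintic. *)
pose f n := - 9%:R * nth 0 a n.
exists (fun i => nth 0 [:: f 4%N - f 1%N; f 1%N + f 4%N; 25%:R * f 0%N + 245%:R * f 3%N;
   149%:R * f 0%N + 49%:R * f 3%N; - (25%:R * f 5%N + 245%:R * f 2%N);
   - (149%:R * f 5%N + 49%:R * f 2%N)] i).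
set t := fun i => _; have [e0 e1 e2 e3 [e4 e5]] := slice_coefE t.
have n2 : 2%:R != 0 :> k by rewrite natr_neq0.
have n720 : 720%:R != 0 :> k by rewrite natr_neq0.
have n144 : 144%:R != 0 :> k by rewrite natr_neq0.
have n245 : 245%:R != 0 :> k by rewrite natr_neq0.
have lE : lform (slice_list t) = - 9%:R *: lform a.
  rewrite -lform_scale; apply: (@lform_ext 5) => //; first by rewrite size_map sa.
  move=> i i6; rewrite (nth_map 0) ?sa // -/(f i).
  case: i i6 => [|[|[|[|[|[|i]]]]]] // _;
    rewrite [LHS]/= ?e0 ?e1 ?e2 ?e3 ?e4 ?e5 /t !inordK // [nth _ _ _]/=;
    rewrite /nth; field; rewrite ?n2 ?n720 ?n144 ?n245 //.
rewrite /slice_form lE scalerA mulVf ?nine_neq0 // scale1r -aE mx_subst_comp mulVmx //.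
by rewrite (mx_subst1 hF).
Qed.

Lemma lform_slice_list t :
  lform (slice_list t) = form_of_coord (fun i : 'I_6 => slice_coef t i).
Proof.
rewrite (@lform_of_coord _ 5) //; apply: eq_form_of_coord => i.
by case: i => [[|[|[|[|[|[|i]]]]]] Hi].
Qed.

Lemma mx_subst_diag n (a b : k) (c : 'I_n.+1 -> k) :
  mx_subst (mx2 a 0 0 b) (form_of_coord c) =
  form_of_coord (fun i : 'I_n.+1 => c i * (a ^+ (n - i) * b ^+ i)).
Proof.
rewrite mx_subst_form; case: (mx2_subst a 0 0 b) => -> ->; apply: eq_bigr => i _.
rewrite !scale0r addr0 add0r !exprZn -scalerAl -scalerAr !scalerA; congr (_ *: _).
by rewrite mulrA.
Qed.

Lemma mx_subst_exchange n (c : 'I_n.+1 -> k) :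
  mx_subst (mx2 0 1 1 0) (form_of_coord c) = form_of_coord (c \o @rev_ord n.+1).
Proof.
have [ex ey] := @mx2_subst k 0 1 1 0.
rewrite mx_subst_form ex ey /form_of_coord [RHS](reindex_inj rev_ord_inj).
apply: eq_bigr => i _; rewrite !scale0r !scale1r addr0 add0r /= rev_ordK.
by rewrite subSS subKn 1?mulrC // -ltnS.
Qed.

Lemma Gamma_rE F : Gamma_r F = - mx_subst (mx2 1 (-1) 1 0) F.
Proof. by rewrite /Gamma_r /mx_subst !mxE /= scale1r scaleN1r scale0r addr0. Qed.

Lemma Gamma_sE F : Gamma_s F = - mx_subst (mx2 (-1) 1 0 1) F.
Proof. by rewrite /Gamma_s /mx_subst !mxE /= scale1r scaleN1r scale0r add0r. Qed.

Lemma slice_form_rotation t :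
  slice_form om (fun i => nth 0 (rotation om) i * t i) = Gamma_r (slice_form om t).
Proof.
rewrite Gamma_rE /slice_form mx_subst_comp.
(* The rows of [slice_mx] are eigenvectors, with eigenvalues 1 + om = - om^2 and - om. *)
have -> : slice_mx om *m mx2 1 (-1) 1 0 = mx2 (1 + om) 0 0 (- om) *m slice_mx om.
  rewrite /slice_mx !mx2_mul.
  have -> : (1 + om) * om = -1 by rewrite mulrDl mul1r -expr2 om_root; ring.
  have -> : - om * (1 + om) = 1 by rewrite mulrDr !mulNr -expr2 om_root; ring.
  by congr mx2; ring.
rewrite -mx_subst_comp !mx_substZ -scalerN; congr (_ *: _).
rewrite -[RHS]scaleN1r -mx_substZ; congr (mx_subst _ _).
rewrite !lform_slice_list mx_subst_diag -form_of_coordZ.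
have [e0 e1 e2 e3 [e4 e5]] := slice_coefE (fun i => nth 0 (rotation om) i * t i).
have [u0 u1 u2 u3 [u4 u5]] := slice_coefE t.
have a1 : 1 + om = - om ^+ 2 by rewrite om_root; ring.
have om3 := om_cube om_root; have om4 : om ^+ 4 = om by rewrite exprS om3 mulr1.
apply: eq_form_of_coord => i; rewrite a1.
(* With the sign of [Gamma_r] the i-th coefficient is multiplied by om^(10 - i), which depends on i
   modulo 3: 1 for f1 and f4, om for f0 and f3, om^2 for f2 and f5. These eigenspaces are the ones
   with coordinates al and w, x1 and x2, y1 and y2. *)
have -> : -1 * (slice_coef t i * ((- om ^+ 2) ^+ (5 - i) * (- om) ^+ i)) =
  om ^+ (10 - i) * slice_coef t i.
  have i5 : (i <= 5)%N by rewrite -ltnS.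
  have -> : (10 - i)%N = (2 * (5 - i) + i)%N by lia.
  rewrite exprNn (exprNn om) exprD exprM [(-1) ^+ _ * _ * _]mulrACA -exprD subnK //.
  by rewrite -signr_odd expr1; ring.
have om9 : om ^+ 9 = 1 by rewrite -[9%N]/(3 * 3)%N exprM om3 expr1n.
have om6 : om ^+ 6 = 1 by rewrite -[6%N]/(3 * 2)%N exprM om3 expr1n.
have p10 : om ^+ 10 = om by rewrite exprS om9 mulr1.
have p8 : om ^+ 8 = om ^+ 2 by rewrite -[8%N]/(6 + 2)%N exprD om6 mul1r.
have p7 : om ^+ 7 = om by rewrite exprS om6 mulr1.
have p5 : om ^+ 5 = om ^+ 2 by rewrite -[5%N]/(3 + 2)%N exprD om3 mul1r.
case: i => [[|[|[|[|[|[|i]]]]]] Hi] //; cbv [nat_of_ord subn Nat.sub subn_rec];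
  rewrite ?p10 ?om9 ?p8 ?p7 ?om6 ?p5
   ?e0 ?e1 ?e2 ?e3 ?e4 ?e5 ?u0 ?u1 ?u2 ?u3 ?u4 ?u5 !inordK //; rewrite /rotation /nth; ring.
Qed.

Lemma slice_form_swap t :
  slice_form om (fun i => nth 0 [:: t (inord 0); - t (inord 1); t (inord 4); t (inord 5);
     t (inord 2); t (inord 3)] i) = Gamma_s (slice_form om t).
Proof.
rewrite Gamma_sE /slice_form mx_subst_comp.
have -> : slice_mx om *m mx2 (-1) 1 0 1 = mx2 0 1 1 0 *m slice_mx om.
  by rewrite /slice_mx !mx2_mul; congr mx2; ring.
rewrite -mx_subst_comp !mx_substZ -scalerN; congr (_ *: _).
rewrite -[RHS]scaleN1r -mx_substZ; congr (mx_subst _ _).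
rewrite !lform_slice_list mx_subst_exchange -form_of_coordZ.
have [e0 e1 e2 e3 [e4 e5]] := slice_coefE (fun i => nth 0 [:: t (inord 0); - t (inord 1);
  t (inord 4); t (inord 5); t (inord 2); t (inord 3)] i).
have [u0 u1 u2 u3 [u4 u5]] := slice_coefE t.
(* With the sign of [Gamma_s], f_i is replaced by - f_(5-i), which fixes al, negates w and exchanges
   x_j with y_j. *)
apply: eq_form_of_coord => i.
case: i => [[|[|[|[|[|[|i]]]]]] Hi] //; cbv [nat_of_ord rev_ord comp subn Nat.sub subn_rec];
  rewrite ?e0 ?e1 ?e2 ?e3 ?e4 ?e5 ?u0 ?u1 ?u2 ?u3 ?u4 ?u5 !inordK //; rewrite /nth; ring.
Qed.

End SliceSymmetry.

(** * Cubics with nonzero discriminant *)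

Section Cubics.
Variable k : fieldType.
Hypothesis char0 : [pchar k] =i pred0.

(** The bracket is the discriminant of the cubic. *)
Lemma inv_D_cubic F (b0 b1 b2 b3 : k) : F \is 5.-homog ->
  (inv_D k).@[pair_coord F (lform [:: b0; b1; b2; b3])] =
  2%:R / 27%:R * (b1 ^+ 2 * b2 ^+ 2 - 4%:R * b1 ^+ 3 * b3 - 4%:R * b0 * b2 ^+ 3
    + 18%:R * b0 * b1 * b2 * b3 - 27%:R * b0 ^+ 2 * b3 ^+ 2).
Proof.
move=> hF; have hG : lform [:: b0; b1; b2; b3] \is 3.-homog by exact: lform_homog.
have n3 : 3%:R != 0 :> k by rewrite natr_neq0.
have n2 : 2%:R != 0 :> k by rewrite natr_neq0.
have n6 : 6%:R != 0 :> k by rewrite natr_neq0.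
have n27 : 27%:R != 0 :> k by rewrite natr_neq0.
have n9 : 9%:R != 0 :> k by rewrite natr_neq0.
have hE : transvectant 3 3 2 (lform [:: b0; b1; b2; b3]) (lform [:: b0; b1; b2; b3]) =
  lform [:: 2%:R / 3%:R * b0 * b2 - 2%:R / 9%:R * b1 ^+ 2;
    2%:R * b0 * b3 - 2%:R / 9%:R * b1 * b2; 2%:R / 3%:R * b1 * b3 - 2%:R / 9%:R * b2 ^+ 2].
  rewrite (@lform_trans _ char0 3 3 2 [:: b0; b1; b2; b3] [:: b0; b1; b2; b3]
    erefl erefl isT isT).
  apply: (congr1 (@lform _)); unfold_lists; cbv [binomial].
  by congr [:: _; _; _]; field; rewrite ?n3 ?n2 ?n6 ?n9 ?oner_neq0.
rewrite const_form_eval (spec_transvectant _ 2 2 2) (spec_transvectant _ 3 3 2).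
rewrite (spec_pair_genG _ hG) hE.
set h := [:: _; _; _]; rewrite (@full_transvectant_lform _ char0 2 h h erefl erefl) /h.
cbv [iota nth foldr subn Nat.sub binomial addn Nat.add].
by field; rewrite ?n3 ?n2 ?n6 ?n9 ?n27 ?oner_neq0.
Qed.

(** Here G = b (x - r1 y)(x - r2 y)(x - r3 y). With u = r3 - r2 and v = r3 - r1, the forms p = u (x
    - r1 y) and q = v (x - r2 y) satisfy p - q = (r1 - r2)(x - r3 y), so that p q (p - q) is a
    multiple of G. The multiple is nonzero, since equal roots would make the discriminant vanish. *)
Lemma cubic_orbit F (b r1 r2 r3 : k) : F \is 5.-homog -> b != 0 ->
  let G := lform [:: b; - b * (r1 + r2 + r3); b * (r1 * r2 + r1 * r3 + r2 * r3);
    - b * (r1 * r2 * r3)] in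
  (inv_D k).@[pair_coord F G] != 0 ->
  exists g c, [/\ \det g != 0, c != 0 & G = c *: mx_subst g (G0 k)].
Proof.
move=> hF b0 G; rewrite /G (inv_D_cubic _ _ _ _ hF) -/G => D0.
have r12 : r1 - r2 != 0 by apply: contraNneq D0 => /subr0_eq ->; apply/eqP; ring.
have r13 : r3 - r1 != 0 by apply: contraNneq D0 => /subr0_eq ->; apply/eqP; ring.
have r23 : r3 - r2 != 0 by apply: contraNneq D0 => /subr0_eq ->; apply/eqP; ring.
set u := r3 - r2 in r23 *; set v := r3 - r1 in r13 *.
have nz : u * v * (r1 - r2) != 0 by rewrite !mulf_neq0.
exists (mx2 u (- u * r1) v (- v * r2)), (b / (u * v * (r1 - r2))); split.
- by rewrite det_mx2 (_ : _ - _ = u * v * (r1 - r2)) //; ring.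
- by rewrite mulf_neq0 ?invr_eq0.
apply: (scalerI nz); rewrite scalerA mulrCA divff // mulr1.
have [ex ey] := mx2_subst u (- u * r1) v (- v * r2).
rewrite /G0 !mx_substM mx_substB ex ey /G [lform _]/= mulr0 addr0 expr0 -!mul_mpolyC.
rewrite /u /v !(mpolyCM, mpolyCN, mpolyCB, mpolyCD).
move: b%:MP r1%:MP r2%:MP r3%:MP => B R1 R2 R3; ring.
Qed.

(** The hypotheses make r1 a root of the monic cubic and r2 a root of its quotient by x - r1; r3 is
    given by the sum of the roots. *)
Lemma cubic_roots_eq (b0 b1 b2 b3 r1 r2 : k) : b0 != 0 ->
  r1 ^+ 3 = - (b3 / b0) + - (b2 / b0) * r1 + - (b1 / b0) * r1 ^+ 2 ->
  r2 ^+ 2 = - (b2 / b0 + b1 / b0 * r1 + r1 ^+ 2) + - (b1 / b0 + r1) * r2 ->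
  let r3 := - (b1 / b0) - r1 - r2 in
  [:: b0; b1; b2; b3] = [:: b0; - b0 * (r1 + r2 + r3);
    b0 * (r1 * r2 + r1 * r3 + r2 * r3); - b0 * (r1 * r2 * r3)].
Proof.
move=> nz E1 E2 r3; rewrite /r3; congr [:: _; _; _; _].
- by field.
(* The equation of r2 enters as an explicit multiple of zero, so that what remains is an identity
   for [field]. *)
- transitivity (b2 - b0 * (r2 ^+ 2
    - (- (b2 / b0 + b1 / b0 * r1 + r1 ^+ 2) + - (b1 / b0 + r1) * r2))).
    by rewrite E2 subrr mulr0 subr0.
  by field.
transitivity (b3 - b0 * (r1 ^+ 3 - (- (b3 / b0) + - (b2 / b0) * r1 + - (b1 / b0) * r1 ^+ 2))
   + b0 * r1 * (r2 ^+ 2 - (- (b2 / b0 + b1 / b0 * r1 + r1 ^+ 2) + - (b1 / b0 + r1) * r2))).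
  by rewrite E1 E2 !subrr !mulr0 subr0 addr0.
by field.
Qed.

Lemma mpolyXi_neq0 n (i : 'I_n) : 'X_i != 0 :> {mpoly k[n]}.
Proof.
by apply/eqP => /(congr1 (meval (fun=> 1))); rewrite mevalXU meval0 => /eqP; rewrite oner_eq0.
Qed.

Lemma pair_coord_form_of_coord (v : 'I_(6 + 4) -> k) :
  v =1 pair_coord (form_of_coord (fun a : 'I_6 => v (lshift 4 a)))
    (form_of_coord (fun b : 'I_4 => v (rshift 6 b))).
Proof.
move=> i; rewrite /pair_coord; case: (splitP i) => j ij; rewrite form_of_coordK;
  by congr v; apply: val_inj; rewrite /= ij.
Qed.

End Cubics.

(** * Density of the orbit of the slice *)

Section Density.
Variable k : fieldType.
Hypothesis closed_k : GRing.closed_field_axiom k.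
Hypothesis char0 : [pchar k] =i pred0.
Implicit Types (F G : {mpoly k[2]}) (P : {mpoly k[6 + 4]}).

Lemma cubic_roots (b0 b1 b2 b3 : k) : b0 != 0 -> exists r1 r2 r3,
  [:: b0; b1; b2; b3] = [:: b0; - b0 * (r1 + r2 + r3);
    b0 * (r1 * r2 + r1 * r3 + r2 * r3); - b0 * (r1 * r2 * r3)].
Proof.
move=> nz.
have [r1 r1E] := @closed_k 3%N (nth 0 [:: - (b3 / b0); - (b2 / b0); - (b1 / b0)]) isT.
have [r2 r2E] := @closed_k 2%N
  (nth 0 [:: - (b2 / b0 + b1 / b0 * r1 + r1 ^+ 2); - (b1 / b0 + r1)]) isT.
exists r1, r2, (- (b1 / b0) - r1 - r2); apply: cubic_roots_eq => //.
  by rewrite r1E !big_ord_recl big_ord0 /= mulr1 addr0 !addrA.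
by rewrite r2E !big_ord_recl big_ord0 /= mulr1 addr0.
Qed.

(** Where D and the coefficient of x^3 in G are nonzero, G has three distinct factors x - r y and
    lies in the GL_2-orbit of the line through G0, so P vanishes there. Multiplying P by D and by
    that coefficient makes it vanish everywhere, and the polynomial ring is a domain. *)
Lemma joint_invariant_vanish d P : joint_invariant d P -> restrict P = 0 -> P = 0.
Proof.
move=> JP rP0; pose b0 : {mpoly k[6 + 4]} := 'X_(rshift 6 ord0).
have [om omE] := @closed_k 2%N (fun=> -1) isT.
have om_root : om ^+ 2 = -1 - om.
  by rewrite omE !big_ord_recl big_ord0 /= mulr1 addr0 mulN1r.
suff : P * (inv_D k * b0) = 0.
  move/eqP; rewrite mulf_eq0 => /orP[/eqP //|]; rewrite mulf_eq0 => /orP[]/eqP E.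
    by have := inv_D_slice closed_k char0 om_root; rewrite E meval0 eqxx.
  by have := mpolyXi_neq0 k (rshift 6 (@ord0 3)); rewrite -/b0 E eqxx.
apply: (mpoly_vanish char0) => v; rewrite !mevalM mevalXU.
have vE := pair_coord_form_of_coord v; rewrite !(meval_eq _ vE).
set F := form_of_coord _; set G := form_of_coord _.
have hF : F \is 5.-homog by exact: form_of_coord_homog.
have hG : G \is 3.-homog by exact: form_of_coord_homog.
have [->|D0] := eqVneq (inv_D k).@[pair_coord F G] 0; first by rewrite mul0r mulr0.
have [->|v0] := eqVneq (v (rshift 6 ord0)) 0; first by rewrite !mulr0.
have GE : G = lform [:: v (rshift 6 (inord 0)); v (rshift 6 (inord 1));
    v (rshift 6 (inord 2)); v (rshift 6 (inord 3))].
  rewrite (@lform_of_coord _ 3) //; apply: eq_form_of_coord => i.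
  case: i => [[|[|[|[|i]]]] Hi] //=; congr (v (rshift _ _));
    apply: val_inj; rewrite /= inordK //.
have i0 : inord 0 = ord0 :> 'I_4 by apply: val_inj; rewrite /= inordK.
rewrite i0 in GE.
have [r1 [r2 [r3 rE]]] := cubic_roots (v (rshift 6 (inord 1))) (v (rshift 6 (inord 2)))
  (v (rshift 6 (inord 3))) v0.
rewrite rE in GE; rewrite GE in D0.
have [g [c [dg c0 cE]]] := cubic_orbit char0 hF v0 D0.
have gu : g \in unitmx by rewrite unitmxE unitfE.
have FE : F = c *: mx_subst g (c^-1 *: mx_subst (invmx g) F).
  by rewrite mx_substZ scalerA divff // scale1r mx_subst_comp mulVmx // (mx_subst1 hF).
have hF' : c^-1 *: mx_subst (invmx g) F \is 5.-homog by apply/rpredZ/mx_subst_homog.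
have [C C0 HC] := joint_invariant_move closed_k dg c0 hF' (G0_homog k).
rewrite [X in pair_coord X _]FE GE cE (HC _ _ JP).
have hF'' : \det g *: (c^-1 *: mx_subst (invmx g) F) \is 5.-homog by exact: rpredZ.
by rewrite -(restrict_meval_form _ hF'') rP0 meval0 mulr0 mul0r.
Qed.

End Density.

(** * Minimal generators on the slice *)

Section SliceMap.
Variable k : fieldType.
Hypothesis char0 : [pchar k] =i pred0.
Variable om : k.
Hypothesis om_root : om ^+ 2 = -1 - om.
Implicit Types (t : 'I_6 -> k) (p q f : {mpoly k[6]}).

Definition slice_point t : 'I_6 -> k := @form_coord k 5 (slice_form om t).

Definition slice_point_poly (j : 'I_6) : {mpoly k[6]} :=
  \sum_(i < 6) ((- 9%:R)^-1 * @form_coord k 5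
     (mx_subst (slice_mx om) xvar ^+ (5 - i) * mx_subst (slice_mx om) yvar ^+ i) j)
   *: slice_coef_poly k i.

(** Pullback along the linear parametrisation [slice_form] of V_5. *)
Definition slice_map p := p \mPo [tuple slice_point_poly j | j < 6].

Lemma slice_point_polyE t j : (slice_point_poly j).@[t] = slice_point t j.
Proof.
rewrite /slice_point_poly raddf_sum /slice_point /slice_form.
rewrite mx_substZ lform_slice_list mx_subst_form.
rewrite /form_coord mcoeffZ raddf_sum mulr_sumr; apply: eq_bigr => i _ /=.
by rewrite mevalZ mcoeffZ -/(slice_coef t i) /form_coord; ring.
Qed.

Lemma meval_slice_map p t : (slice_map p).@[t] = p.@[slice_point t].
Proof.
rewrite /slice_map comp_mpoly_meval; apply: meval_eq => j.
by rewrite tnth_mktuple slice_point_polyE.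
Qed.

Lemma slice_map_inj p q : slice_map p = slice_map q -> p = q.
Proof.
move=> E; apply: (mpoly_eq_meval char0) => a.
have [t tE] := slice_form_surj char0 om_root (form_of_coord_homog (a : 'I_6 -> k)).
have aE : a =1 slice_point t by move=> j; rewrite /slice_point -tE form_of_coordK.
by rewrite !(meval_eq _ aE) -!meval_slice_map E.
Qed.

Lemma slice_mapM p q : slice_map (p * q) = slice_map p * slice_map q.
Proof. exact: rmorphM. Qed.
Lemma slice_mapD p q : slice_map (p + q) = slice_map p + slice_map q.
Proof. exact: raddfD. Qed.
Lemma slice_mapC c : slice_map c%:MP = c%:MP.
Proof. exact: comp_mpolyC. Qed.

Lemma slice_pointZ c t : slice_point (fun i => c * t i) =1 (fun i => c * slice_point t i).
Proof.
move=> j; rewrite -!slice_point_polyE /slice_point_poly !raddf_sum mulr_sumr.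
apply: eq_bigr => i _ /=; rewrite !mevalZ mulrCA; congr (_ * _); rewrite -!/(slice_coef _ i).
have [e0 e1 e2 e3 [e4 e5]] := slice_coefE (fun i => c * t i).
have [u0 u1 u2 u3 [u4 u5]] := slice_coefE t.
case: i => [[|[|[|[|[|[|i]]]]]] Hi] //; cbv [nat_of_ord];
  rewrite ?e0 ?e1 ?e2 ?e3 ?e4 ?e5 ?u0 ?u1 ?u2 ?u3 ?u4 ?u5; ring.
Qed.

Lemma Gamma_homog a : @Gamma k a -> forall F, F \is 5.-homog -> a F \is 5.-homog.
Proof.
elim=> [//|b _ IH F hF|b _ IH F hF] /=.
  by rewrite Gamma_rE rpredN mx_subst_homog // IH.
by rewrite Gamma_sE rpredN mx_subst_homog // IH.
Qed.

Lemma slice_map_even p : Gamma_invariant p -> s3_even (slice_map p).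
Proof.
move=> ip; have Gr : @Gamma k (@Gamma_r k \o id) by apply: Gamma_mul_r; exact: Gamma_id.
have Gs : @Gamma k (@Gamma_s k \o id) by apply: Gamma_mul_s; exact: Gamma_id.
apply: (s3_evenP char0 (om_cube om_root) (om_neq1 char0 om_root)) => t.
  rewrite !meval_slice_map /slice_point (slice_form_rotation om_root).
  exact: (ip _ Gr _ (slice_form_homog om t)).
rewrite !meval_slice_map /slice_point slice_form_swap.
exact: (ip _ Gs _ (slice_form_homog om t)).
Qed.

Lemma Gamma_invariant_subalg (X : {mpoly k[6]} -> Prop) f :
  (forall g, X g -> Gamma_invariant g) -> subalg (@mpolyC 6 k) X f -> Gamma_invariant f.
Proof.
move=> HX; elim=> [c|g /HX//|g h _ Hg _ Hh|g h _ Hg _ Hh] a Ga F hF.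
- by rewrite !mevalC.
- by rewrite !mevalD Hg // Hh.
by rewrite !mevalM Hg // Hh.
Qed.

Section MinimalGenerators.
Variable u : 'I_14 -> {mpoly k[6]}.
Hypothesis u_inv : forall i, Gamma_invariant (u i).
Hypothesis u_slice : forall i t,
  (u i).@[slice_point t] = tnth (gamma k) i * (tnth (s3_generators k) i).@[t].

Lemma slice_map_u i : slice_map (u i) = tnth (gamma k) i *: tnth (s3_generators k) i.
Proof.
by apply: (mpoly_eq_meval char0) => t; rewrite meval_slice_map u_slice mevalZ.
Qed.

(** Division by the nonzero [gamma] lifts the generators. Applied to the pullback of an invariant,
    the lift is that invariant itself by [slice_map_inj]. *)
Lemma even_lift g : s3_even g ->
  exists2 f, subalg (@mpolyC 6 k) (fun f => exists i, f = u i) f & slice_map f = g.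
Proof.
elim=> [c|_ [i ->]|g1 g2 _ [f1 H1 E1] _ [f2 H2 E2]|g1 g2 _ [f1 H1 E1] _ [f2 H2 E2]].
- by exists c%:MP; [exact: subalg_const|exact: slice_mapC].
- exists ((tnth (gamma k) i)^-1%:MP * u i).
    by apply: subalg_mul; [exact: subalg_const|apply: subalg_gen; exists i].
  rewrite slice_mapM slice_mapC slice_map_u mul_mpolyC scalerA mulVf ?scale1r //.
  exact: gamma_neq0.
- by exists (f1 + f2); [exact: subalg_add|rewrite slice_mapD E1 E2].
by exists (f1 * f2); [exact: subalg_mul|rewrite slice_mapM E1 E2].
Qed.

Lemma minimal_generators_of_slice :
  minimal_homogeneous_generators (@Gamma_invariant k) u (tnth generator_degrees).
Proof.
have gen : generates (@mpolyC 6 k) (fun f => exists i, f = u i) (@Gamma_invariant k).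
  move=> f; split=> [inv_f|]; last by apply: Gamma_invariant_subalg => _ [i ->].
  by have [f' Hf' /slice_map_inj <-] := even_lift (slice_map_even inv_f).
split=> // [i|J HJ].
  split.
    apply/eqP => u0; have /eqP := mcoeff_lead k i i.
    have /eqP := slice_map_u i; rewrite u0 /slice_map raddf0 eq_sym scaler_eq0.
    rewrite (negbTE (gamma_neq0 char0 i)) /= => /eqP ->.
    by rewrite eqxx mcoeff0 eq_sym oner_eq0.
  (* Degrees are read off in the coordinates t, where doubling t doubles the quintic. *)
  apply: (homog_of_meval char0) => a.
  have [t tE] := slice_form_surj char0 om_root (form_of_coord_homog (a : 'I_6 -> k)).
  have aE : a =1 slice_point t by move=> j; rewrite /slice_point -tE form_of_coordK.
  have a2E : (fun i => 2%:R * a i) =1 slice_point (fun i => 2%:R * t i).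
    by move=> j; rewrite slice_pointZ aE.
  rewrite [LHS](meval_eq (u i) a2E) (meval_eq (u i) aE).
  rewrite [LHS]u_slice (u_slice i t) [RHS]mulrCA; congr (_ * _).
  rewrite [LHS]meval_s3_generator (meval_s3_generator i t) (tnth_nth 0%N).
  case: i => [[|[|[|[|[|[|[|[|[|[|[|[|[|[|i]]]]]]]]]]]]]] Hi]; [..|by []];
    cbv [nth nat_of_ord generator_degrees tuple tval]; ring.
(* If i is missing from J, the pullback of u_i lies in an algebra on which the coefficient of the
   i-th distinguished monomial vanishes, whereas this coefficient is the i-th entry of [gamma]. *)
apply/setP => i; rewrite inE; apply: contraT => iJ.
have /HJ Hi : Gamma_invariant (u i) by exact: u_inv.
pose X g := exists2 j, j \in J & g = slice_map (u j).
have : subalg (@mpolyC 6 k) X (slice_map (u i)).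
  elim: Hi => [c|_ [j jJ ->]|f g _ Hf _ Hg|f g _ Hf _ Hg].
  - by rewrite slice_mapC; exact: subalg_const.
  - by apply: subalg_gen; exists j.
  - by rewrite slice_mapD; exact: subalg_add.
  by rewrite slice_mapM; exact: subalg_mul.
case/(@s3_indecomposable _ X i) => [g [j jJ ->]|_].
  exists j, (tnth (gamma k) j); split; last exact: slice_map_u.
  by apply: contraNneq iJ => <-.
rewrite slice_map_u mcoeffZ mcoeff_lead eqxx mulr1 => /eqP.
by rewrite (negbTE (gamma_neq0 char0 i)).
Qed.

End MinimalGenerators.
End SliceMap.

(** * Restriction of the generators to the slice *)

Section Restriction.
Variable k : fieldType.
Hypothesis char0 : [pchar k] =i pred0.
Implicit Types (F : {mpoly k[2]}) (P Q : {mpoly k[6 + 4]}).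

Definition D0 : k := (inv_D k).@[pair_coord 0 (G0 k)].

Lemma inv_D_G0 F : F \is 5.-homog -> (inv_D k).@[pair_coord F (G0 k)] = D0.
Proof. by move=> hF; apply: inv_D_indep => //; [exact: dhomog0|exact: G0_homog]. Qed.

Lemma restrictM P Q : restrict (P * Q) = restrict P * restrict Q.
Proof. exact: rmorphM. Qed.
Lemma restrictD P Q : restrict (P + Q) = restrict P + restrict Q.
Proof. exact: raddfD. Qed.
Lemma restrictX P n : restrict (P ^+ n) = restrict P ^+ n.
Proof. exact: rmorphXn. Qed.
Lemma restrictC (c : k) : restrict c%:MP = c%:MP.
Proof. exact: comp_mpolyC. Qed.

Lemma restrict_inv_D : restrict (inv_D k) = D0%:MP.
Proof.
apply: (mpoly_eq_meval char0) => a; rewrite restrict_meval mevalC inv_D_G0 //.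
exact: form_of_coord_homog.
Qed.

(** D restricts to the constant D0, so the inverse taken in the polynomial ring is that of a
    scalar. *)
Lemma slice_generatorE i : slice_generator k i =
  ((tnth den_const i)%:R * D0 ^+ tnth den_exp i)^-1 *: restrict (tnth (generators k) i).1.
Proof.
rewrite /slice_generator denominatorE restrictM restrictX restrict_inv_D.
rewrite -[_%:R]mpolyC_nat restrictC -rmorphXn -mpolyCM mpolyC_inv.
by rewrite mulrC mul_mpolyC.
Qed.

(** Stated for abstract nonzero scalars, so that [field] does not see the powers they stand for. *)
Lemma cancel_power_ratio (x y z w : k) : x != 0 -> y != 0 -> z != 0 ->
  (x * (y * z))^-1 * (y * (x * z * w)) = w.
Proof. by move=> x0 y0 z0; field; rewrite x0 y0 z0. Qed.

End Restriction.

(** * Absolute invariants *)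

Section AbsoluteInvariants.
Variable k : fieldType.
Hypothesis closed_k : GRing.closed_field_axiom k.
Hypothesis char0 : [pchar k] =i pred0.
Notation coordring := {mpoly k[6 + 4]}.
Implicit Types (F G : {mpoly k[2]}) (P : coordring) (f : {fraction coordring}).
Variable om : k.
Hypothesis om_root : om ^+ 2 = -1 - om.

Lemma D0_neq0 : D0 k != 0.
Proof. exact: (inv_D_slice closed_k char0 om_root). Qed.

Lemma slice_generator_value i t : (slice_generator k i).@[slice_point om t] =
  tnth (gamma k) i * (tnth (s3_generators k) i).@[t].
Proof.
have hF := slice_form_homog om t.
rewrite (slice_generatorE char0) mevalZ (restrict_meval_form _ hF).
have [c c0 Hc] := slice_pair closed_k char0 om_root t.
rewrite (Hc _ _ (numerator_joint char0 i)) numerator_value //.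
(* The c that scales the numerator also scales D, hence its powers cancel. *)
have DE : D0 k = c ^+ 4 * - 2%:R.
  by rewrite -(inv_D_G0 hF) (Hc _ _ (inv_D_joint char0)) slice_inv_D.
have n2 : - 2%:R != 0 :> k by rewrite oppr_eq0 natr_neq0.
rewrite DE exprMn -exprM.
have cm : c ^+ (4 * tnth den_exp i) != 0 by rewrite expf_neq0.
have dm : (- 2%:R) ^+ tnth den_exp i != 0 :> k by rewrite expf_neq0.
have nc := den_const_neq0 char0 i.
exact: cancel_power_ratio.
Qed.

(* D takes the same nonzero value at all points of the slice, so it detects that the
   factor by which an element of Gamma multiplies P is 1. *)
Lemma restrict_Gamma_invariant d m P : joint_invariant d P -> inv_D k ^+ m \is d.-homog ->
  Gamma_invariant (restrict P).
Proof.
move=> JP hD; have JD : joint_invariant d (inv_D k ^+ m).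
  by split=> //; case: (joint_invariantX m (inv_D_joint char0)).
have step g e F : \det g != 0 -> e != 0 -> G0 k = e *: mx_subst g (G0 k) -> F \is 5.-homog ->
    P.@[pair_coord (e *: mx_subst g F) (G0 k)] = P.@[pair_coord (\det g *: F) (G0 k)].
  move=> dg e0 G0E hF; have [c c0 Hc] := joint_invariant_move closed_k dg e0 hF (G0_homog k).
  have hF1 : e *: mx_subst g F \is 5.-homog by apply/rpredZ/mx_subst_homog.
  have hF2 : \det g *: F \is 5.-homog by exact: rpredZ.
  have E := Hc _ _ JD; have EP := Hc _ _ JP; rewrite -G0E in E; rewrite -G0E in EP.
  have cd : c ^+ d = 1.
    apply: (mulIf (expf_neq0 m D0_neq0)); rewrite mul1r.
    have D0E F' : F' \is 5.-homog -> (inv_D k ^+ m).@[pair_coord F' (G0 k)] = D0 k ^+ m.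
      by move=> hF'; rewrite [LHS]rmorphXn; congr (_ ^+ m); exact: inv_D_G0.
    by rewrite -{1}(D0E _ hF2) -E (D0E _ hF1).
  by rewrite EP cd mul1r.
(* The matrix of r has determinant 1 and sends G0 to - G0; that of s has determinant -1 and fixes
   G0. The minus sign in [Gamma_r] thus comes from the cubic, the one in [Gamma_s] from the
   determinant. *)
have G0rE : G0 k = -1 *: mx_subst (mx2 1 (-1) 1 0) (G0 k).
  have [ex ey] := @mx2_subst k 1 (-1) 1 0.
  rewrite {2}/G0 !mx_substM mx_substB ex ey /G0 !scaleN1r !scale1r scale0r; ring.
have G0sE : G0 k = 1 *: mx_subst (mx2 (-1) 1 0 1) (G0 k).
  have [ex ey] := @mx2_subst k (-1) 1 0 1.
  rewrite {2}/G0 !mx_substM mx_substB ex ey /G0 !scaleN1r !scale1r scale0r; ring.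
move=> a0; elim=> {a0} [//|a Ga IH F hF|a Ga IH F hF] /=.
  have haF := Gamma_homog Ga hF; rewrite -(IH F hF).
  rewrite !(restrict_meval_form _ _) // ?Gamma_rE ?rpredN ?mx_subst_homog //.
  rewrite -scaleN1r (step _ _ _ _ _ G0rE haF) ?oppr_eq0 ?oner_neq0 // ?det_mx2.
    by rewrite (_ : 1 * 0 - -1 * 1 = 1) ?scale1r //; ring.
  by rewrite (_ : 1 * 0 - -1 * 1 = 1) ?oner_neq0 //; ring.
have haF := Gamma_homog Ga hF; rewrite -(IH F hF).
rewrite !(restrict_meval_form _ _) // ?Gamma_sE ?rpredN ?mx_subst_homog //.
have haFN : - a F \is 5.-homog by rewrite rpredN.
have -> : - mx_subst (mx2 (-1) 1 0 1) (a F) = 1 *: mx_subst (mx2 (-1) 1 0 1) (- a F).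
  by rewrite scale1r; exact: esym (raddfN _ _).
rewrite (step _ _ _ _ _ G0sE haFN) ?oner_neq0 // ?det_mx2.
  by rewrite (_ : -1 * 1 - 1 * 0 = -1) ?scaleN1r ?opprK //; ring.
by rewrite (_ : -1 * 1 - 1 * 0 = -1) ?oppr_eq0 ?oner_neq0 //; ring.
Qed.

Lemma slice_generator_Gamma_invariant i : Gamma_invariant (slice_generator k i).
Proof.
have JN := numerator_joint char0 i.
have [_ hD] := joint_invariantX (tnth den_exp i) (inv_D_joint char0).
move=> a Ga F hF; rewrite (slice_generatorE char0) !mevalZ; congr (_ * _).
exact: (restrict_Gamma_invariant JN hD Ga hF).
Qed.

Lemma slice_generators_minimal :
  minimal_homogeneous_generators (@Gamma_invariant k) (@slice_generator k)
    (tnth generator_degrees).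
Proof.
exact: (minimal_generators_of_slice char0 om_root slice_generator_Gamma_invariant
  slice_generator_value).
Qed.

(** Numerator, exponent and degree stay explicit: a fraction has many representations, and
    restriction to the slice is defined on numerators. *)
Definition fraction_rep f P m d :=
  [/\ joint_invariant d P, inv_D k ^+ m \is d.-homog & f = tofrac P / tofrac (inv_D k ^+ m)].

Lemma fraction_rep_absolute f P m d : fraction_rep f P m d -> absolute_invariant f.
Proof. by case=> [[iP hP] hD fE]; exists P, m, d. Qed.

Lemma inv_D_neq0 : inv_D k != 0.
Proof.
by apply: contraNneq D0_neq0 => D00; rewrite /D0 D00 meval0.
Qed.

Lemma tofrac_D_neq0 m : tofrac (inv_D k ^+ m) != 0.
Proof. by rewrite tofrac_eq0 expf_neq0 // inv_D_neq0. Qed.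

Lemma fraction_repD f g P Q m n d e : fraction_rep f P m d -> fraction_rep g Q n e ->
  fraction_rep (f + g) (P * inv_D k ^+ n + Q * inv_D k ^+ m) (m + n) (d + e).
Proof.
move=> [JP hDm ->] [JQ hDn ->].
have JDm : joint_invariant d (inv_D k ^+ m).
  by split=> //; case: (joint_invariantX m (inv_D_joint char0)).
have JDn : joint_invariant e (inv_D k ^+ n).
  by split=> //; case: (joint_invariantX n (inv_D_joint char0)).
split; [|by rewrite exprD; exact: dhomogM|].
  apply: (joint_invariantD (joint_invariantM JP JDn) (joint_invariantM JQ JDm)).
  by rewrite addnC.
by rewrite addf_div ?tofrac_D_neq0 // exprD tofracD !tofracM.
Qed.

Lemma fraction_repM f g P Q m n d e : fraction_rep f P m d -> fraction_rep g Q n e ->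
  fraction_rep (f * g) (P * Q) (m + n) (d + e).
Proof.
move=> [JP hDm ->] [JQ hDn ->].
split; [exact: joint_invariantM|by rewrite exprD; exact: dhomogM|].
by rewrite exprD !tofracM invfM mulrACA.
Qed.

Lemma fraction_repC c : fraction_rep (frac_const c) c%:MP 0 0.
Proof.
by split; [exact: joint_invariantC|rewrite expr0; exact: dhomog1|rewrite expr0 tofrac1 divr1].
Qed.

Lemma fraction_rep_generator i : fraction_rep (generator k i)
  ((tnth den_const i)%:R^-1%:MP * (tnth (generators k) i).1)
  (tnth den_exp i) (4 * tnth den_exp i).
Proof.
split.
- exact: (joint_invariantM (joint_invariantC _) (numerator_joint char0 i)).
- by case: (joint_invariantX (tnth den_exp i) (inv_D_joint char0)).
have cE : tofrac ((tnth den_const i)%:R^-1%:MP : coordring) =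
    (tofrac ((tnth den_const i)%:R : coordring))^-1.
  have nz := den_const_neq0 char0 i.
  have e1 : (tnth den_const i)%:R * (tnth den_const i)%:R^-1%:MP = 1 :> coordring.
    by rewrite -mpolyC_nat -mpolyCM divff.
  by apply/esym/mulr1_eq; rewrite -tofracM e1 tofrac1.
rewrite /generator (denominatorE k i) !tofracM cE invfM mulrA; congr (_ / _).
by rewrite mulrC.
Qed.

Lemma absolute_subalg f :
  subalg (@frac_const k) (fun g => exists i, g = generator k i) f -> absolute_invariant f.
Proof.
move=> Hf; suff [P [m [d /fraction_rep_absolute]]] : exists P m d, fraction_rep f P m d by [].
elim: Hf => [c|_ [i ->]|g h _ [P [m [d R]]] _ [Q [n [e R']]]
  |g h _ [P [m [d R]]] _ [Q [n [e R']]]].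
- by exists c%:MP, 0%N, 0%N; exact: fraction_repC.
- by do 3!eexists; exact: fraction_rep_generator.
- by do 3!eexists; exact: fraction_repD R R'.
by do 3!eexists; exact: fraction_repM R R'.
Qed.

(** The expression of p in the restricted generators is evaluated at the generators themselves; the
    power of D0 accounts for the denominator of the fraction obtained. *)
Lemma restrict_lift p :
  subalg (@mpolyC 6 k) (fun g => exists i, g = slice_generator k i) p ->
  exists f P m d, [/\ subalg (@frac_const k) (fun g => exists i, g = generator k i) f,
    fraction_rep f P m d & restrict P = D0 k ^+ m *: p].
Proof.
elim=> [c|_ [i ->]|g h _ [f1 [P [m [d [S R E]]]]] _ [f2 [Q [n [e [S' R' E']]]]]
  |g h _ [f1 [P [m [d [S R E]]]]] _ [f2 [Q [n [e [S' R' E']]]]]].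
- exists (frac_const c), c%:MP, 0%N, 0%N; split; [exact: subalg_const|exact: fraction_repC|].
  by rewrite restrictC expr0 scale1r.
- exists (generator k i); do 3!eexists; split; first by apply: subalg_gen; exists i.
    exact: fraction_rep_generator.
  rewrite restrictM restrictC mul_mpolyC (slice_generatorE char0) scalerA; congr (_ *: _).
  by rewrite invfM mulrCA divff ?mulr1 // expf_neq0 // D0_neq0.
- exists (f1 + f2); do 3!eexists; split; [exact: subalg_add|exact: fraction_repD R R'|].
  rewrite restrictD !restrictM !restrictX (restrict_inv_D char0) E E' exprD -!rmorphXn /=.
  rewrite ![_ * _%:MP]mulrC !mul_mpolyC !scalerA scalerDr.
  by congr (_ *: _ + _ *: _); rewrite mulrC.
exists (f1 * f2); do 3!eexists; split; [exact: subalg_mul|exact: fraction_repM R R'|].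
by rewrite restrictM E E' exprD -scalerAl -scalerAr scalerA.
Qed.

Lemma absolute_invariants_generated : generates (@frac_const k)
  (fun f => exists i, f = generator k i) (@absolute_invariant k).
Proof.
move=> f; split=> [[P [m [d [iP hP hD fE]]]]|]; last exact: absolute_subalg.
have JP : joint_invariant d P by [].
have [gen _ _] := slice_generators_minimal.
have Dm0 n : D0 k ^+ n != 0 by rewrite expf_neq0 // D0_neq0.
(* The restriction of f to the slice, where D^m is the constant D0^m. *)
pose p := (D0 k ^+ m)^-1 *: restrict P.
have /gen Hp : Gamma_invariant p.
  by move=> a Ga F hF; rewrite !mevalZ (restrict_Gamma_invariant JP hD Ga hF).
have [f' [P' [m' [d' [Hf' [JP' hD' f'E] P'E]]]]] := restrict_lift Hp.
suff -> : f = f' by [].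
have JDm : joint_invariant d (inv_D k ^+ m).
  by split=> //; case: (joint_invariantX m (inv_D_joint char0)).
have JDm' : joint_invariant d' (inv_D k ^+ m').
  by split=> //; case: (joint_invariantX m' (inv_D_joint char0)).
(* After cross-multiplication the difference of f and its lift is a homogeneous joint invariant that
   restricts to zero. *)
have JZ : joint_invariant (d + d') (P * inv_D k ^+ m' - P' * inv_D k ^+ m).
  apply: (joint_invariantD (joint_invariantM JP JDm')).
    exact: joint_invariantN (joint_invariantM JP' JDm).
  by rewrite addnC.
have /subr0_eq Z0 : P * inv_D k ^+ m' - P' * inv_D k ^+ m = 0.
  apply: (joint_invariant_vanish closed_k char0 JZ).
  have powC n : (D0 k)%:MP ^+ n = (D0 k ^+ n)%:MP :> {mpoly k[6]}.
    exact: esym (rmorphXn (@mpolyC 6 k) n _).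
  rewrite restrictD -mulNr !restrictM !restrictX (restrict_inv_D char0) !powC.
  have -> : restrict (- P') = - restrict P' by exact: raddfN.
  rewrite P'E /p scalerA mulNr ![_ * _%:MP]mulrC !mul_mpolyC scalerA.
  by rewrite mulrCA divff // mulr1 subrr.
by rewrite fE f'E; apply/eqP; rewrite eqr_div ?tofrac_D_neq0 // -!tofracM Z0.
Qed.

End AbsoluteInvariants.

Theorem corollary6p6 (k : closedFieldType) (char0 : [pchar k] =i pred0) :
  generates (@frac_const k) (fun f => exists i, f = @generator k i)
    (@absolute_invariant k)
  /\ minimal_homogeneous_generators (@Gamma_invariant k)
       (@slice_generator k) (tnth generator_degrees).
Proof.
have closed_k := @solve_monicpoly k.
(* All coefficients -1 encode z^2 = -1 - z, whose roots are primitive cube roots of unity in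
   characteristic zero. *)
have [om omE] := closed_k 2%N (fun=> -1) isT.
have om_root : om ^+ 2 = -1 - om.
  by rewrite omE !big_ord_recl big_ord0 /= mulr1 addr0 mulN1r.
split; first exact: (absolute_invariants_generated closed_k char0 om_root).
exact: (slice_generators_minimal closed_k char0 om_root).
Qed.
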